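(* Let $\mu^1=\mu^1_t(dx)\,dt$ and $\mu^2=\mu^2_t(dx)\,dt$ be two solutions to the Cauchy problem $$\partial_t\mu+\mathrm{div}(b\mu)=0,\qquad \mu|_{t=0}=\nu$$ on $\mathbb{R}^d\times[0,T]$ (with the same $b$ and the same locally bounded Borel measure $\nu$ on $\mathbb{R}^d$). Put $\mu_t=\mu_t^1-\mu_t^2$ and $\mu=\mu_t(dx)\,dt$. Assume that: (i) $\displaystyle\lim_{N\to\infty}N^{-1}\int_0^T\int_{N<|x|<2N}|b(x,t)|\,|\mu_t|(dx)\,dt=0$; and that for every ball $U\subset\mathbb{R}^d$ one can find numbers $C>0$ and $\delta>0$, a sequence of vector fields $b_k\in C^\infty(U\times\mathbb{R}^1,\mathbb{R}^d)$ and a sequence of positive functions $V_k\in C^1(U)$ (all depending on the measure $\mu$ and the ball $U$) such that (ii) $\inf_k\inf_{x\in U}V_k(x)>0$ and $$\langle b_k(x,t),\nabla V_k(x)\rangle\le\Bigl(C-\delta|b_k(x,t)|^2-2\max_{|\xi|=1}\langle\mathcal{B}_k(x,t)\xi,\xi\rangle\Bigr)V_k(x)$$ for every $k$ and all $(x,t)\in U\times[0,T]$, where $\mathcal{B}_k=(\partial_{x_i}b_k^j)_{i,j\le d}$; (iii) $\displaystyle\lim_{k\to\infty}\int_0^T\int_U|b_k(x,t)-b(x,t)|\sqrt{V_k(x)}\,|\mu_t|(dx)\,dt=0$. Then $\mu=0$, i.e., $\mu^1=\mu^2$.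
   Context: $T>0$ is fixed and $b\colon\mathbb{R}^d\times[0,T]\to\mathbb{R}^d$ is a Borel vector field. A locally bounded Borel measure on $\mathbb{R}^d$ is a real-valued (possibly signed) function on the class of all bounded Borel sets that is countably additive on the Borel subsets of every compact set; locally bounded Borel measures on $\mathbb{R}^d\times[0,T]$ are defined similarly. $|\mu|$ denotes the total variation of $\mu$. A locally bounded Borel measure $\mu$ on $\mathbb{R}^d\times[0,T]$ is given by a family of locally bounded Borel measures $(\mu_t)_{t\in[0,T]}$ on $\mathbb{R}^d$ (written $\mu=\mu_t(dx)\,dt$) if for every bounded Borel set $B\subset\mathbb{R}^d$ the mapping $t\mapsto\mu_t(B)$ is measurable, $t\mapsto|\mu_t|(K)$ belongs to $L^1[0,T]$ for every compact $K\subset\mathbb{R}^d$, and $$\int_0^T\int_{\mathbb{R}^d}u(x,t)\,\mu(dx\,dt)=\int_0^T\int_{\mathbb{R}^d}u(x,t)\,\mu_t(dx)\,dt\quad\text{for all }u\in C_0^\infty(\mathbb{R}^d\times(0,T)).$$ A solution to the Cauchy problem $\partial_t\mu+\mathrm{div}(b\mu)=0$, $\mu|_{t=0}=\nu$, is a locally bounded Borel measure $\mu$ on $\mathbb{R}^d\times[0,T]$ given by a family $(\mu_t)_{t\in[0,T]}$ of locally bounded Borel measures such that $b\in L^1(|\mu|,U\times[0,T])$ for every ball $U\subset\mathbb{R}^d$ and, for every function $u$ that is continuous on $\mathbb{R}^d\times[0,T)$ along with its first order derivatives in $t$ and $x$ and satisfies $u(x,t)=0$ whenever $|x|>R$ for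 some $R$, one has $$\int_{\mathbb{R}^d}u(x,t)\,\mu_t(dx)=\int_{\mathbb{R}^d}u(x,0)\,\nu(dx)+\int_0^t\int_{\mathbb{R}^d}\bigl[\partial_tu+\langle b,\nabla u\rangle\bigr]\,\mu_s(dx)\,ds$$ for almost every $t\in[0,T]$. Two measures given by families $(\mu^1_t)$, $(\mu^2_t)$ are equal iff $\mu^1_t=\mu^2_t$ for almost every $t\in[0,T]$. *)

(* Defs.v *)
From mathcomp Require Import all_boot all_order all_algebra.
From mathcomp Require Import all_classical all_reals all_analysis.

Set Implicit Arguments.
Unset Strict Implicit.
Unset Printing Implicit Defensive.
Import Order.TTheory GRing.Theory Num.Theory.
Import numFieldNormedType.Exports.

Local Open Scope classical_set_scope.
Local Open Scope ring_scope.

Notation borel X := (g_sigma_algebraType (@open X)).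

(* The line with all its Lebesgue (= Caratheodory) measurable sets, and Lebesgue
   measure on them, so that "measurable in t" is not restricted to Borel
   measurability. *)
Notation lebesgue_line R :=
  (caratheodory_type (wlength (@idfun (Real.sort R)))^*%mu).
Notation leb R := (@completed_lebesgue_measure R).

(* MathComp-Analysis equips 'rV[R]_d with the max-norm; vector norms and
   balls here are Euclidean. *)
Section Euclidean.
Context {R : realType} {d : nat}.
Implicit Types x y : 'rV[R]_d.

Definition dotp x y : R := \sum_i x 0 i * y 0 i.
Definition enorm x : R := Num.sqrt (dotp x x).
Definition eball (c : 'rV[R]_d) (r : R) : set 'rV[R]_d :=
  [set x | enorm (x - c) < r].

Definition unit_row (i : 'I_d) : 'rV[R]_d := delta_mx 0 i.
Definition grad (f : 'rV[R]_d -> R) x : 'rV[R]_d :=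
  \row_i 'D_(unit_row i) f x.
Definition partials (f : 'rV[R]_d -> 'rV[R]_d) x : 'M[R]_d :=
  \matrix_(i, j) 'D_(unit_row i) (fun y => f y 0 j) x.

(* The supremum over the unit sphere, attained when 0 < d. Vectors are rows, so
   the matrix-vector product B xi is xi *m B^T. *)
Definition max_form (B : 'M[R]_d) : R :=
  sup [set dotp (xi *m B^T) xi | xi in [set xi : 'rV[R]_d | enorm xi = 1]].
End Euclidean.

(* C^n and C^oo on an open set U: all iterated directional derivatives up to
   order n (resp. of every order) exist and are continuous on U; in finite
   dimension this is the same as continuity of the partial derivatives. *)
Section Smooth.
Context {R : realType} {V W : normedModType R}.

Fixpoint class_C (n : nat) (U : set V) (f : V -> W) : Prop :=
  (forall x, U x -> {for x, continuous f}) /\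
  if n is m.+1 then
    forall v, (forall x, U x -> derivable f x v) /\ class_C m U ('D_v f)
  else True.

Definition class_Coo (U : set V) (f : V -> W) : Prop :=
  forall n, class_C n U f.
End Smooth.

(* Locally bounded (signed) Borel measures on a closed subset D of X are
   represented by functions on sets, of which only the values on bounded Borel
   subsets of D matter. *)
Section LocallyBoundedMeasures.
Context {R : realType} {X : normedModType R}.
Implicit Types (D A K : set X) (m : set X -> R).

Definition bounded_borel D A : Prop :=
  [/\ measurable (A : set (borel X)), bounded_set A & A `<=` D].

Definition locally_bounded_measure D m : Prop :=
  forall K, compact K -> K `<=` D ->
  forall F : (set X)^nat,
    (forall n, measurable (F n : set (borel X)) /\ F n `<=` K) ->
    trivIset setT F ->
    \sum_(0 <= i < n) m (F i) @[n --> \oo] --> m (\bigcup_n F n).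

(* Jordan decomposition: m^+(A) = sup {m(B) : B subset of A}. The charges of
   the library are finite, hence its Jordan decomposition does not apply; here
   m^+ and m^- are possibly infinite Borel measures. *)
Definition pos_measure D m : set (borel X) -> \bar R := fun A =>
  ereal_sup [set (m B)%:E | B in [set B | bounded_borel D B /\ B `<=` A]].

Definition neg_measure D m : set (borel X) -> \bar R :=
  pos_measure D (fun B => - m B).

Definition abs_measure D m : set (borel X) -> \bar R :=
  (pos_measure D m \+ neg_measure D m)%E.

Definition signed_integral D m (f : X -> R) : R :=
  fine (\int[pos_measure D m]_(x in D) (f x)%:E)%E -
  fine (\int[neg_measure D m]_(x in D) (f x)%:E)%E.
End LocallyBoundedMeasures.

Section Continuity.
Context {R : realType} {d : nat}.
Local Notation E := 'rV[R]_d.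
Implicit Types (T : R) (mut : R -> set E -> R).

Definition slab T : set (E * R) := [set: E] `*` `[0, T].
Definition open_slab T : set (E * R) := [set: E] `*` `]0, T[.

(* mu = mu_t(dx) dt *)
Record given_by T (mu : set (E * R) -> R) mut : Prop := GivenBy {
  given_by_measure : locally_bounded_measure (slab T) mu ;
  given_by_slice : forall t, t \in `[0, T] ->
    locally_bounded_measure setT (mut t) ;
  given_by_measurable : forall B, bounded_borel setT B ->
    measurable_fun (`[0, T] : set (lebesgue_line R)) (fun t => mut t B) ;
  given_by_integrable : forall K : set E, compact K ->
    (leb R).-integrable `[0, T] (fun t => abs_measure setT (mut t) K) ;
  given_by_test : forall u : E * R -> R, class_Coo setT u ->
    compact (closure [set z | u z != 0]) ->
    closure [set z | u z != 0] `<=` open_slab T ->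
    signed_integral (slab T) mu u =
    \int[leb R]_(t in `[0, T]) signed_integral setT (mut t) (fun x => u (x, t))
}.

(* Derivative relative to A; one-sided at an endpoint of an interval A. *)
Definition quotient_within (A : set R) (f : R -> R) (t : R) : set_system R :=
  (fun h => h^-1 * (f (t + h) - f t)) @ within [set h | A (t + h)] 0^'.
Definition derive_within A f t : R := lim (quotient_within A f t).

Definition time_derive T (u : E * R -> R) (z : E * R) : R :=
  derive_within `[0, T[ (fun t => u (z.1, t)) z.2.
Definition space_grad (u : E * R -> R) (z : E * R) : E :=
  grad (fun x => u (x, z.2)) z.1.

Record test_function T (u : E * R -> R) (Q := [set: E] `*` `[0, T[)
    : Prop := TestFunction {
  test_continuous : {within Q, continuous u} ;
  test_time_derivable : forall z, Q z ->
    cvg (quotient_within `[0, T[ (fun t => u (z.1, t)) z.2) ;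
  test_time_continuous : {within Q, continuous (time_derive T u)} ;
  test_space_derivable : forall z i, Q z ->
    derivable (fun x => u (x, z.2)) z.1 (unit_row i) ;
  test_space_continuous : {within Q, continuous (space_grad u)} ;
  test_support : exists r : R, forall z, Q z -> r < enorm z.1 -> u z = 0
}.

Record cauchy_solution T (b : E * R -> E) (nu : set E -> R)
    (mu : set (E * R) -> R) mut : Prop := CauchySolution {
  solution_given_by : given_by T mu mut ;
  solution_integrable : forall (c : E) (r : R), 0 < r ->
    (abs_measure (slab T) mu).-integrable (eball c r `*` `[0, T])
      (fun z => (enorm (b z))%:E) ;
  solution_equation : forall u, test_function T u ->
    {ae leb R, forall t : R, t \in `[0, T] ->
      signed_integral setT (mut t) (fun x => u (x, t)) =
      signed_integral setT nu (fun x => u (x, 0)) +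
      \int[leb R]_(s in `[0, t]) signed_integral setT (mut s) (fun x =>
        time_derive T u (x, s) + dotp (b (x, s)) (space_grad u (x, s)))}
}.

(* Equality of the measures given by two families; the values on the slices
   t = 0 and t = T of a measure given by a family are not constrained by it. *)
Definition same_family T mut1 mut2 : Prop :=
  {ae leb R, forall t : R, t \in `[0, T] ->
    forall B, bounded_borel setT B -> mut1 t B = mut2 t B}.
End Continuity.

(* Main.v *)
(** The difference [m_t] of the two solutions is tested against [u = phi_N * f], where
[phi_N] is a cut-off at radius [N] and [f] interpolates in time, by quadratic splines,
the explicit Euler scheme [f_(j+1) = f_j \o (id + h B)] for the backward transport
equation of [B = th^2 b_k] ([th] another cut-off), started from the given test function
[psi].  The scheme avoids any ODE theory, and condition (ii) yields for it a discrete
Lyapunov bound [|grad f_j|^2 <= S V_k] with [S] independent of [k] and of the step [h].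
Since [df/dt + <b, grad f>] differs from [<b - b_k, grad f>] by [O(h)] where [th = 1],
one obtains, for almost every [t],
  [|int psi phi_N dm_t| <= C_k h + 5 sqrt S int int |b_k - b| sqrt V_k d|m_t| dt
                           + (15 / N) int int_(N < |x| < 2N) |b| d|m_t| dt],
and [h -> 0], [k -> oo], [N -> oo] in this order gives [int psi dm_t = 0], for countably
many [psi] that determine [m_t].
  The equation only provides integrability of [b] against the total variation of the
measure on space-time; that this bounds the iterated integral against [|m_t| dt] follows
from identifying the measure with [m_t(dx)dt] on Borel sets of the open slab and slicing
a Hahn set. *)
From HB Require Import structures.
Require Import Defs.
From mathcomp Require Import all_boot all_order all_algebra.
From mathcomp Require Import all_classical all_reals all_analysis.
From mathcomp Require Import measurable_realfun.
From mathcomp Require Import ring lra.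
Set Implicit Arguments.
Unset Strict Implicit.
Unset Printing Implicit Defensive.
Import Order.TTheory GRing.Theory Num.Theory.
Import numFieldNormedType.Exports.
Local Open Scope classical_set_scope.
Local Open Scope ring_scope.

(** * Euclidean norm and Borel sets *)

(** The Lyapunov bound rests on a cancellation. One Euler step turns a gradient v into v + h A v,
    with A the transposed Jacobian of B, and multiplies |v|^2 by about 1 + 2 h <A v, v> / |v|^2;
    along the step V gains the factor 1 + h <B, grad V> / V. Condition (ii) bounds the sum of the
    two rates, so |grad f_j|^2 / V grows at a bounded rate. The localisation of b_k by th^2 creates
    the term 4 th <grad th, v> <b_k, v>, for which no bound uniform in k is known; the square leaves
    a factor th in it, so that the reserve th^2 delta |b_k|^2 of (ii) absorbs it. Lipschitz bounds
    of B and the modulus of continuity of grad V may depend on k: they enter only C_k and the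
    admissible size of h, and h -> 0 comes first. The 5 bounds the value of a spline interpolation
    by that of its nodes, and 15 = 5 * 3 with |grad phi_N| <= 3 / N. Condition (ii) is used on the
    ball of radius 6 N: phi_N lives in radius 2 N, th in 4 N, and Euler steps need one more N. The
    null sets of t stay under control because only countably many steps h, numbers of steps and test
    functions occur. *)

Section EuclideanAlgebra.
Context {R : realType} {d : nat}.
Implicit Types (x y z : 'rV[R]_d) (a r : R).

Lemma dotpC x y : dotp x y = dotp y x.
Proof. by apply: eq_bigr => i _; rewrite mulrC. Qed.

Lemma dotpDl x y z : dotp (x + y) z = dotp x z + dotp y z.
Proof. by rewrite -big_split; apply: eq_bigr => i _; rewrite mxE mulrDl. Qed.

Lemma dotpZl a x y : dotp (a *: x) y = a * dotp x y.
Proof. by rewrite mulr_sumr; apply: eq_bigr => i _; rewrite mxE mulrA. Qed.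

Lemma dotpNl x y : dotp (- x) y = - dotp x y.
Proof. by rewrite -scaleN1r dotpZl mulN1r. Qed.

Lemma dotpBl x y z : dotp (x - y) z = dotp x z - dotp y z.
Proof. by rewrite dotpDl dotpNl. Qed.

Lemma dotpDr x y z : dotp x (y + z) = dotp x y + dotp x z.
Proof. by rewrite dotpC dotpDl !(dotpC x). Qed.

Lemma dotpZr a x y : dotp x (a *: y) = a * dotp x y.
Proof. by rewrite dotpC dotpZl dotpC. Qed.

Lemma dotpNr x y : dotp x (- y) = - dotp x y.
Proof. by rewrite dotpC dotpNl dotpC. Qed.

Lemma dotpBr x y z : dotp x (y - z) = dotp x y - dotp x z.
Proof. by rewrite dotpDr dotpNr. Qed.

Lemma dotp0l x : dotp 0 x = 0.
Proof. by rewrite -(scale0r 0) dotpZl mul0r. Qed.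

Lemma dotp0r x : dotp x 0 = 0.
Proof. by rewrite dotpC dotp0l. Qed.

Lemma dotp_ge0 x : 0 <= dotp x x.
Proof. by apply: sumr_ge0 => i _; rewrite -expr2 sqr_ge0. Qed.

Lemma enorm_ge0 x : 0 <= enorm x.
Proof. exact: sqrtr_ge0. Qed.

Lemma sqr_enorm x : enorm x ^+ 2 = dotp x x.
Proof. by rewrite sqr_sqrtr ?dotp_ge0. Qed.

Lemma enorm0 : enorm (0 : 'rV[R]_d) = 0.
Proof. by rewrite /enorm dotp0l sqrtr0. Qed.

Lemma enormZ a x : enorm (a *: x) = `|a| * enorm x.
Proof.
by rewrite /enorm dotpZl dotpZr mulrA -expr2 sqrtrM ?sqr_ge0// sqrtr_sqr.
Qed.

Lemma enormN x : enorm (- x) = enorm x.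
Proof. by rewrite -scaleN1r enormZ normrN1 mul1r. Qed.

Lemma enormB x y : enorm (x - y) = enorm (y - x).
Proof. by rewrite -enormN opprB. Qed.

Lemma coord_le_enorm x i : `|x 0 i| <= enorm x.
Proof.
rewrite -sqrtr_sqr; apply: ler_wsqrtr; rewrite /dotp (bigD1 i)//= expr2 lerDl.
by apply: sumr_ge0 => j _; rewrite -expr2 sqr_ge0.
Qed.

Lemma enorm_eq0 x : enorm x = 0 -> x = 0.
Proof.
move=> x0; apply/rowP => i; rewrite mxE; apply/eqP; rewrite -normr_le0 -x0.
exact: coord_le_enorm.
Qed.

Lemma ler_dotp x y : dotp x y <= enorm x * enorm y.
Proof.
have [/enorm_eq0 ->|y0] := eqVneq (enorm y) 0.
  by rewrite dotp0r enorm0 mulr0.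
have [/enorm_eq0 ->|x0] := eqVneq (enorm x) 0.
  by rewrite dotp0l enorm0 mul0r.
have xp : 0 < enorm x by rewrite lt_def x0 enorm_ge0.
have yp : 0 < enorm y by rewrite lt_def y0 enorm_ge0.
have := dotp_ge0 ((enorm x)^-1 *: x - (enorm y)^-1 *: y).
rewrite dotpBl !dotpBr !dotpZl !dotpZr -!sqr_enorm (dotpC y x) => H.
have {}H : dotp x y * ((enorm x)^-1 * (enorm y)^-1) <= 1.
  have e1 : (enorm x)^-1 * ((enorm x)^-1 * enorm x ^+ 2) = 1 by field.
  have e2 : (enorm y)^-1 * ((enorm y)^-1 * enorm y ^+ 2) = 1 by field.
  move: H; rewrite e1 e2; lra.
by move: H; rewrite -invfM -ler_pdivlMr ?invr_gt0 ?mulr_gt0// invrK mul1r.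
Qed.

Lemma normr_dotp x y : `|dotp x y| <= enorm x * enorm y.
Proof. by rewrite ler_norml lerNl -dotpNl -{1}(enormN x) !ler_dotp. Qed.

Lemma enormD x y : enorm (x + y) <= enorm x + enorm y.
Proof.
rewrite -(ler_pXn2r (n := 2)) ?nnegrE ?addr_ge0 ?enorm_ge0// sqr_enorm sqrrD.
rewrite dotpDl !dotpDr (dotpC y x) !sqr_enorm.
by have := ler_dotp x y; lra.
Qed.

Lemma enorm_sub x y : enorm (x - y) <= enorm x + enorm y.
Proof. by rewrite -(enormN y) enormD. Qed.

Lemma enorm_subl x y : enorm x - enorm y <= enorm (x - y).
Proof. by have := enormD (x - y) y; rewrite subrK; lra. Qed.

Lemma ler_enorm_sum x : enorm x <= \sum_i `|x 0 i|.
Proof.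
rewrite -(ler_pXn2r (n := 2)) ?nnegrE ?enorm_ge0// ?sumr_ge0//.
rewrite sqr_enorm expr2 mulr_suml; apply: ler_sum => i _.
rewrite -expr2 -real_normK ?num_real// expr2 ler_wpM2l//.
by rewrite (bigD1 i)//= lerDl sumr_ge0.
Qed.

Lemma coord_le_normr x i : `|x 0 i| <= `|x|.
Proof.
have -> : `|x| = mx_norm x by []. rewrite mx_normrE.
exact: (le_bigmax_cond _ (fun ij : 'I_1 * 'I_d => `|x ij.1 ij.2|)
  (j := (ord0, i))).
Qed.

Lemma normr_le_enorm x : `|x| <= enorm x.
Proof.
have -> : `|x| = mx_norm x by []. rewrite mx_normrE; apply/bigmax_leP; split => [|[i j] _ /=].
  exact: enorm_ge0.
by rewrite ord1 coord_le_enorm.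
Qed.

Lemma enorm_le_normr x : enorm x <= d%:R * `|x|.
Proof.
apply: (le_trans (ler_enorm_sum x)).
rewrite mulr_natl -[X in _ *+ X]card_ord -sumr_const.
by apply: ler_sum => i _; exact: coord_le_normr.
Qed.

Lemma enorm_convex (r l : R) x y : 0 <= l <= 1 -> enorm x <= r -> enorm y <= r ->
  enorm (x + l *: (y - x)) <= r.
Proof.
move=> /andP[l0 l1] xr yr.
have -> : x + l *: (y - x) = (1 - l) *: x + l *: y.
  by apply/rowP => i; rewrite !mxE; ring.
apply: (le_trans (enormD _ _)); rewrite !enormZ !ger0_norm ?subr_ge0//.
have h1 : (1 - l) * enorm x <= (1 - l) * r by rewrite ler_wpM2l// subr_ge0.
have h2 : l * enorm y <= l * r by rewrite ler_wpM2l.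
lra.
Qed.

End EuclideanAlgebra.

Section EuclideanTopology.
Context {R : realType} {d : nat}.
Local Notation E := 'rV[R]_d.
Implicit Types (x y z : E) (a r : R).

Lemma continuous_coord (X : topologicalType) (f : X -> E) (p : X) i :
  {for p, continuous f} -> {for p, continuous (fun z : X => f z 0 i)}.
Proof.
move=> cf; apply: (continuous_comp (f := f) (g := fun M : E => M 0 i) cf).
exact: coord_continuous.
Qed.

Lemma continuous_row (X : topologicalType) (f : X -> E) (p : X) :
  (forall i, {for p, continuous (fun z : X => f z 0 i)}) -> {for p, continuous f}.
Proof.
move=> cf; apply/cvgrPdist_lt => e e0.
have H : \forall z \near p, forall k, `|f p 0 k - f z 0 k| < e.
  by apply: filter_forall => k; exact: (cvgrPdist_lt _ _).1 (cf k) e e0.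
near=> z.
have -> : `|f p - f z| = mx_norm (f p - f z) by []. rewrite mx_normrE; apply/bigmax_ltP; split => // -[i j] _ /=.
rewrite ord1 !mxE; move: j; near: z; exact: H.
Unshelve. all: by end_near. Qed.

Lemma cvg_sum_cont (X : topologicalType) (I : finType) (f : I -> X -> R) (p : X) :
  (forall i, {for p, continuous (f i)}) ->
  {for p, continuous (fun z : X => \sum_i f i z)}.
Proof.
move=> cf.
have H (s : seq I) : {for p, continuous (fun z : X => \sum_(i <- s) f i z)}.
  elim: s => [|i s IH]; rewrite /prop_for /continuous_at.
    by under eq_fun do rewrite big_nil; rewrite big_nil; exact: cvg_cst.
  by under eq_fun do rewrite big_cons; rewrite big_cons; apply: cvgD => //; exact: cf.
exact: H.
Qed.

Lemma continuous_dotp (X : topologicalType) (f g : X -> E) (p : X) :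
  {for p, continuous f} -> {for p, continuous g} ->
  {for p, continuous (fun z : X => dotp (f z) (g z))}.
Proof.
move=> cf cg; apply: cvg_sum_cont => i; apply: continuousM;
exact: continuous_coord.
Qed.

Lemma continuous_enorm (X : topologicalType) (f : X -> E) (p : X) :
  {for p, continuous f} -> {for p, continuous (fun z : X => enorm (f z))}.
Proof.
move=> cf; apply: (continuous_comp (g := Num.sqrt)).
  exact: continuous_dotp.
exact: sqrt_continuous.
Qed.

Definition cball r : set E := [set x | enorm x <= r].

Lemma closed_cball r : closed (cball r).
Proof.
rewrite (_ : cball r = enorm @^-1` [set y | y <= r])//.
apply: closed_comp; last exact: closed_le.
by move=> x _; apply: continuous_enorm.
Qed.

Lemma open_eball (c : E) r : open (eball c r).
Proof.
rewrite (_ : eball c r = (fun x => enorm (x - c)) @^-1` [set y | y < r])//.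
apply: open_comp; last exact: open_lt.
move=> x _; apply: (continuous_enorm (f := fun x => x - c)).
by apply: continuousB => //; exact: cst_continuous.
Qed.

Lemma bounded_cball r : bounded_set (cball r).
Proof.
exists r; split; first exact: num_real.
move=> M rM x /= xr; apply: (le_trans (normr_le_enorm x)).
by apply: (le_trans xr); exact: ltW.
Qed.

Lemma compact_cball r : compact (cball r).
Proof. apply: bounded_closed_compact; [exact: bounded_cball|exact: closed_cball]. Qed.

Lemma bounded_sub_cball (A : set E) : bounded_set A ->
  exists n : nat, A `<=` cball n%:R.
Proof.
move=> [M [_ HM]].
exists `|Num.ceil (d%:R * (M + 1))|%N => x Ax /=.
apply: (le_trans (enorm_le_normr x)).
have h : `|x| <= M + 1 by apply: HM => //; rewrite ltrDl.
apply: (@le_trans _ _ (d%:R * (M + 1))); first by rewrite ler_wpM2l.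
rewrite natr_absz; apply: (le_trans (Num.Theory.ceil_ge _)).
by rewrite ler_int ler_norm.
Qed.

Lemma unit_rowE (i j : 'I_d) : (unit_row i : E) 0 j = (j == i)%:R :> R.
Proof. by rewrite /unit_row !mxE eqxx. Qed.

Lemma dotp_unit x i : dotp x (unit_row i) = x 0 i.
Proof.
rewrite /dotp (bigD1 i)//= unit_rowE eqxx mulr1 big1 ?addr0// => j ji.
by rewrite unit_rowE (negPf ji) mulr0.
Qed.

Lemma row_unit_sum x : x = \sum_i x 0 i *: unit_row i.
Proof. exact: row_sum_delta. Qed.

End EuclideanTopology.

Section BorelFunctions.
Context {R : realType}.

Lemma continuous_borel (X Y : normedModType R) (f : X -> Y) : continuous f ->
  measurable_fun setT (f : borel X -> borel Y).
Proof.
move=> cf; apply: (measurability _ (erefl : open.-sigma.-measurable = <<s @open Y>>)) => //.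
move=> _ [U oU <-]; rewrite setTI; apply: sub_sigma_algebra.
by apply: open_comp => // x _; exact: cf.
Qed.

Lemma continuous_borel_real (X : normedModType R) (f : X -> R) : continuous f ->
  measurable_fun setT (f : borel X -> R).
Proof.
move=> cf; apply: (measurability _ (RGenOpens.measurableE R)).
move=> _ [U [a [b ->]] <-]; rewrite setTI; apply: sub_sigma_algebra.
apply: open_comp; last exact: interval_open.
by move=> x _; exact: cf.
Qed.

Lemma open_borel (X : normedModType R) (U : set X) : open U ->
  measurable (U : set (borel X)).
Proof. exact: sub_sigma_algebra. Qed.

Lemma closed_borel (X : normedModType R) (U : set X) : closed U ->
  measurable (U : set (borel X)).
Proof.
by move=> cU; rewrite -(setCK U); apply: measurableC; apply: open_borel;
  exact: closed_openC.
Qed.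

Lemma compact_borel (X : normedModType R) (U : set X) : compact U ->
  measurable (U : set (borel X)).
Proof.
move=> cU; apply: closed_borel; apply: compact_closed => //; exact: norm_hausdorff.
Qed.

Lemma borel_real_measurable (J : set R) : measurable J ->
  measurable (J : set (borel R)).
Proof.
move=> mJ.
have /(_ measurableT J mJ) := @continuous_borel_real R idfun (fun=> cvg_id).
by rewrite setTI.
Qed.

(* Separability enters only through the generation of the Borel sets by balls. *)
Lemma dense_open_bigcup (X : normedModType R) (q : nat -> X) (U : set X) :
  (forall (x : X) (e : R), 0 < e -> exists n, ball x e (q n)) -> open U ->
  U = \bigcup_n \bigcup_(m in [set m | ball (q n) m.+1%:R^-1 `<=` U])
        ball (q n) m.+1%:R^-1.
Proof.
move=> dq oU; apply/seteqP; split => [x Ux|x [n _ [m /= mU]]]; last exact: mU.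
have [e /= e0 eU] : nbhs_ball x U by apply/nbhs_ballP; exact: open_nbhs_nbhs.
have [m Hm] : exists m : nat, m.+1%:R^-1 < e / 2.
  exists (Num.truncn (e / 2)^-1).
  by rewrite invf_plt ?posrE ?divr_gt0// truncnS_gt.
have m0 : 0 < m.+1%:R^-1 :> R by rewrite invr_gt0.
have [n xn] := dq x _ m0.
exists n => //; exists m => /=; last exact: ball_sym.
move=> y ny; apply: eU; rewrite (splitr e).
apply: (ball_triangle (y := q n)).
  by apply: le_ball xn; exact: ltW.
by apply: le_ball ny; exact: ltW.
Qed.

Lemma borel_generated (X : normedModType R) (q : nat -> X) (G : set (set X)) :
  (forall (x : X) (e : R), 0 < e -> exists n, ball x e (q n)) ->
  (forall n (r : R), 0 < r -> G (ball (q n) r)) ->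
  G `<=` open ->
  @measurable _ (borel X) = <<s G >>.
Proof.
move=> dq Gb Go; apply/seteqP; split; last first.
  by apply: sub_sigma_algebra2.
apply: smallest_sub; first exact: smallest_sigma_algebra.
move=> U oU; rewrite (dense_open_bigcup dq oU).
apply: sigma_algebra_bigcup => n.
rewrite bigcup_mkcond; apply: sigma_algebra_bigcup => m.
case: ifP => _; last exact: sigma_algebra0.
by apply: sub_sigma_algebra; apply: Gb; rewrite invr_gt0.
Qed.

End BorelFunctions.

(** * Locally bounded signed measures *)

Section LocallyBounded.
Context {R : realType} {X : normedModType R}.
Implicit Types (D A B K : set X) (m : set X -> R).

Lemma sub_bounded_set A B : A `<=` B -> bounded_set B -> bounded_set A.
Proof.
by move=> AB [M [Mr BM]]; exists M; split => // e Me x /AB; exact: BM.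
Qed.

Lemma bounded_setU A B : bounded_set A -> bounded_set B -> bounded_set (A `|` B).
Proof.
move=> [M [Mr AM]] [N [Nr BN]]; exists (Num.max M N); split.
  exact: num_real.
by move=> e; rewrite gt_max => /andP[Me Ne] x [/AM|/BN]; exact.
Qed.

Lemma bounded_set0 : bounded_set (set0 : set X).
Proof. by exists 0; split => [|M M0 x []]; exact: num_real. Qed.

(** A compact exhaustion of [D] that absorbs every bounded subset. It puts any two bounded Borel
    sets inside a common compact set, where [m] is additive. *)
Definition exhausts D (K : nat -> set X) :=
  (forall n, compact (K n) /\ K n `<=` D) /\
  (forall A, bounded_set A -> A `<=` D -> exists n, A `<=` K n).

(** Countable additivity for a sequence of empty sets says that n times [m set0] converges; the
    consecutive differences, all equal to [m set0], then tend to 0. *)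
Lemma lb_set0 D m : locally_bounded_measure D m -> m set0 = 0.
Proof.
move=> hm; have h := hm _ (@compact0 X) (@sub0set _ D) (fun=> set0).
have {}h : m set0 *+ n @[n --> \oo] --> m set0.
  have t0 : trivIset [set: nat] (fun=> set0 : set X).
    by apply/trivIsetP => i j _ _ _; exact: setI0.
  have := h (fun=> conj measurable0 (@subset_refl _ set0)) t0.
  rewrite bigcup0//.
  by under eq_fun do rewrite sumr_const_nat subn0.
have h1 : m set0 *+ n.+1 @[n --> \oo] --> m set0 by rewrite cvg_shiftS.
have {h h1} : (m set0 *+ n.+1 - m set0 *+ n) @[n --> \oo] --> m set0 - m set0.
  exact: cvgB.
rewrite subrr; under eq_fun do rewrite mulrS addrK.
by move/cvg_lim => /(_ (@norm_hausdorff _ _)); rewrite lim_cst.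
Qed.

Lemma lbN D m : locally_bounded_measure D m ->
  locally_bounded_measure D (fun B => - m B).
Proof.
move=> hm K cK KD F HF tF; under eq_fun do rewrite sumrN.
by apply: cvgN; exact: hm cK KD F HF tF.
Qed.

Lemma lbD D m1 m2 : locally_bounded_measure D m1 ->
  locally_bounded_measure D m2 ->
  locally_bounded_measure D (fun B => m1 B + m2 B).
Proof.
move=> h1 h2 K cK KD F HF tF; under eq_fun do rewrite big_split/=.
by apply: cvgD; [exact: h1 cK KD F HF tF|exact: h2 cK KD F HF tF].
Qed.

Lemma lbB D m1 m2 : locally_bounded_measure D m1 ->
  locally_bounded_measure D m2 ->
  locally_bounded_measure D (fun B => m1 B - m2 B).
Proof. by move=> h1 /lbN; exact: lbD. Qed.

Section Restriction.
Variables (D : set X) (m : set X -> R) (hm : locally_bounded_measure D m).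
Variables (K : set X) (cK : compact K) (KD : K `<=` D).

(** Restricted to a compact set, [m] becomes a finite charge on all Borel sets. The three hypotheses
    are arguments of the term so that the charge structure can be inferred from it; [lb_pos],
    [lb_neg], [lb_abs] and [kernel_charge] follow the same pattern. *)
Definition lb_charge of locally_bounded_measure D m & compact K & K `<=` D :
  set (borel X) -> \bar R := fun A => (m (A `&` K))%:E.

Local Notation mK := (lb_charge hm cK KD).

Let mK0 : mK set0 = 0%E. Proof. by rewrite /lb_charge set0I (lb_set0 hm). Qed.

Let mKfin (A : set (borel X)) : measurable A -> mK A \is a fin_num. Proof. by []. Qed.

Let mK_sigma : semi_sigma_additive mK.
Proof.
move=> F mF tF _; rewrite /lb_charge setI_bigcupl.
apply/fine_cvgP; split; first by apply: nearW => n; rewrite sumEFin.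
under eq_fun => n. rewrite /comp sumEFin/=; over.
apply: hm cK KD _ _ _ => [n|].
  by split; [apply: measurableI => //; exact: compact_borel|apply: subIsetr].
apply/trivIsetP => i j _ _ ij; rewrite setIACA setIid.
by move/trivIsetP: tF => -> //; rewrite set0I.
Qed.

HB.instance Definition _ := isCharge.Build _ (borel X) R mK mK0 mKfin mK_sigma.

Lemma lb_hahn : exists P : set (borel X), measurable P /\
  forall A : set (borel X), measurable A -> A `<=` K ->
    [/\ 0 <= m (A `&` P), m (A `\` P) <= 0 & m A = m (A `&` P) + m (A `\` P)].
Proof.
have [P [N [[mP Ppos] [mN Nneg] PN PN0]]] := Hahn_decomposition mK.
exists P; split => // A mA AK.
have e1 : (A `&` P) `&` K = A `&` P.
  by apply/seteqP; split => [x []//|x [Ax Px]]; do !split => //; exact: AK.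
have e2 : (A `\` P) `&` K = A `\` P.
  by apply/seteqP; split => [x []//|x [Ax Px]]; do !split => //; exact: AK.
split.
- have : (0 <= (m (A `&` P `&` K))%:E)%E.
    exact: Ppos (A `&` P) (measurableI _ _ mA mP) (@subIsetr _ _ _).
  by rewrite e1 lee_fin.
- have APN : A `\` P `<=` N.
    move=> x [Ax nPx]; have : [set: X] x by [].
    by rewrite -PN => -[].
  have : ((m ((A `\` P) `&` K))%:E <= 0)%E.
    exact: Nneg (A `\` P) (measurableD mA mP) APN.
  by rewrite e2 lee_fin.
- have : (m (A `&` K))%:E = ((m ((A `\` P) `&` K))%:E + (m (A `&` P `&` K))%:E)%E.
    exact: @chargeDI _ _ _ mK A P mA mP.
  by rewrite e1 e2 (setIidl AK) -EFinD => -[->]; rewrite addrC.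
Qed.

Lemma lb_setU A B : measurable (A : set (borel X)) ->
  measurable (B : set (borel X)) -> A `<=` K -> B `<=` K ->
  A `&` B = set0 -> m (A `|` B) = m A + m B.
Proof.
move=> mA mB AK BK AB.
have : (m ((A `|` B) `&` K))%:E = ((m (A `&` K))%:E + (m (B `&` K))%:E)%E.
  exact: @chargeU _ _ _ mK A B mA mB AB.
by rewrite (setIidl AK) (setIidl BK) setIidl ?subUset// -EFinD => -[].
Qed.

End Restriction.

Section PosMeasure.
Variables (D : set X) (Kn : nat -> set X) (exD : exhausts D Kn).
Variables (m : set X -> R) (hm : locally_bounded_measure D m).

Definition lb_pos of exhausts D Kn & locally_bounded_measure D m :
  set (borel X) -> \bar R := pos_measure D m.
Local Notation pos := (lb_pos exD hm).

Let bb0 : bounded_borel D set0.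
Proof. by split => //; exact: bounded_set0. Qed.

Let pos0 : pos set0 = 0%E.
Proof.
rewrite /lb_pos /pos_measure; apply/eqP; rewrite eq_le; apply/andP; split.
  apply: ge_ereal_sup => _ /= [B [_ +] <-]; rewrite subset0 => ->.
  by rewrite (lb_set0 hm).
by apply: ereal_sup_ubound; exists set0; [split|rewrite /= (lb_set0 hm)].
Qed.

Let pos_ge0 A : (0 <= pos A)%E.
Proof.
by apply: ereal_sup_ubound; exists set0; [split|rewrite /= (lb_set0 hm)].
Qed.

Let le_pos A B : A `<=` B -> (pos A <= pos B)%E.
Proof.
move=> AB; apply: le_ereal_sup => _ [C [bC CA] <-].
by exists C => //; split => //; exact: subset_trans CA AB.
Qed.

(** Competitors for [A] and for [B] are disjoint bounded sets, so they lie in one member of the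
    exhaustion and [m] adds up on their union, which competes for the union of [A] and [B]. If the
    right-hand side is infinite there is nothing to prove; otherwise all three values are finite and
    subtraction is legitimate. *)
Let posU A B : measurable (A : set (borel X)) ->
  measurable (B : set (borel X)) -> A `&` B = set0 ->
  (pos A + pos B <= pos (A `|` B))%E.
Proof.
move=> mA mB AB.
have [cy|cy] := eqVneq (pos (A `|` B)) +oo%E; first by rewrite cy leey.
have fin C : C `<=` A `|` B -> pos C \is a fin_num.
  move=> CAB; rewrite ge0_fin_numE ?pos_ge0//.
  by apply: (le_lt_trans (le_pos CAB)); rewrite lt_neqAle cy leey.
have fA := fin A (@subsetUl _ _ _).
have fB := fin B (@subsetUr _ _ _).
have fAB := fin _ (@subset_refl _ (A `|` B)).
rewrite -leeBrDr//; apply: ge_ereal_sup => _ [C [[mC bC CD] CA] <-].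
rewrite leeBrDr// addeC -leeBrDr//.
apply: ge_ereal_sup => _ [C' [[mC' bC' CD'] CB] <-].
rewrite leeBrDr// -EFinD.
have bCC : bounded_set (C `|` C') by exact: bounded_setU.
have [n Kn_] := exD.2 _ bCC (fun x H => match H with or_introl h => CD x h | or_intror h => CD' x h end).
have [cK KD] := exD.1 n.
have sC : C `<=` Kn n by apply: subset_trans Kn_; exact: subsetUl.
have sC' : C' `<=` Kn n by apply: subset_trans Kn_; exact: subsetUr.
rewrite addrC -(lb_setU hm cK KD)//; last first.
  by apply: subsetI_eq0 AB.
apply: ereal_sup_ubound; exists (C `|` C') => //; split; last exact: setUSS.
by split => //; [exact: measurableU|rewrite subUset; split].
Qed.

(** One inequality is superadditivity over finite subunions. For the other, a bounded competitor [B]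
    lies in one compact set of the exhaustion, so [m B] is the sum of the [m] of its pieces in the
    [F i], each at most [pos (F i)]. *)
Let pos_sigma : semi_sigma_additive pos.
Proof.
move=> F mF tF mUF.
suff -> : pos (\bigcup_n F n) = (\sum_(0 <= i <oo) pos (F i))%E.
  by apply: is_cvg_nneseries => n _ _; exact: pos_ge0.
apply/eqP; rewrite eq_le; apply/andP; split; last first.
  apply: lime_le; first by apply: is_cvg_nneseries => n _ _; exact: pos_ge0.
  apply: nearW => n.
  apply: (@le_trans _ _ (pos (\big[setU/set0]_(i < n) F i))); last first.
    by apply: le_pos; exact: bigsetU_bigcup.
  elim: n => [|n IH]; first by rewrite big_nil big_ord0 pos_ge0.
  rewrite big_nat_recr//= big_ord_recr/=.
  apply: le_trans (posU _ _ _) => //; first by rewrite leeD2r.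
    exact: bigsetU_measurable.
  rewrite big_distrl/=.
  apply: big1 => i _; move/trivIsetP: tF; apply => //.
  by rewrite neq_ltn ltn_ord.
apply: ge_ereal_sup => _ [B [[mB bB BD] BF] <-].
have [n Kn_] := exD.2 _ bB BD; have [cK KD] := exD.1 n.
have h : (\sum_(0 <= i < k) m (B `&` F i)) @[k --> \oo] --> m B.
  rewrite -{2}(setIidl BF) setI_bigcupr; apply: hm cK KD _ _ _ => [k|].
    split; first exact: measurableI.
    by apply: subset_trans Kn_; exact: subIsetl.
  apply/trivIsetP => i j _ _ ij; rewrite setIACA setIid.
  by move/trivIsetP: tF => -> //; rewrite setI0.
have {}h : (\sum_(0 <= i < k) (m (B `&` F i))%:E)%E @[k --> \oo] --> (m B)%:E.
  by under eq_fun do rewrite sumEFin; apply: cvg_EFin => //; apply: nearW.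
rewrite -(cvg_lim _ h)//; apply: lee_lim.
- by apply/cvg_ex; exists (m B)%:E.
- by apply: is_cvg_nneseries => k _ _; exact: pos_ge0.
apply: nearW => k; apply: lee_sum => i _.
apply: ereal_sup_ubound; exists (B `&` F i) => //; split; last exact: subIsetr.
split; [exact: measurableI|apply: sub_bounded_set bB|apply: subset_trans BD];
exact: subIsetl.
Qed.

HB.instance Definition _ := isMeasure.Build _ (borel X) R pos pos0 pos_ge0 pos_sigma.

End PosMeasure.

Section Hahn.
Variables (D : set X) (m : set X -> R) (hm : locally_bounded_measure D m).

Definition hahn_on (K P : set X) := forall A : set (borel X), measurable A ->
  A `<=` K -> 0 <= m (A `&` P) /\ m (A `\` P) <= 0.

Lemma exists_hahn_on K : compact K -> K `<=` D ->
  exists2 P : set (borel X), measurable P & hahn_on K P.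
Proof.
move=> cK KD; have [P [mP HP]] := lb_hahn hm cK KD.
by exists P => // A mA AK; have [] := HP A mA AK.
Qed.

Lemma lb_setID K (A P : set (borel X)) : compact K -> K `<=` D ->
  measurable A -> measurable P -> A `<=` K ->
  m A = m (A `&` P) + m (A `\` P).
Proof.
move=> cK KD mA mP AK.
have sI : A `&` P `<=` K by apply: subset_trans AK; exact: subIsetl.
have sD : A `\` P `<=` K by apply: subset_trans AK; exact: subDsetl.
have mD : measurable (A `\` P : set (borel X)) by exact: measurableD.
have mI : measurable (A `&` P : set (borel X)) by exact: measurableI.
rewrite -(lb_setU hm cK KD)//; first by rewrite setUIDK.
by rewrite setDE setIACA setICr setI0.
Qed.

(** The supremum is attained at [A] cut by a Hahn set: for [B] inside [A], dropping the part of [B]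
    outside [P] and then enlarging the rest to the whole of [A] inside [P] never decreases [m]. *)
Lemma pos_measureE K (P A : set (borel X)) : compact K -> K `<=` D ->
  measurable P -> hahn_on K P -> measurable A -> A `<=` K ->
  pos_measure D m A = (m (A `&` P))%:E.
Proof.
move=> cK KD mP HP mA AK; apply/eqP; rewrite eq_le; apply/andP; split.
  apply: ge_ereal_sup => _ [B [[mB bB BD] BA] <-]; rewrite lee_fin.
  have BK : B `<=` K by exact: subset_trans AK.
  have mBP : measurable (B `&` P : set (borel X)) by exact: measurableI.
  rewrite (lb_setID cK KD mB mP BK).
  apply: (@le_trans _ _ (m (B `&` P))); first by rewrite gerDl (HP _ mB BK).2.
  have mC : measurable (A `&` P : set (borel X)) by exact: measurableI.
  have CK : A `&` P `<=` K by apply: subset_trans AK; exact: subIsetl.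
  rewrite (lb_setID cK KD mC mBP CK).
  have -> : A `&` P `&` (B `&` P) = B `&` P.
    by rewrite setIACA setIid (setIidr BA).
  rewrite lerDl.
  have -> : A `&` P `\` (B `&` P) = (A `\` B) `&` P.
    by apply/seteqP; split => x /= ; tauto.
  apply: (HP (A `\` B) _ _).1; first exact: measurableD.
  by apply: subset_trans AK; exact: subDsetl.
apply: ereal_sup_ubound; exists (A `&` P) => //; split; last exact: subIsetl.
split; first exact: measurableI.
  apply: (@sub_bounded_set _ K); last exact: compact_bounded.
  by apply: subset_trans AK; exact: subIsetl.
by apply: subset_trans KD; apply: subset_trans AK; exact: subIsetl.
Qed.

End Hahn.

Lemma hahn_onN m K (P : set (borel X)) : measurable P -> hahn_on m K P ->
  hahn_on (fun B => - m B) K (~` P).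
Proof.
move=> mP HP A mA AK; have [h1 h2] := HP A mA AK.
by rewrite setDE setCK -setDE oppr_ge0 oppr_le0.
Qed.

Lemma neg_measureE D m K (P A : set (borel X)) : locally_bounded_measure D m ->
  compact K -> K `<=` D ->
  measurable P -> hahn_on m K P -> measurable A -> A `<=` K ->
  neg_measure D m A = (- m (A `\` P))%:E.
Proof.
move=> hm cK KD mP HP mA AK.
rewrite /neg_measure (pos_measureE (lbN hm) cK KD _ (hahn_onN mP HP))//.
exact: measurableC.
Qed.

Lemma pos_measure_lty D m K (A : set (borel X)) :
  locally_bounded_measure D m -> compact K -> K `<=` D ->
  measurable A -> A `<=` K -> (pos_measure D m A < +oo)%E.
Proof.
move=> hm cK KD mA AK; have [P mP HP] := exists_hahn_on hm cK KD.
by rewrite (pos_measureE hm cK KD mP HP mA AK) ltry.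
Qed.

Lemma jordan_measure D m K (A : set (borel X)) :
  locally_bounded_measure D m -> compact K -> K `<=` D ->
  measurable A -> A `<=` K ->
  (m A)%:E = (pos_measure D m A - neg_measure D m A)%E.
Proof.
move=> hm cK KD mA AK; have [P mP HP] := exists_hahn_on hm cK KD.
rewrite (pos_measureE hm cK KD mP HP mA AK) (neg_measureE hm cK KD mP HP mA AK).
by rewrite -EFinB opprK (lb_setID hm cK KD mA mP AK).
Qed.

End LocallyBounded.
Lemma Rintegral_dominated_cvg d (T : measurableType d) (R : realType)
  (mu : {measure set T -> \bar R}) (A : set T) (f_ : nat -> T -> R) (f g : T -> R) :
  measurable A -> (forall n, measurable_fun A (f_ n)) -> measurable_fun A f ->
  (forall x, A x -> f_ n x @[n --> \oo] --> f x) ->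
  (forall n x, A x -> `|f_ n x| <= g x) ->
  mu.-integrable A (EFin \o g) ->
  (\int[mu]_(x in A) (f_ n x))%R @[n --> \oo] --> (\int[mu]_(x in A) f x)%R.
Proof.
move=> mA mfn mf cf fg Ig.
have h := @dominated_convergence _ _ _ mu A mA
    (fun n x => (f_ n x)%:E) (fun x => (f x)%:E) (EFin \o g).
have [] := h.
- by move=> n; exact/measurable_EFinP.
- exact/measurable_EFinP.
- by apply: aeW => x Ax; apply: cvg_EFin; [exact: nearW|exact: cf].
- exact: Ig.
- by apply: aeW => x n Ax; rewrite lee_fin fg.
move=> If _ hc.
apply: fine_cvg; rewrite fineK//; exact: integrable_fin_num.
Qed.

Section SignedIntegral.
Context {R : realType} {X : normedModType R}.
Variables (D : set X) (Kn : nat -> set X) (exD : exhausts D Kn).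
Implicit Types (m : set X -> R) (f g : borel X -> R).

Section AbsMeasure.
Variables (m : set X -> R) (hm : locally_bounded_measure D m).

Definition lb_neg of exhausts D Kn & locally_bounded_measure D m :
  set (borel X) -> \bar R := neg_measure D m.
HB.instance Definition _ := Measure.copy (lb_neg exD hm) (lb_pos exD (lbN hm)).

Definition lb_abs of exhausts D Kn & locally_bounded_measure D m :
  set (borel X) -> \bar R := abs_measure D m.
Let lb_absE : lb_abs exD hm = measure_add (lb_pos exD hm) (lb_neg exD hm).
Proof. by apply/funext => A; rewrite measure_addE. Qed.
Let abs0 : lb_abs exD hm set0 = 0%E. Proof. by rewrite lb_absE; exact: measure0. Qed.
Let abs_ge0 A : (0 <= lb_abs exD hm A)%E.
Proof. by rewrite lb_absE; exact: measure_ge0. Qed.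
Let abs_sigma : semi_sigma_additive (lb_abs exD hm).
Proof. by rewrite lb_absE; exact: measure_semi_sigma_additive. Qed.
HB.instance Definition _ :=
  isMeasure.Build _ (borel X) R (lb_abs exD hm) abs0 abs_ge0 abs_sigma.

Lemma integral_lb_abs (A : set (borel X)) (f : borel X -> \bar R) :
  measurable A -> measurable_fun A f ->
  (forall x, A x -> 0 <= f x)%E ->
  (\int[lb_abs exD hm]_(x in A) f x =
  \int[lb_pos exD hm]_(x in A) f x + \int[lb_neg exD hm]_(x in A) f x)%E.
Proof.
by move=> mA mf f0; rewrite -ge0_integral_measure_add// -lb_absE.
Qed.

Lemma integrable_lb_abs (A : set (borel X)) (f : borel X -> \bar R) :
  measurable A ->
  (lb_abs exD hm).-integrable A f ->
  (lb_pos exD hm).-integrable A f /\ (lb_neg exD hm).-integrable A f.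
Proof.
move=> mA /integrableP[mf]; rewrite integral_lb_abs//; last first.
  exact: measurableT_comp.
move=> h; split; apply/integrableP; split => //; apply: le_lt_trans h.
  by rewrite leeDl// integral_ge0.
by rewrite leeDr// integral_ge0.
Qed.

Lemma lb_abs_lty K (A : set (borel X)) : compact K -> K `<=` D ->
  measurable A -> A `<=` K -> (lb_abs exD hm A < +oo)%E.
Proof.
move=> cK KD mA AK; apply: lte_add_pinfty.
  exact: pos_measure_lty AK.
by apply: pos_measure_lty AK; first exact: lbN hm.
Qed.

Lemma signed_integralE (A : set (borel X)) f :
  measurable A -> A `<=` D -> (forall x, D x -> ~ A x -> f x = 0) ->
  signed_integral D m f =
  (\int[lb_pos exD hm]_(x in A) f x - \int[lb_neg exD hm]_(x in A) f x)%R.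
Proof.
move=> mA AD f0; rewrite /signed_integral /Rintegral.
have H (mu : {measure set (borel X) -> \bar R}) :
  (\int[mu]_(x in D) (f x)%:E = \int[mu]_(x in A) (f x)%:E)%E.
  rewrite integral_mkcond [RHS]integral_mkcond; apply: eq_integral => x _.
  rewrite /patch; case: ifPn => [/set_mem Dx|nDx]; case: ifPn => //.
    by move=> nAx; rewrite f0// => Ax; rewrite mem_set in nAx.
  by move=> /set_mem/AD/mem_set; rewrite (negbTE nDx).
by congr (fine _ - fine _); [exact: (H (lb_pos exD hm))|exact: (H (lb_neg exD hm))].
Qed.

Lemma signed_integral_abs (A : set (borel X)) f :
  measurable A -> A `<=` D -> (forall x, D x -> ~ A x -> f x = 0) ->
  (lb_abs exD hm).-integrable A (EFin \o f) ->
  (`|signed_integral D m f|%:E <= \int[lb_abs exD hm]_(x in A) `|f x|%:E)%E.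
Proof.
move=> mA AD f0 If; have [Ip In] := integrable_lb_abs mA If.
have mf := measurable_int _ If.
rewrite (signed_integralE mA AD f0) integral_lb_abs//; last first.
- exact/measurable_EFinP/measurableT_comp/measurable_EFinP.
apply: (@le_trans _ _ (`|\int[lb_pos exD hm]_(x in A) f x|%:E +
    `|\int[lb_neg exD hm]_(x in A) f x|%:E)%E).
  by rewrite -EFinD lee_fin ler_normB.
by apply: leeD; rewrite EFin_normr_Rintegral//; exact: le_abse_integral.
Qed.

Lemma signed_integralD (A : set (borel X)) f g :
  measurable A -> A `<=` D -> (forall x, D x -> ~ A x -> f x = 0) ->
  (forall x, D x -> ~ A x -> g x = 0) ->
  (lb_abs exD hm).-integrable A (EFin \o f) ->
  (lb_abs exD hm).-integrable A (EFin \o g) ->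
  signed_integral D m (fun x => f x + g x) =
  signed_integral D m f + signed_integral D m g.
Proof.
move=> mA AD f0 g0 If Ig.
have [Ifp Ifn] := integrable_lb_abs mA If.
have [Igp Ign] := integrable_lb_abs mA Ig.
rewrite !(signed_integralE mA AD)//; last first.
  by move=> x Dx nAx; rewrite f0// g0// addr0.
rewrite !RintegralD//; ring.
Qed.

Lemma signed_integral_indic K (A : set (borel X)) : compact K -> K `<=` D ->
  measurable A -> A `<=` K -> signed_integral D m (\1_A) = m A.
Proof.
move=> cK KD mA AK.
have AD : A `<=` D by exact: subset_trans KD.
rewrite (signed_integralE mA AD); last first.
  by move=> x Dx nAx; rewrite indicE memNset.
have H (mu : {measure set (borel X) -> \bar R}) :
    (\int[mu]_(x in A) \1_A x)%R = fine (mu A).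
  by rewrite /Rintegral integral_indic// setIid.
rewrite !H.
have h := jordan_measure hm cK KD mA AK.
have p_fin : pos_measure D m A \is a fin_num.
  rewrite ge0_fin_numE; first exact: pos_measure_lty AK.
  exact: (measure_ge0 (lb_pos exD hm)).
have n_fin : neg_measure D m A \is a fin_num.
  rewrite ge0_fin_numE; first by apply: pos_measure_lty AK; first exact: lbN hm.
  exact: (measure_ge0 (lb_neg exD hm)).
by apply: EFin_inj; rewrite EFinB !fineK.
Qed.

Lemma signed_integral_cvg (A : set (borel X)) (f_ : nat -> borel X -> R) f g :
  measurable A -> A `<=` D ->
  (forall n x, D x -> ~ A x -> f_ n x = 0) ->
  (forall x, D x -> ~ A x -> f x = 0) ->
  (forall n, measurable_fun A (f_ n)) ->
  measurable_fun A f ->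
  (forall x, A x -> f_ n x @[n --> \oo] --> f x) ->
  (forall n x, A x -> `|f_ n x| <= g x) ->
  (lb_abs exD hm).-integrable A (EFin \o g) ->
  signed_integral D m (f_ n) @[n --> \oo] --> signed_integral D m f.
Proof.
move=> mA AD fn0 f0 mfn mf cf fg Ig.
have [Ip In] := integrable_lb_abs mA Ig.
under eq_fun do rewrite (signed_integralE mA AD (fn0 _)).
rewrite (signed_integralE mA AD f0).
by apply: cvgB; exact: (Rintegral_dominated_cvg mA mfn mf cf fg).
Qed.

End AbsMeasure.

Lemma pos_measureB_le m1 m2 (A : set (borel X)) :
  (pos_measure D (fun B => (m1 B - m2 B)%R) A <=
   pos_measure D m1 A + neg_measure D m2 A)%E.
Proof.
apply: ge_ereal_sup => _ [B bB <-].
by rewrite EFinD; apply: leeD; apply: ereal_sup_ubound; exists B.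
Qed.

Section Difference.
Variables (m1 m2 : set X -> R).
Variables (h1 : locally_bounded_measure D m1) (h2 : locally_bounded_measure D m2).

Let h12 := lbB h1 h2.

Lemma neg_measureB_le (A : set (borel X)) :
  (neg_measure D (fun B => (m1 B - m2 B)%R) A <=
   neg_measure D m1 A + pos_measure D m2 A)%E.
Proof.
apply: ge_ereal_sup => _ [B bB <-].
rewrite opprB addrC EFinD; apply: leeD; apply: ereal_sup_ubound; by exists B.
Qed.

Lemma abs_measureB_le (A : set (borel X)) :
  (lb_abs exD h12 A <= lb_abs exD h1 A + lb_abs exD h2 A)%E.
Proof.
rewrite /lb_abs /abs_measure [X in (_ <= _ + X)%E]addeC addeACA.
exact: leeD (pos_measureB_le m1 m2 A) (neg_measureB_le A).
Qed.

Lemma integrable_abs_measureB (A : set (borel X)) (f : borel X -> \bar R) :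
  measurable A -> (lb_abs exD h1).-integrable A f ->
  (lb_abs exD h2).-integrable A f -> (lb_abs exD h12).-integrable A f.
Proof.
move=> mA /integrableP[mf l1] /integrableP[_ l2]; apply/integrableP; split => //.
rewrite integral_mkcond.
have mfA : measurable_fun setT ((fun x => `|f x|%E) \_ A).
  by apply/(measurable_restrictT _ mA); exact: measurableT_comp.
have fA0 x : (0 <= ((fun x => `|f x|%E) \_ A) x)%E.
  by apply: erestrict_ge0 => y _; exact: abse_ge0.
apply: (@le_lt_trans _ _ (\int[measure_add (lb_abs exD h1) (lb_abs exD h2)]_x
   ((fun x => `|f x|%E) \_ A) x)%E).
  apply: ge0_le_measure_integral => // S mS.
  apply: (le_trans (abs_measureB_le S)).
  by have := measure_addE (lb_abs exD h1) (lb_abs exD h2) S => /= <-.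
rewrite ge0_integral_measure_add// -!integral_mkcond.
exact: lte_add_pinfty.
Qed.

(** The Jordan parts of a difference are not the differences of the Jordan parts. Moving every part
    to the side where it has a positive sign gives an equality of positive measures on the Borel
    subsets of [A], namely of (m1 - m2)^+ + m1^- + m2^+ and (m1 - m2)^- + m1^+ + m2^-; it is
    integrated and rearranged. *)
Lemma signed_integralB_measure (A K : set (borel X)) (f : borel X -> R) :
  compact (K : set X) -> K `<=` D -> measurable A -> A `<=` K ->
  (forall x, D x -> ~ A x -> f x = 0) ->
  (lb_abs exD h1).-integrable A (EFin \o f) ->
  (lb_abs exD h2).-integrable A (EFin \o f) ->
  signed_integral D (fun B => m1 B - m2 B) f =
  signed_integral D m1 f - signed_integral D m2 f.
Proof.
move=> cK KD mA AK f0 I1 I2.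
have AD : A `<=` D by exact: subset_trans KD.
have I12 := integrable_abs_measureB mA I1 I2.
have [p1 n1] := integrable_lb_abs mA I1.
have [p2 n2] := integrable_lb_abs mA I2.
have [p n] := integrable_lb_abs mA I12.
have mf := measurable_int _ p1.
rewrite (signed_integralE h12 mA AD f0) (signed_integralE h1 mA AD f0).
rewrite (signed_integralE h2 mA AD f0).
have add_int (mu nu : {measure set (borel X) -> \bar R}) :
    mu.-integrable A (EFin \o f) -> nu.-integrable A (EFin \o f) ->
    (measure_add mu nu).-integrable A (EFin \o f).
  move=> /integrableP[_ l1] /integrableP[_ l2]; apply/integrableP; split => //.
  rewrite ge0_integral_measure_add//; first exact: lte_add_pinfty.
  exact: measurableT_comp.
have add_R (mu nu : {measure set (borel X) -> \bar R}) :
    mu.-integrable A (EFin \o f) -> nu.-integrable A (EFin \o f) ->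
    (\int[measure_add mu nu]_(x in A) f x =
     \int[mu]_(x in A) f x + \int[nu]_(x in A) f x)%R.
  move=> i1 i2; rewrite /Rintegral integral_measure_add// fineD//;
    exact: integrable_fin_num.
have fin m (hm : locally_bounded_measure D m) (S : set (borel X)) :
    measurable S -> S `<=` A ->
    exists a c : R, [/\ lb_pos exD hm S = a%:E, lb_neg exD hm S = c%:E &
      m S = a - c].
  move=> mS SA; have SK := subset_trans SA AK.
  have p_fin : lb_pos exD hm S \is a fin_num.
    rewrite ge0_fin_numE ?measure_ge0//; exact: pos_measure_lty SK.
  have n_fin : lb_neg exD hm S \is a fin_num.
    rewrite ge0_fin_numE ?measure_ge0//.
    by apply: pos_measure_lty SK; first exact: lbN hm.
  exists (fine (lb_pos exD hm S)), (fine (lb_neg exD hm S)).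
  rewrite !fineK//; split => //; apply: EFin_inj; rewrite EFinB !fineK//.
  exact: jordan_measure SK.
have key : (\int[measure_add (lb_pos exD h12)
      (measure_add (lb_neg exD h1) (lb_pos exD h2))]_(x in A) f x =
   \int[measure_add (lb_neg exD h12)
      (measure_add (lb_pos exD h1) (lb_neg exD h2))]_(x in A) f x)%R.
  rewrite /Rintegral; congr fine; apply: eq_measure_integral => S mS SA.
  have e (m m' m'' : {measure set (borel X) -> \bar R}) :
      (measure_add m (measure_add m' m'') S = m S + (m' S + m'' S))%E.
    by rewrite measure_addE; congr (_ + _)%E; exact: measure_addE.
  refine (etrans (e _ _ _) (etrans _ (esym (e _ _ _)))).
  have [a [c [pa nc e12]]] := fin _ h12 S mS SA.
  have [a1 [c1 [pa1 nc1 e1]]] := fin _ h1 S mS SA.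
  have [a2 [c2 [pa2 nc2 e2]]] := fin _ h2 S mS SA.
  refine (etrans (congr2 adde pa (congr2 adde nc1 pa2)) (etrans _
    (esym (congr2 adde nc (congr2 adde pa1 nc2))))).
  by rewrite /=; congr EFin; lra.
move: key; rewrite !add_R ?add_int//; lra.
Qed.

End Difference.
End SignedIntegral.

(** * Rational boxes *)

Section Boxes.
Context {R : realType} {d : nat}.
Local Notation E := 'rV[R]_d.

Definition box (a b : E) : set E := [set x | forall i, a 0 i < x 0 i < b 0 i].
Definition sbox (a b : E) (s t : R) : set (E * R) :=
  [set z | box a b z.1 /\ s < z.2 < t].

Lemma ball_rowE (x : E) (r : R) : 0 < r ->
  ball x r = box (x - const_mx r) (x + const_mx r).
Proof.
move=> r0; rewrite mx_norm_ball /ball_ /box; apply/seteqP; split => y /=.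
  move=> H i; rewrite !mxE.
  have : `|(x - y) 0 i| < r by apply: le_lt_trans H; exact: coord_le_normr.
  by rewrite !mxE ltr_norml => /andP[? ?]; apply/andP; split; lra.
move=> H; have -> : `|x - y| = mx_norm (x - y) by [].
rewrite mx_normrE; apply/bigmax_ltP; split => // -[i j] _ /=.
rewrite ord1 !mxE ltr_norml; have := H j; rewrite !mxE => /andP[? ?].
by apply/andP; split; lra.
Qed.

Lemma ball_rowRE (z : E * R) (r : R) : 0 < r ->
  ball z r = sbox (z.1 - const_mx r) (z.1 + const_mx r) (z.2 - r) (z.2 + r).
Proof.
move=> r0; rewrite {1}/ball/= /prod_ball ball_rowE//.
apply/seteqP; split => y /= [h1 h2]; split => //.
  by move: h2; rewrite /ball/= ltr_norml => /andP[? ?]; apply/andP; split; lra.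
by move: h2 => /andP[? ?]; rewrite /ball/= ltr_norml; apply/andP; split; lra.
Qed.

Lemma open_box a b : open (box a b).
Proof.
rewrite openE => x bx; rewrite /interior.
suff H : nbhs x (fun y => forall i, a 0 i < (y : E) 0 i < b 0 i) by [].
apply: (@filter_forall _ _ (fun i (y : E) => a 0 i < y 0 i < b 0 i) (nbhs x)).
move=> i; have /andP[ax xb] := bx i.
have c : {for x, continuous (fun y : E => y 0 i)} by exact: coord_continuous.
have /cvgr_gt /(_ _ ax) h1 := c; have /cvgr_lt /(_ _ xb) h2 := c.
by near=> y; apply/andP; split; near: y.
Unshelve. all: by end_near. Qed.

Lemma open_sbox a b s t : open (sbox a b s t).
Proof.
have -> : sbox a b s t = fst @^-1` box a b `&` snd @^-1` `]s, t[%classic.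
  by apply/seteqP; split => z /=; rewrite in_itv.
apply: openI; apply: open_comp.
- by move=> z _; exact: cvg_fst.
- exact: open_box.
- by move=> z _; exact: cvg_snd.
- exact: interval_open.
Qed.

Definition box_max (a b : E) : E := \row_i Num.max (a 0 i) (b 0 i).
Definition box_min (a b : E) : E := \row_i Num.min (a 0 i) (b 0 i).

Lemma box_setI a b a' b' :
  box a b `&` box a' b' = box (box_max a a') (box_min b b').
Proof.
apply/seteqP; split => x /=.
  by move=> [h h'] i; rewrite !mxE gt_max lt_min;
    have /andP[-> ->] := h i; have /andP[-> ->] := h' i.
by move=> h; split=> i; have := h i; rewrite !mxE gt_max lt_min;
  move=> /andP[/andP[? ?] /andP[? ?]]; apply/andP.
Qed.

Lemma sbox_setI a b s t a' b' s' t' : sbox a b s t `&` sbox a' b' s' t' =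
  sbox (box_max a a') (box_min b b') (Num.max s s') (Num.min t t').
Proof.
rewrite /sbox -box_setI; apply/seteqP; split => z /=; rewrite gt_max lt_min.
  by move=> [[h /andP[-> ->]] [h' /andP[-> ->]]].
by move=> [[h h'] /andP[/andP[-> ->] /andP[-> ->]]].
Qed.

(** A sequence rather than a countable set, since unions and null sets are indexed by integers
    below; codes that decode to nothing get the harmless value 0. *)
Definition rat_row (n : nat) : E :=
  if unpickle n is Some r then map_mx ratr (r : 'rV[rat]_d) else 0.

Definition rat_row_time (n : nat) : E * R :=
  if unpickle n is Some r then
    (map_mx ratr (r.1 : 'rV[rat]_d), ratr (r.2 : rat)) else (0, 0).

Let rat_near (x e : R) : 0 < e -> exists q : rat, `|x - ratr q| < e.
Proof.
move=> e0; have [q] := rat_in_itvoo (x := x - e) (y := x + e) ltac:(lra).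
by rewrite in_itv/= => /andP[? ?]; exists q; rewrite ltr_norml; apply/andP; split; lra.
Qed.

Let rat_row_near (x : E) (e : R) : 0 < e ->
  exists r : 'rV[rat]_d, ball x e (map_mx ratr r).
Proof.
move=> e0; have /choice[f Hf] : forall i, exists q : rat, `|x 0 i - ratr q| < e.
  by move=> i; exact: rat_near.
exists (\row_i f i); rewrite ball_rowE// => i; rewrite !mxE.
by have := Hf i; rewrite ltr_norml => /andP[? ?]; apply/andP; split; lra.
Qed.

Lemma rat_row_dense (x : E) (e : R) : 0 < e -> exists n, ball x e (rat_row n).
Proof.
move=> /(rat_row_near x)[r xr]; exists (pickle r).
by rewrite /rat_row pickleK.
Qed.

Lemma rat_row_time_dense (x : E * R) (e : R) : 0 < e ->
  exists n, ball x e (rat_row_time n).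
Proof.
move=> e0; have [r xr] := rat_row_near x.1 e0; have [q xq] := rat_near x.2 e0.
by exists (pickle (r, q)); rewrite /rat_row_time pickleK.
Qed.

Definition boxes : set (set E) := [set box p.1 p.2 | p in [set: E * E]].
Definition sboxes : set (set (E * R)) :=
  [set sbox p.1.1 p.1.2 p.2.1 p.2.2 | p in [set: (E * E) * (R * R)]].

Lemma borel_boxes : @measurable _ (borel E) = <<s boxes >>.
Proof.
apply: (borel_generated rat_row_dense).
  move=> n r r0; rewrite ball_rowE//.
  by exists (rat_row n - const_mx r, rat_row n + const_mx r).
by move=> _ [p _ <-]; exact: open_box.
Qed.

Lemma borel_sboxes : @measurable _ (borel (E * R)%type) = <<s sboxes >>.
Proof.
apply: (borel_generated rat_row_time_dense).
  move=> n r r0; rewrite ball_rowRE//; set z := rat_row_time n.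
  by exists ((z.1 - const_mx r, z.1 + const_mx r), (z.2 - r, z.2 + r)).
by move=> _ [p _ <-]; exact: open_sbox.
Qed.

Lemma boxes_setI : setI_closed boxes.
Proof.
by move=> _ _ [p _ <-] [q _ <-]; rewrite box_setI;
  exists (box_max p.1 q.1, box_min p.2 q.2).
Qed.

Lemma sboxes_setI : setI_closed sboxes.
Proof.
by move=> _ _ [p _ <-] [q _ <-]; rewrite sbox_setI; exists ((box_max p.1.1 q.1.1,
  box_min p.1.2 q.1.2), (Num.max p.2.1 q.2.1, Num.min p.2.2 q.2.2)).
Qed.

(** Dynkin's lemma for the open boxes, which are stable under intersection and contain the balls of
    the max-norm. The whole space is a case of its own because boxes are bounded. *)
Lemma sbox_induction (P : set (E * R) -> Prop) :
  P setT -> (forall a b s t, P (sbox a b s t)) ->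
  (forall S, measurable (S : set (borel (E * R)%type)) -> P S -> P (~` S)) ->
  (forall F : (set (E * R))^nat,
    (forall n, measurable (F n : set (borel (E * R)%type))) -> trivIset setT F ->
    (forall n, P (F n)) -> P (\bigcup_k F k)) ->
  forall A, measurable (A : set (borel (E * R)%type)) -> P A.
Proof.
move=> PT Pbox PC PU A; rewrite borel_sboxes.
apply: (@dynkin_induction _ (borel (E * R)%type) sboxes).
- exact: borel_sboxes.
- exact: sboxes_setI.
- exact: PT.
- by move=> _ [p _ <-]; exact: Pbox.
- exact: PC.
- exact: PU.
Qed.

Lemma box_induction (P : set E -> Prop) :
  P setT -> (forall a b, P (box a b)) ->
  (forall S, measurable (S : set (borel E)) -> P S -> P (~` S)) ->
  (forall F : (set E)^nat,
    (forall n, measurable (F n : set (borel E))) -> trivIset setT F ->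
    (forall n, P (F n)) -> P (\bigcup_k F k)) ->
  forall A, measurable (A : set (borel E)) -> P A.
Proof.
move=> PT Pbox PC PU A; rewrite borel_boxes.
apply: (@dynkin_induction _ (borel E) boxes).
- exact: borel_boxes.
- exact: boxes_setI.
- exact: PT.
- by move=> _ [p _ <-]; exact: Pbox.
- exact: PC.
- exact: PU.
Qed.

Lemma exhausts_space : exhausts [set: E] (fun n => cball n%:R).
Proof.
split=> [n|A /bounded_sub_cball[n An] _]; last by exists n.
by split => //; exact: compact_cball.
Qed.

Lemma exhausts_slab T :
  exhausts (slab T : set (E * R)) (fun n => cball n%:R `*` `[0, T]).
Proof.
split=> [n|A bA As].
  split; last by move=> z [_ h]; split.
  by apply: compact_setX; [exact: compact_cball|exact: segment_compact].
have : bounded_set (fst @` A).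
  move: bA => [M [Mr HM]]; exists M; split => // e Me _ [z Az <-].
  by apply: le_trans (HM _ Me z Az); rewrite prod_normE le_max lexx.
move=> /bounded_sub_cball[n An]; exists n => z Az.
by split; [apply: An; exists z|exact: (As z Az).2].
Qed.

(* Half-line sections through the time coordinate. *)
Definition slice (A : set (E * R)) (t : R) : set E := (fun x => (x, t)) @^-1` A.

Lemma slice_borel (A : set (E * R)) t : measurable (A : set (borel (E * R)%type)) ->
  measurable (slice A t : set (borel E)).
Proof.
move=> mA; have c : continuous (fun x : E => (x, t)).
  move=> x; apply: (@cvg_pair _ _ _ (nbhs x) (nbhs x) (nbhs t) _ _ _ id (cst t)).
    exact: cvg_id.
  exact: cvg_cst.
by have := continuous_borel c measurableT mA; rewrite setTI.
Qed.

Lemma fst_borel : measurable_fun setT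
  (fst : borel (E * R)%type -> borel E).
Proof. by apply: continuous_borel => z; exact: cvg_fst. Qed.

Lemma snd_borel : measurable_fun setT (snd : borel (E * R)%type -> R).
Proof. by apply: continuous_borel_real => z; exact: cvg_snd. Qed.

Lemma setX_borel (B : set (borel E)) (J : set R) : measurable B -> measurable J ->
  measurable (B `*` J : set (borel (E * R)%type)).
Proof.
move=> mB mJ; have := measurableI _ _ (fst_borel measurableT mB)
  (snd_borel measurableT mJ); rewrite !setTI.
by congr measurable; apply/seteqP; split.
Qed.

End Boxes.

(** * Measurable families of signed measures *)

Section LebesgueLine.
Context {R : realType}.

Lemma leb_measurable (J : set R) : measurable J ->
  measurable (J : set (lebesgue_line R)).
Proof. exact: sub_caratheodory. Qed.

Lemma leb_measurable_itv (i : interval R) :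
  measurable ([set` i] : set (lebesgue_line R)).
Proof. by apply: leb_measurable; exact: measurable_itv. Qed.

(* Lebesgue sets differ from Borel sets by null sets. *)
Lemma leb_inner_borel (J : set (lebesgue_line R)) : measurable J ->
  exists2 A : set R, measurable A &
    A `<=` J /\ (leb R).-negligible (J `\` A).
Proof.
move=> mJ.
have e := congr1 (fun f => f J) (@completed_caratheodory_measurable R).
have := eq_ind_r (fun P : Prop => P) mJ e.
rewrite g_sigma_completed_algebra_genE => -[A mA [N nN <-]].
exists A => //; split; first exact: subsetUl.
rewrite setDUl setDv set0U.
have [B [mB B0 NB]] := nN.
exists B; split => //; first exact: leb_measurable.
by apply: subset_trans NB; exact: subDsetl.
Qed.

Lemma leb_aeS (P Q : R -> Prop) : {ae leb R, forall t, P t} ->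
  (forall t, P t -> Q t) -> {ae leb R, forall t, Q t}.
Proof.
have F : Filter (almost_everywhere (leb R)) by exact: _.
by move=> hP PQ; exact: (filterS PQ hP).
Qed.

Lemma leb_aeI (P Q : R -> Prop) : {ae leb R, forall t, P t} ->
  {ae leb R, forall t, Q t} -> {ae leb R, forall t, P t /\ Q t}.
Proof.
have F : Filter (almost_everywhere (leb R)) by exact: _.
by move=> hP hQ; exact: (filterI hP hQ).
Qed.

Lemma leb_ae_countable (I : countType) (P : I -> R -> Prop) :
  (forall i, {ae leb R, forall t, P i t}) ->
  {ae leb R, forall t, forall i, P i t}.
Proof.
move=> hP; have : {ae leb R, forall t : R, forall n : nat,
    if unpickle n is Some i then P i t else True}.
  apply/ae_foralln => n; case: (unpickle n) => [i|]; first exact: hP.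
  exact: aeW.
by move=> /leb_aeS; apply => t Ht i; have := Ht (pickle i); rewrite pickleK.
Qed.

End LebesgueLine.

Section Family.
Context {R : realType} {d : nat}.
Local Notation E := 'rV[R]_d.
Local Notation ER := (E * R)%type.

(** The working form of a family. The values vanish off [0, T], so that measurability in t holds on
    the whole line, and one integrable function of t dominates all Borel subsets of a given compact
    set at once, as dominated convergence demands. *)
Record regular_family (T : R) (m : R -> set E -> R) : Prop := RegularFamily {
  family_lb : forall t, locally_bounded_measure setT (m t) ;
  family_measurable : forall B : set (borel E), measurable B -> bounded_set (B : set E) ->
    measurable_fun setT (fun t : lebesgue_line R => m t B) ;
  family_out : forall t B, t \notin `[0, T] -> m t B = 0 ;
  family_dominated : forall K : set E, compact K ->
    exists2 g : lebesgue_line R -> R, (leb R).-integrable `[0, T] (EFin \o g) &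
      forall t (B : set (borel E)), t \in `[0, T] -> measurable B -> B `<=` K ->
        `|m t B| <= g t }.

Arguments family_lb {T m} _ t _ _ _ _ _ _.
Arguments family_measurable {T m} _ B _ _.
Arguments family_out {T m} _ t B _.

Lemma regular_familyN T m : regular_family T m ->
  regular_family T (fun t B => - m t B).
Proof.
move=> [h1 h2 h3 h4]; split.
- by move=> t; exact: lbN.
- by move=> B mB bB; apply: measurable_funN; exact: h2.
- by move=> t B tT; rewrite h3// oppr0.
- move=> K /h4[g Ig H]; exists g => // t B tT mB BK; rewrite normrN; exact: H.
Qed.

Lemma regular_familyB T m1 m2 : regular_family T m1 -> regular_family T m2 ->
  regular_family T (fun t B => m1 t B - m2 t B).
Proof.
move=> [h1 h2 h3 h4] [k1 k2 k3 k4]; split.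
- by move=> t; exact: lbB.
- by move=> B mB bB; apply: measurable_funB; [exact: h2|exact: k2].
- by move=> t B tT; rewrite h3// k3// subr0.
- move=> K cK; have [g Ig H] := h4 K cK; have [g' Ig' H'] := k4 K cK.
  exists (fun t => g t + g' t).
    have mI : measurable (`[0, T] : set (lebesgue_line R)).
      exact: leb_measurable_itv.
    by apply: eq_integrable (integrableD mI Ig Ig').
  move=> t B tT mB BK; apply: (le_trans (ler_normB _ _)).
  by apply: lerD; [exact: H|exact: H'].
Qed.

Section Measurability.
Variables (T : R) (m : R -> set E -> R) (mf : regular_family T m).
Variables (K : set E) (cK : compact K).

Let mK : measurable (K : set (borel E)). Proof. exact: compact_borel. Qed.
Let bK : bounded_set K. Proof. exact: compact_bounded. Qed.

Lemma slice0 t : slice (set0 : set ER) t = set0.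
Proof. by rewrite /slice preimage_set0. Qed.

Lemma slice_bigcup_partial_sum (F : nat -> set ER) t n :
  (forall i, measurable (F i : set (borel ER))) -> trivIset setT F ->
  m t (slice (\bigcup_(i in [set i | (i < n)%N]) F i) t `&` K) =
  \sum_(0 <= i < n) m t (slice (F i) t `&` K).
Proof.
move=> mF tF; elim: n => [|n IH].
  rewrite big_nil bigcup0//.
  by rewrite slice0 set0I (lb_set0 (family_lb mf t)).
rewrite big_nat_recr//= -IH.
have -> : \bigcup_(i in [set i | (i < n.+1)%N]) F i =
   (\bigcup_(i in [set i | (i < n)%N]) F i) `|` F n.
  by rewrite !bigcup_mkord big_ord_recr.
rewrite {1}/slice preimage_setU setIUl.
have mU : measurable (\bigcup_(i in [set i | (i < n)%N]) F i : set (borel ER)).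
  by apply: fin_bigcup_measurable => // i _; exact: mF.
rewrite (lb_setU (family_lb mf t) cK (@subsetT _ K))//.
- by apply: measurableI => //; exact: slice_borel.
- by apply: measurableI => //; exact: slice_borel.
- rewrite setIACA setIid -preimage_setI.
  rewrite setI_bigcupl (_ : \bigcup_(i in _) _ = set0) ?preimage_set0 ?set0I//.
  apply: bigcup0 => i /= ni; move/trivIsetP: tF; apply => //.
  by rewrite neq_ltn ni.
Qed.

Lemma slice_sum_cvg (F : nat -> set ER) t :
  (forall i, measurable (F i : set (borel ER))) -> trivIset setT F ->
  \sum_(0 <= i < n) m t (slice (F i) t `&` K) @[n --> \oo] -->
  m t (slice (\bigcup_i F i) t `&` K).
Proof.
move=> mF tF; rewrite /slice preimage_bigcup setI_bigcupl.
apply: (family_lb mf t _ cK (@subsetT _ K)) => [n|].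
  by split; [apply: measurableI => //; exact: slice_borel|exact: subIsetr].
apply/trivIsetP => i j _ _ ij; rewrite setIACA setIid -preimage_setI.
by move/trivIsetP: tF => -> //; rewrite preimage_set0 set0I.
Qed.

(** Dynkin induction: for a box the value is the product of m_t of a fixed set and the indicator of
    a time interval, complements are taken inside [K], and disjoint unions are pointwise limits of
    partial sums. *)
Lemma family_slice_measurable (A : set (borel ER)) : measurable A ->
  measurable_fun setT (fun t : lebesgue_line R => m t (slice A t `&` K)).
Proof.
move: A; apply: sbox_induction.
- under eq_fun do rewrite /slice preimage_setT setTI.
  exact: family_measurable mf _ mK bK.
- move=> a b s s'.
  have mB : measurable (box a b `&` K : set (borel E)).
    by apply: measurableI => //; apply: open_borel; exact: open_box.
  rewrite (_ : (fun t => _) =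
      (fun t : lebesgue_line R => m t (box a b `&` K) * \1_`]s, s'[ t)); last first.
    apply/funext => t; rewrite indicE.
    case: (boolP (t \in `]s, s'[)) => ts.
      rewrite mem_set// mulr1; congr (m t (_ `&` K)).
      apply/seteqP; split => x; rewrite /slice/= /sbox/=; first by case.
      by move=> h; split => //; move: ts; rewrite in_itv.
    rewrite memNset ?mulr0; last by move=> /= h; move: ts; rewrite h.
    rewrite (_ : slice _ t = set0) ?set0I ?(lb_set0 (family_lb mf t))//.
    rewrite -subset0 => x [_ /=]; move: ts; rewrite in_itv /= => /negP; exact.
  apply: measurable_funM.
    apply: (family_measurable mf _ mB).
    by apply: sub_bounded_set bK; exact: subIsetr.
  by apply: measurable_indic; exact: leb_measurable_itv.
- move=> S mS PS.
  rewrite (_ : (fun t => _) =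
      (fun t : lebesgue_line R => m t K - m t (slice S t `&` K))).
    exact: (measurable_funB (family_measurable mf _ mK bK) PS).
  apply/funext => t.
  have mSt := slice_borel t mS.
  rewrite (lb_setID (family_lb mf t) cK (@subsetT _ K) mK mSt)//.
  rewrite [K `&` _]setIC [_ + m t _]addrC addrK; congr (m t _).
  by rewrite setDE setIC.
- move=> F mF tF PF.
  refine (@measurable_fun_cvg _ (lebesgue_line R) R setT (fun n t =>
     \sum_(0 <= i < n) m t (slice (F i) t `&` K)) _ _ _).
    by move=> n; apply: measurable_sum => i; exact: PF.
  by move=> t _; exact: slice_sum_cvg.
Qed.

End Measurability.
End Family.

Arguments family_lb {R d T m} _ t _ _ _ _ _ _.
Arguments family_measurable {R d T m} _ B _ _.
Arguments family_out {R d T m} _ t B _.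
Section MonotoneLimits.
Context {R : realType} {X : normedModType R}.
Variables (D : set X) (Kn : nat -> set X) (exD : exhausts D Kn).
Variables (m : set X -> R) (hm : locally_bounded_measure D m).
Variables (K : set X) (cK : compact K) (KD : K `<=` D).

Lemma lb_cvg_nondecreasing (F : nat -> set (borel X)) :
  (forall n, measurable (F n)) -> (forall n, F n `<=` K) -> nondecreasing_seq F ->
  m (F n) @[n --> \oo] --> m (\bigcup_n F n).
Proof.
move=> mF FK ndF.
have mU : measurable (\bigcup_n F n) by exact: bigcupT_measurable.
have UK : \bigcup_n F n `<=` K by apply: bigcup_sub => n _; exact: FK.
have e (A : set (borel X)) : measurable A -> A `<=` K ->
    m A = fine (lb_pos exD hm A) - fine (lb_neg exD hm A).
  move=> mA AK; have h := jordan_measure hm cK KD mA AK.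
  have p_fin : pos_measure D m A \is a fin_num.
    rewrite ge0_fin_numE; first exact: pos_measure_lty AK.
    exact: (measure_ge0 (lb_pos exD hm)).
  have n_fin : neg_measure D m A \is a fin_num.
    rewrite ge0_fin_numE; first by apply: pos_measure_lty AK; first exact: lbN hm.
    exact: (measure_ge0 (lb_neg exD hm)).
  by apply: EFin_inj; rewrite EFinB !fineK.
rewrite (e _ mU UK); under eq_fun do rewrite e//.
have H (mu : {measure set (borel X) -> \bar R}) :
    (mu (\bigcup_n F n) < +oo)%E ->
    fine (mu (F n)) @[n --> \oo] --> fine (mu (\bigcup_n F n)).
  move=> fin; apply: fine_cvg; rewrite fineK ?ge0_fin_numE//.
  exact: nondecreasing_cvg_mu.
apply: cvgB; apply: H.
  exact: pos_measure_lty UK.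
by apply: pos_measure_lty UK; first exact: lbN hm.
Qed.

Lemma lb_setD (A B : set (borel X)) : measurable A -> measurable B ->
  B `<=` A -> A `<=` K -> m (A `\` B) = m A - m B.
Proof.
move=> mA mB BA AK; rewrite (lb_setID hm cK KD mA mB AK) (setIidr BA).
by rewrite addrAC subrr add0r.
Qed.

Lemma lb_cvg_nonincreasing (F : nat -> set (borel X)) :
  (forall n, measurable (F n)) -> (forall n, F n `<=` K) -> nonincreasing_seq F ->
  m (F n) @[n --> \oo] --> m (\bigcap_n F n).
Proof.
move=> mF FK niF.
have mK : measurable (K : set (borel X)) by exact: compact_borel.
have mI : measurable (\bigcap_n F n) by exact: bigcapT_measurable.
have IK : \bigcap_n F n `<=` K by move=> x /(_ 0%N I); exact: FK.
have : m (K `\` F n) @[n --> \oo] --> m (\bigcup_n (K `\` F n)).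
  apply: lb_cvg_nondecreasing.
  - by move=> n; exact: measurableD.
  - by move=> n; exact: subDsetl.
  - move=> a b ab; apply/subsetPset; apply: setDS; exact/subsetPset/niF.
have -> : \bigcup_n (K `\` F n) = K `\` \bigcap_n F n.
  by rewrite setDE setC_bigcap setI_bigcupr.
rewrite lb_setD//; under eq_fun do rewrite lb_setD//.
move=> h; have -> : (fun n => m (F n)) = (fun n => m K - (m K - m (F n))).
  by apply/funext => n; ring.
have -> : m (\bigcap_n F n) = m K - (m K - m (\bigcap_n F n)) by ring.
by apply: cvgB => //; exact: cvg_cst.
Qed.

End MonotoneLimits.

Section CountableAlgebra.
Context {R : realType} {d : nat}.
Local Notation E := 'rV[R]_d.

(* Boolean combinations of the balls with rational centres and radii: a tree is
   read as an iterated NAND. *)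
Fixpoint rat_set (t : GenTree.tree (nat * nat)) : set E :=
  match t with
  | GenTree.Leaf p => ball (rat_row p.1) p.2.+1%:R^-1
  | GenTree.Node _ l => ~` foldr (fun u A => rat_set u `&` A) setT l
  end.

Lemma rat_set_measurable t : measurable (rat_set t : set (borel E)).
Proof.
elim/GenTree.tree_ind: t => [p|n l IH] /=.
  by apply: open_borel; apply: ball_open; rewrite invr_gt0.
apply: measurableC; elim: l IH => [_|u l IHl /= [mu /IHl]]; first exact: measurableT.
exact: measurableI.
Qed.

Lemma rat_set_setring : setring (range rat_set).
Proof.
have C A : range rat_set A -> range rat_set (~` A).
  by move=> [t _ <-]; exists (GenTree.Node 0 [:: t]) => //=; rewrite setIT.
have I A B : range rat_set A -> range rat_set B -> range rat_set (A `&` B).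
  move=> [t _ <-] [u _ <-]; rewrite -[_ `&` _]setCK; apply: C.
  by exists (GenTree.Node 0 [:: t; u]) => //=; rewrite setIT.
split.
- by rewrite -setCT; apply: C; exists (GenTree.Node 0 [:: GenTree.Node 0 [::]]);
    rewrite //= setIT setCK.
- by move=> A B ? ?; rewrite -[_ `|` _]setCK setCU; apply: (C); apply: (I); exact: C.
- by move=> A B ? ?; rewrite setDE; apply: (I) => //; exact: C.
Qed.

(** The monotone class theorem over a countable ring. It serves to extend an inequality from
    countably many sets, valid off one null set of times, to all Borel sets; Dynkin's lemma would
    not do, since positivity does not pass to complements. *)
Lemma borel_monotone_class (M : set (set E)) : (forall t, M (rat_set t)) ->
  monotone M -> forall A, measurable (A : set (borel E)) -> M A.
Proof.
move=> Mr Mm.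
have srM : <<sr range rat_set>> `<=` M.
  rewrite -(g_monotone_g_sigma_ring rat_set_setring).
  by apply: smallest_sub => // _ [t _ <-].
have [sr0 srD srU] := smallest_sigma_ring (range rat_set).
have srT : <<sr range rat_set>> setT.
  apply: sub_g_sigma_ring; exists (GenTree.Node 0 [:: GenTree.Node 0 [::]]) => //=.
  by rewrite setIT setCK.
have sa : sigma_algebra setT <<sr range rat_set>>.
  by split => // A ?; exact: srD.
move=> A mA; apply: srM; move: A mA.
apply: smallest_sub; first exact: sa.
move=> U oU; rewrite (dense_open_bigcup rat_row_dense oU).
apply: (srU) => n; rewrite bigcup_mkcond; apply: (srU) => k.
case: ifP => _ //; apply: sub_g_sigma_ring.
by exists (GenTree.Leaf (n, k)).
Qed.

End CountableAlgebra.

(** * The measure m_t(dx)dt and the slices of its Hahn sets *)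

Section KernelCharge.
Context {R : realType} {d : nat}.
Local Notation E := 'rV[R]_d.
Local Notation ER := (E * R)%type.
Variables (T : R) (m : R -> set E -> R) (mf : regular_family T m).
Variables (K : set E) (cK : compact K).

Let mT : measurable (`[0, T] : set (lebesgue_line R)) := leb_measurable_itv _.

Lemma family_slice_integrable (A : set (borel ER)) : measurable A ->
  (leb R).-integrable `[0, T] (fun t => (m t (slice A t `&` K))%:E).
Proof.
move=> mA; have [g Ig Hg] := family_dominated mf cK.
apply: (le_integrable mT _ _ Ig).
  apply/measurable_EFinP.
  by apply: measurable_funS (family_slice_measurable mf cK mA).
move=> t tT; rewrite lee_fin.
apply: le_trans (ler_norm _); apply: Hg => //.
  by apply: measurableI; [exact: slice_borel|exact: compact_borel].
Qed.

Definition kernel_integral (A : set ER) : R :=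
  \int[leb R]_(t in `[0, T]) m t (slice A t `&` K).

Definition kernel_charge of regular_family T m & compact K :
  set (borel ER) -> \bar R := fun A => (kernel_integral A)%:E.
Local Notation nu := (kernel_charge mf cK).

Let nu0 : nu set0 = 0%E.
Proof.
rewrite /kernel_charge /kernel_integral.
under eq_Rintegral => t _ do rewrite slice0 set0I (lb_set0 (family_lb mf t)).
by rewrite Rintegral_cst// mul0r.
Qed.

Let nu_fin (A : set (borel ER)) : measurable A -> nu A \is a fin_num.
Proof. by []. Qed.

Let nu_sigma : semi_sigma_additive nu.
Proof.
move=> F mF tF mU.
have e n : (\sum_(0 <= i < n) nu (F i))%E = (\int[leb R]_(t in `[0, T])
    m t (slice (\bigcup_(i in [set i | (i < n)%N]) F i) t `&` K))%:E.
  rewrite sumEFin; congr EFin; elim: n => [|n IH].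
    rewrite big_nil bigcup0//.
    by have [] := nu0; rewrite /kernel_integral => ->.
  rewrite big_nat_recr//= IH /kernel_integral -RintegralD//.
  - apply: eq_Rintegral => t _.
    by rewrite !(slice_bigcup_partial_sum mf cK)// big_nat_recr.
  - apply: family_slice_integrable; apply: fin_bigcup_measurable => //.
  - exact: family_slice_integrable.
under eq_fun do rewrite e.
apply: cvg_EFin; first exact: nearW.
have [g Ig Hg] := family_dominated mf cK.
apply: (Rintegral_dominated_cvg mT _ _ _ _ Ig).
- move=> n; apply: measurable_funS (family_slice_measurable mf cK _) => //.
  by apply: fin_bigcup_measurable => //.
- exact: measurable_funS (family_slice_measurable mf cK _).
- move=> t _; have := @slice_sum_cvg _ _ _ _ mf _ cK F t mF tF.
  by under eq_fun do rewrite -(slice_bigcup_partial_sum mf cK)//.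
- move=> n t tT; apply: Hg => //.
  apply: measurableI; last exact: compact_borel.
  by apply: slice_borel; apply: fin_bigcup_measurable => //.
Qed.

HB.instance Definition _ := isCharge.Build _ (borel ER) R nu nu0 nu_fin nu_sigma.

End KernelCharge.

Section BorelTest.
Context {R : realType} (T : R) (f : R -> R).
Let mT : measurable (`[0, T] : set (lebesgue_line R)) := leb_measurable_itv _.
Hypothesis If : (leb R).-integrable `[0, T] (EFin \o f).

(** The set where f < 0 is only Lebesgue measurable, while the hypothesis tests Borel sets. A Borel
    subset [A] of it with null difference is tested instead: the integral of f over [A] is both
    nonnegative and nonpositive, so [A] is null. *)
Lemma ae_ge0_of_borel :
  (forall J : set R, measurable J -> 0 <= \int[leb R]_(t in `[0, T]) (f t * \1_J t)) ->
  {ae leb R, forall t, t \in `[0, T] -> 0 <= f t}.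
Proof.
move=> H; have mf : measurable_fun (`[0, T] : set (lebesgue_line R)) f.
  exact/measurable_EFinP/(measurable_int _ If).
pose S : set (lebesgue_line R) := `[0, T] `&` [set t | f t < 0].
have mS : measurable S.
  rewrite (_ : S = `[0, T] `&` f @^-1` `]-oo, 0[%classic).
    by apply: mf => //; exact: measurable_itv.
  by apply/seteqP; split => t /=; rewrite in_itv.
have [A mA [AS nSA]] := leb_inner_borel mS.
have mA' := leb_measurable mA.
suff A0 : leb R A = 0%E.
  have nS : (leb R).-negligible S.
    rewrite -(setDUK AS); apply: negligibleU nSA.
    by exists A; split.
  apply: negligibleS nS => t /= /not_implyP[tT] /negP; rewrite -ltNge => ft.
  by split.
have AT : A `<=` `[0, T] by move=> t /AS[].
have IA : (leb R).-integrable A (EFin \o f) by exact: integrableS If.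
have : \int[leb R]_(t in `[0, T]) (f t * \1_A t) = \int[leb R]_(t in A) f t.
  rewrite -[in RHS](setIidr AT) Rintegral_mkcondr; apply: eq_Rintegral => t _.
  by rewrite /patch indicE; case: ifP => _; rewrite ?mulr1 ?mulr0.
have := H A mA => /[swap] -> h.
have h0 : (\int[leb R]_(t in A) `|(f t)%:E| = 0)%E.
  have -> : (\int[leb R]_(t in A) `|(f t)%:E| = \int[leb R]_(t in A) (- f t)%:E)%E.
    apply: eq_integral => t /set_mem/AS[_ /= ft].
    by rewrite /= ltr0_norm.
  apply/eqP; rewrite eq_le; apply/andP; split; last first.
    by apply: integral_ge0 => t /AS[_ /= ft]; rewrite lee_fin oppr_ge0 ltW.
  under eq_integral do rewrite EFinN.
  rewrite integralN/=; last by apply: integrable_add_def.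
  rewrite leeNl oppe0 -[X in (_ <= X)%E]fineK ?lee_fin//.
  exact: integrable_fin_num.
have := (ae_eq_integral_abs (leb R) mA' (measurable_int _ IA)).1 h0.
move=> [N [mN N0 HN]].
apply: (@subset_measure0 _ _ _ (leb R) A N) => // t At; apply: HN => /= /(_ At)[] ft0.
by have [_ /=] := AS _ At; rewrite ft0 ltxx.
Qed.

End BorelTest.

Section KernelHahn.
Context {R : realType} {d : nat}.
Local Notation E := 'rV[R]_d.
Local Notation ER := (E * R)%type.

(** For each set of the countable ring, the integral over its product with any Borel set of times,
    cut by [P], is nonnegative, so the integrand is nonnegative for almost every t. The countably
    many null sets are united, and outside the union the monotone class theorem reaches all Borel
    [B]. *)
Lemma kernel_ae_ge0 (T : R) (m : R -> set E -> R) (mf : regular_family T m)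
    (K : set E) (cK : compact K) (P : set (borel ER)) : measurable P ->
  (forall A : set (borel ER), measurable A -> A `<=` P ->
    0 <= kernel_integral T m K A) ->
  {ae leb R, forall t, t \in `[0, T] ->
    forall B : set (borel E), measurable B -> 0 <= m t (B `&` slice P t `&` K)}.
Proof.
move=> mP HP.
have mKb : measurable (K : set (borel E)) by exact: compact_borel.
have mA u (J : set R) : measurable J ->
    measurable (P `&` (rat_set u `*` J) : set (borel ER)).
  by move=> mJ; apply: measurableI => //; apply: setX_borel => //; exact: rat_set_measurable.
have Hu u : {ae leb R, forall t, t \in `[0, T] ->
    0 <= m t (rat_set u `&` slice P t `&` K)}.
  have eT t : slice (P `&` (rat_set u `*` (setT : set R))) t = rat_set u `&` slice P t.
    by rewrite /slice; apply/seteqP; split => x /= [] // ? [].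
  have := @ae_ge0_of_borel _ T (fun t => m t (rat_set u `&` slice P t `&` K)).
  apply.
    have h := family_slice_integrable mf cK (mA u setT measurableT).
    apply: (eq_integrable (leb_measurable_itv _) _ _ _ h) => t _ /=.
    by congr (m t (_ `&` _))%:E; exact: eT.
  move=> J mJ.
  have := HP _ (mA u J mJ) (@subIsetl _ _ _).
  rewrite /kernel_integral; congr (_ <= _); apply: eq_Rintegral => t _.
  rewrite indicE; case: (boolP (t \in J)) => tJ.
    rewrite mulr1; congr (m t (_ `&` _)); rewrite /slice.
    move: tJ => /set_mem tJ; apply/seteqP; split => x; first by move=> [? []].
    by move=> [].
  rewrite mulr0 (_ : slice _ t = set0) ?set0I ?(lb_set0 (family_lb mf t))//.
  rewrite -subset0 => x [_ [_ /= tJ']]; move: tJ; rewrite mem_set//.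
apply: leb_aeS (leb_ae_countable Hu) _ => t Ht tT B mB.
have lbt := family_lb mf t.
have mPt := slice_borel t mP.
pose M := [set B : set E | measurable (B : set (borel E)) /\
  0 <= m t (B `&` slice P t `&` K)].
have mI (A : set (borel E)) : measurable A ->
    measurable (A `&` slice P t `&` K : set (borel E)).
  by move=> mA'; do 2 (apply: measurableI => //).
suff [] : M B by [].
apply: borel_monotone_class mB => //.
  move=> u; split; first exact: rat_set_measurable.
  exact: Ht.
have lim_ge0 (u : nat -> R) (l : R) : u n @[n --> \oo] --> l ->
    (forall n, 0 <= u n) -> 0 <= l.
  by move=> cu u0; rewrite -(cvg_lim _ cu)//; apply: limr_ge;
    [apply/cvg_ex; exists l|exact: nearW].
have exE := @exhausts_space R d.
split => F ndF MF.
  split; first by apply: bigcupT_measurable => n; exact: (MF n).1.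
  rewrite !setI_bigcupl; apply: lim_ge0 (fun n => (MF n).2).
  apply: (lb_cvg_nondecreasing exE lbt cK (@subsetT _ K)).
  - by move=> n; apply: mI; exact: (MF n).1.
  - by move=> n; exact: subIsetr.
  - by move=> p q pq; apply/subsetPset; do 2 apply: setSI; exact/subsetPset/ndF.
split; first by apply: bigcapT_measurable => n; exact: (MF n).1.
rewrite -setIA setIC -bigcapIr; last by exists 0%N.
under eq_bigcapr do rewrite setIC setIA.
apply: lim_ge0 (fun n => (MF n).2).
apply: (lb_cvg_nonincreasing exE lbt cK (@subsetT _ K)).
- by move=> n; apply: mI; exact: (MF n).1.
- by move=> n; exact: subIsetr.
- by move=> p q pq; apply/subsetPset; do 2 apply: setSI; exact/subsetPset/ndF.
Qed.

Lemma kernel_integralN (T : R) (m : R -> set E -> R) (mf : regular_family T m)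
    (K : set E) (cK : compact K) (A : set (borel ER)) : measurable A ->
  kernel_integral T (fun t B => - m t B) K A = - kernel_integral T m K A.
Proof.
move=> mA; rewrite /kernel_integral -mulN1r -RintegralZl.
- by apply: eq_Rintegral => t _; rewrite mulN1r.
- exact: leb_measurable_itv.
- exact: family_slice_integrable.
Qed.

(* A Hahn set of the measure m_t(dx)dt is, for almost every t, sliced into Hahn
   sets of m_t. *)
Lemma kernel_hahn (T : R) (m : R -> set E -> R) (mf : regular_family T m)
    (K : set E) (cK : compact K) : exists2 P : set (borel ER), measurable P &
  {ae leb R, forall t, t \in `[0, T] -> hahn_on (m t) K (slice P t)}.
Proof.
have [P [N [[mP Ppos] [mN Nneg] PN PN0]]] :=
  Hahn_decomposition (kernel_charge mf cK).
exists P => //.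
have hP := @kernel_ae_ge0 T m mf K cK P mP (fun A mA AP => Ppos A mA AP).
have hN : {ae leb R, forall t, t \in `[0, T] -> forall B : set (borel E),
    measurable B -> 0 <= - m t (B `&` slice N t `&` K)}.
  apply: (kernel_ae_ge0 (regular_familyN mf) cK mN) => A mA AN.
  rewrite (kernel_integralN mf)// oppr_ge0; exact: Nneg A mA AN.
apply: leb_aeS (leb_aeI hP hN) _ => t [h1 h2] tT A mA AK; split.
  by have := h1 tT A mA; rewrite setIAC (setIidl AK).
have := h2 tT A mA; rewrite oppr_ge0 setIAC (setIidl AK).
congr (m t _ <= 0); rewrite setDE; congr (_ `&` _).
apply/seteqP; split => x; rewrite /slice /=.
  by move=> Nx Px; have : (P `&` N) (x, t) by []; rewrite PN0.
by move=> nPx; have : [set: ER] (x, t) by []; rewrite -PN => -[].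
Qed.

End KernelHahn.

(** * Integrals against m_t dt compared with integrals over space-time *)

Section KernelIntegral.
Context d d' (Y : measurableType d) (Z : measurableType d') (R : realType).
Variables (la : {measure set Y -> \bar R}) (D : set Y) (mD : measurable D).
Variables (ka : Y -> {measure set Z -> \bar R}) (mu : {measure set Z -> \bar R}).
Hypothesis mka : forall A, measurable A -> measurable_fun setT (fun y => ka y A).
Hypothesis ka_le : forall A, measurable A ->
  (\int[la]_(y in D) ka y A <= mu A)%E.
Local Open Scope ereal_scope.

Import HBNNSimple.

Let kernel_le_nnsfun (f : {nnsfun Z >-> R}) :
  \int[la]_(y in D) (\int[ka y]_z (f z)%:E) <= \int[mu]_z (f z)%:E.
Proof.
rewrite integralT_nnsfun sintegralE.
under eq_integral do rewrite integralT_nnsfun sintegralE.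
have f0 (m : {measure set Z -> \bar R}) r : 0 <= r%:E * m (f @^-1` [set r]).
  have := mulemu_ge0 (fun n => f @^-1` [set n]).
  by apply; exact: preimage_nnfun0.
rewrite ge0_integral_fsum//; last first.
- by move=> r; apply: measurable_funeM; apply: measurable_funS (mka _).
apply: lee_fsum => // r _.
have [r0|r0] := leP 0%R r; last first.
  rewrite preimage_nnfun0// measure0 mule0 integral0_eq// => y _.
  by rewrite measure0 mule0.
rewrite ge0_integralZl//; first by apply: lee_wpmul2l => //; exact: ka_le.
by apply: measurable_funS (mka _).
Qed.

(** An inequality between values on sets passes to simple functions by linearity and then to
    nonnegative functions by monotone convergence on both sides. *)
Lemma kernel_le_integral (g : Z -> \bar R) : (forall z, 0 <= g z) ->
  measurable_fun setT g ->
  \int[la]_(y in D) (\int[ka y]_z g z) <= \int[mu]_z g z.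
Proof.
move=> g0 mg; pose g_ := nnsfun_approx measurableT mg.
have mono (m : {measure set Z -> \bar R}) :
    \int[m]_z g z = lim (\int[m]_z (g_ n z)%:E @[n --> \oo]).
  rewrite -monotone_convergence//.
  - by apply: eq_integral => z _; apply/esym/cvg_lim => //; exact: cvg_nnsfun_approx.
  - by move=> n; exact/measurable_EFinP.
  - by move=> n z _; rewrite lee_fin.
  - by move=> z _ a b ab; rewrite lee_fin; exact/lefP/nd_nnsfun_approx.
have nd (m : {measure set Z -> \bar R}) :
    {homo (fun n => \int[m]_z (g_ n z)%:E) : a b / (a <= b)%N >-> a <= b}.
  move=> a b ab; apply: ge0_le_integral => //.
  - by move=> z _; rewrite lee_fin.
  - exact/measurable_EFinP.
  - exact/measurable_EFinP.
  - by move=> z _; rewrite lee_fin; exact/lefP/nd_nnsfun_approx.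
under eq_integral do rewrite mono.
rewrite monotone_convergence//.
- rewrite mono; apply: lee_lim.
  + apply: ereal_nondecreasing_is_cvgn => a b ab; apply: ge0_le_integral => //.
    + by move=> y _; apply: integral_ge0 => z _; rewrite lee_fin.
    + apply: measurable_funS (measurable_fun_integral_kernel mka _ _) => //.
        by move=> z; rewrite lee_fin.
      exact/measurable_EFinP.
    + apply: measurable_funS (measurable_fun_integral_kernel mka _ _) => //.
        by move=> z; rewrite lee_fin.
      exact/measurable_EFinP.
    + by move=> y _; exact: nd.
  - exact: ereal_nondecreasing_is_cvgn (nd mu).
  - by apply: nearW => n; exact: kernel_le_nnsfun.
- move=> n; apply: measurable_funS (measurable_fun_integral_kernel mka _ _) => //.
  + by move=> z; rewrite lee_fin.
  + exact/measurable_EFinP.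
- by move=> n y _; apply: integral_ge0 => z _; rewrite lee_fin.
Qed.

End KernelIntegral.

Section RestrictedMeasure.
Context d (Z : measurableType d) (R : realType).
Variables (mu : {measure set Z -> \bar R}) (D : set Z) (mD : measurable D).

Lemma ge0_integral_mrestr (f : Z -> \bar R) : (forall z, (0 <= f z)%E) ->
  measurable_fun setT f ->
  (\int[mrestr mu mD]_z f z = \int[mu]_(z in D) f z)%E.
Proof.
move=> f0 mf; rewrite -(setUv D) ge0_integral_setU//.
- rewrite [X in (_ + X)%E]null_set_integral ?adde0.
  + by apply: eq_measure_integral => A mA AD; rewrite /= /mrestr setIidl.
  + exact: measurableC.
  + exact: measurable_funS mf.
  + by rewrite /= /mrestr setICl measure0.
- exact: measurableC.
- exact: measurable_funS mf.
- by apply/disj_setPS; rewrite setICr.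
Qed.

End RestrictedMeasure.

Section FamilyIntegral.
Context {R : realType} {d : nat}.
Local Notation E := 'rV[R]_d.
Local Notation ER := (E * R)%type.
Variables (T : R) (m : R -> set E -> R) (mf : regular_family T m).
Variables (K : set E) (cK : compact K).

Let mT : measurable (`[0, T] : set (lebesgue_line R)) := leb_measurable_itv _.
Let mK : measurable (K : set (borel E)). Proof. exact: compact_borel. Qed.

(** The identification of the space-time measure is made on the open slab only; the two endpoints it
    leaves out form a null set. *)
Lemma leb_ae_interior : {ae leb R, forall t, t \in `[0, T] -> t \in `]0, T[}.
Proof.
have n1 (a : R) : (leb R).-negligible [set a].
  exists [set a]; split => //; first by apply: leb_measurable; exact: measurable_set1.
  exact: lebesgue_measure_set1.
apply: negligibleS (negligibleU (n1 0) (n1 T)) => t /= /not_implyP[].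
rewrite !in_itv/= => /andP[t0 tT] /negP; rewrite negb_and -!leNgt => /orP[?|?].
  by left; apply/eqP; rewrite eq_le t0 andbT.
by right; apply/eqP; rewrite eq_le tT.
Qed.

Definition family_pos (mf : regular_family T m) t :
  {measure set (borel E) -> \bar R} :=
  lb_pos (@exhausts_space R d) (family_lb mf t).

Lemma family_pos_out t A : t \notin `[0, T] -> family_pos mf t A = 0%E.
Proof.
move=> tT; apply/eqP; rewrite eq_le measure_ge0 andbT.
by apply: ge_ereal_sup => _ [B _ <-]; rewrite (family_out mf).
Qed.

(** The positive part of m_t is a supremum over uncountably many sets, so its measurability in t is
    not immediate. With [P] a space-time Hahn set it equals, for almost every t, the value of m_t on
    a slice of [A] cut by [P], which is measurable in t; completeness of Lebesgue measure disposes
    of the exceptional times. *)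
Lemma family_pos_measurable (A : set (borel ER)) : measurable A ->
  measurable_fun setT (fun t : lebesgue_line R => family_pos mf t (slice A t `&` K)).
Proof.
move=> mA; have [P mP HP] := kernel_hahn mf cK.
have -> : (fun t : lebesgue_line R => family_pos mf t (slice A t `&` K)) =
    (fun t => family_pos mf t (slice A t `&` K)) \_ `[0, T].
  apply/funext => t; rewrite /patch; case: ifPn => // tT.
  by apply: family_pos_out; apply: contra tT => tT; rewrite inE.
apply/(measurable_restrictT _ mT).
have mAP : measurable (A `&` P : set (borel ER)) by exact: measurableI.
apply: (ae_measurable_fun (@completed_lebesgue_measure_is_complete R)
  (f := fun t => (m t (slice (A `&` P) t `&` K))%:E)).
  apply: leb_aeS HP _ => t Ht tT.
  have mAt : measurable (slice A t `&` K : set (borel E)).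
    by apply: measurableI => //; exact: slice_borel.
  have h := pos_measureE (family_lb mf t) cK (@subsetT _ K) (slice_borel t mP)
    (Ht tT) mAt (@subIsetr _ _ _).
  by apply: etrans _ (esym h); rewrite /slice preimage_setI setIAC.
apply/measurable_EFinP.
by apply: measurable_funS (family_slice_measurable mf cK mAP).
Qed.

Let pair_meas t : measurable_fun setT (pair^~ t : borel E -> borel ER).
Proof.
apply: continuous_borel => x.
by apply: (@cvg_pair _ _ _ (nbhs x) (nbhs x) (nbhs t) _ _ _ id (cst t));
  [exact: cvg_id|exact: cvg_cst].
Qed.

(** The measure m_t^+ on [K] carried to the hyperplane at time t. As a family of measures on
    space-time it is the kernel to which [kernel_le_integral] applies. *)
Definition family_slice_measure (mf : regular_family T m) (cK : compact K) t
  (A : set (borel ER)) : \bar R := family_pos mf t (slice A t `&` K).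

Section SliceMeasure.
Variable t : R.
Local Notation ka := (family_slice_measure mf cK t).
Let ka0 : ka set0 = 0%E.
Proof. by rewrite /family_slice_measure slice0 set0I measure0. Qed.
Let ka_ge0 A : (0 <= ka A)%E. Proof. exact: measure_ge0. Qed.
Let ka_sigma : semi_sigma_additive ka.
Proof.
move=> F mF tF mU; rewrite /family_slice_measure /slice preimage_bigcup setI_bigcupl.
apply: measure_semi_sigma_additive.
- by move=> i; apply: measurableI => //; exact: slice_borel.
- apply/trivIsetP => i j _ _ ij; rewrite setIACA setIid -preimage_setI.
  by move/trivIsetP: tF => -> //; rewrite preimage_set0 set0I.
- apply: bigcupT_measurable => i.
  by apply: measurableI => //; exact: slice_borel.
Qed.
HB.instance Definition _ := isMeasure.Build _ (borel ER) R ka ka0 ka_ge0 ka_sigma.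
End SliceMeasure.

Lemma integral_family_slice t (g : borel ER -> \bar R) :
  (forall z, (0 <= g z)%E) -> measurable_fun setT g ->
  (\int[family_slice_measure mf cK t]_z g z =
   \int[family_pos mf t]_(x in K) g (x, t))%E.
Proof.
move=> g0 mg.
have := @ge0_integral_pushforward _ _ (borel E) (borel ER) R (pair^~ t) (pair_meas t)
  (mrestr (family_pos mf t) mK) setT g measurableT mg (fun z _ => g0 z).
rewrite preimage_setT ge0_integral_mrestr//; first by move=> x; exact: g0.
exact: measurableT_comp mg (pair_meas t).
Qed.

Lemma family_pos_integral_measurable (g : borel ER -> \bar R) :
  (forall z, (0 <= g z)%E) -> measurable_fun setT g ->
  measurable_fun setT (fun t : lebesgue_line R =>
    \int[family_pos mf t]_(x in K) g (x, t))%E.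
Proof.
move=> g0 mg.
have h := @measurable_fun_integral_kernel _ _ (lebesgue_line R) (borel ER) R
  (family_slice_measure mf cK) (fun A mA => family_pos_measurable mA) g g0 mg.
apply: eq_measurable_fun h => t _; exact: integral_family_slice.
Qed.

(** With [P] a Hahn set of m_t(dx)dt, the time integral of m_t^+ over the slices of [A] equals [mu]
    of the part of [A] inside [P] and the open slab, and this part competes in the supremum that
    defines the positive part of [mu]. *)
Lemma family_pos_le_integral (mu : set ER -> R)
    (hmu : locally_bounded_measure (slab T) mu) (g : borel ER -> \bar R) :
  (forall A : set (borel ER), measurable A -> A `<=` K `*` `]0, T[ ->
    mu A = kernel_integral T m K A) ->
  (forall z, (0 <= g z)%E) -> measurable_fun setT g ->
  (\int[leb R]_(t in `[0%R, T]) \int[family_pos mf t]_(x in K) g (x, t) <=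
   \int[lb_pos (@exhausts_slab R d T) hmu]_(z in K `*` `]0%R, T[) g z)%E.
Proof.
move=> Hmu g0 mg.
have mO : measurable (K `*` `]0, T[ : set (borel ER)).
  by apply: setX_borel => //; exact: measurable_itv.
rewrite -(ge0_integral_mrestr _ mO)//.
rewrite (eq_integral (fun t : lebesgue_line R => \int[family_slice_measure mf cK t]_z g z)%E); last first.
  by move=> t _; rewrite integral_family_slice.
apply: (kernel_le_integral mT _ _ g0 mg) => A mA.
  exact: family_pos_measurable.
have [P mP HP] := kernel_hahn mf cK.
have mB : measurable (A `&` P `&` (K `*` `]0, T[) : set (borel ER)).
  by apply: measurableI => //; exact: measurableI.
rewrite (@ae_eq_integral _ _ _ (leb R) (`[0, T] : set (lebesgue_line R))
  (fun t : lebesgue_line R => (m t (slice (A `&` P `&` (K `*` `]0, T[)) t `&` K))%:E) _ mT); last first.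
- apply: leb_aeS (leb_aeI HP leb_ae_interior) _ => t [Ht It] tT.
  have Pt := slice_borel t mP.
  have mAt : measurable (slice A t `&` K : set (borel E)).
    by apply: measurableI => //; exact: slice_borel.
  apply: etrans (pos_measureE (family_lb mf t) cK (@subsetT _ K) Pt (Ht tT) mAt
    (@subIsetr _ _ _)) _.
  congr (m t _)%:E; rewrite /slice; apply/seteqP; split => x /=.
    by move=> [[Ax Kx] Px]; split=> //; split => //; split => //=; exact: It.
  by move=> [[[Ax Px] [Kx _]] _].
- apply/measurable_EFinP.
  by apply: measurable_funS (family_slice_measurable mf cK mB).
- by apply: measurable_funS (family_pos_measurable mA).
have -> : (\int[leb R]_(t in `[0%R, T])
    (m t (slice (A `&` P `&` (K `*` `]0%R, T[)) t `&` K))%:E)%E =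
    (mu (A `&` P `&` (K `*` `]0, T[)))%:E.
  rewrite (Hmu _ mB (@subIsetr _ _ _)) /kernel_integral /Rintegral fineK//.
  exact: (integrable_fin_num mT (family_slice_integrable mf cK mB)).
apply: ereal_sup_ubound; exists (A `&` P `&` (K `*` `]0, T[)) => //.
split; last by move=> z [[? _] ?].
split; first exact: mB.
  apply: sub_bounded_set (compact_bounded (compact_setX cK (@segment_compact R 0 T))).
  by move=> z [_ [? /= h]]; split => //; move: h; rewrite /= !in_itv/= => /andP[/ltW-> /ltW->].
by move=> z [_ [_ /= h]]; split => //; move: h; rewrite /= !in_itv/= => /andP[/ltW-> /ltW->].
Qed.

End FamilyIntegral.

(** * Smooth bumps *)

Section DirectionalDerivative.
Context {R : realType} {V : normedModType R}.
Implicit Types (f g : V -> R) (x v : V).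

Lemma is_derive_line f x v (df : R) :
  is_derive (0 : R) 1 (fun h : R => f (h *: v + x)) df -> is_derive x v f df.
Proof.
move=> [dF dFE].
have e : (fun h : R => h^-1 *: ((f \o shift x) (h *: v) - f x)) =
  (fun h : R => h^-1 *: (((fun h : R => f (h *: v + x)) \o shift 0) (h *: (1 : R)) -
     f ((0 : R) *: v + x))).
  apply/funext => h; rewrite /= scale0r add0r addr0.
  by have -> : h *: (1 : R) = h by exact: mulr1.
split; first exact/derivable1P.
by rewrite /derive e.
Qed.

(** Many derivatives below are obtained from a quadratic bound on the remainder; this also covers
    the points where a function is pieced together, such as the origin for [flat] and the knots of
    the splines. *)
Lemma is_derive_sqr f x v (df L e : R) : 0 < e ->
  (forall h, `|h| < e -> `|f (h *: v + x) - f x - h * df| <= L * h ^+ 2) ->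
  is_derive x v f df.
Proof.
move=> e0 H.
suff c : h^-1 *: ((f \o shift x) (h *: v) - f x) @[h --> 0^'] --> df.
  by split; [apply/cvg_ex; exists df|apply/cvg_lim].
apply/cvgrPdist_le => eps eps0.
have L1 : 0 < `|L| + 1 by rewrite ltr_wpDl.
near=> h.
have h0 : h != 0 by near: h; exact: nbhs_dnbhs_neq.
have he : `|h| < e by near: h; apply: dnbhs0_lt.
have hL : `|h| < eps / (`|L| + 1).
  by near: h; apply: dnbhs0_lt; rewrite divr_gt0.
have hp : 0 < `|h| by rewrite normr_gt0.
have -> : df - h^-1 *: ((f \o shift x) (h *: v) - f x) =
    - (h^-1 * (f (h *: v + x) - f x - h * df)).
  by rewrite /= /GRing.scale/=; field.
rewrite normrN normrM normfV ler_pdivrMl//.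
apply: (le_trans (H h he)); apply: (@le_trans _ _ ((`|L| + 1) * `|h| ^+ 2)).
  rewrite real_normK ?num_real//; apply: ler_wpM2r; first exact: sqr_ge0.
  by apply: (le_trans (ler_norm _)); rewrite lerDl.
rewrite expr2 mulrA mulrC ler_wpM2l//.
by rewrite mulrC -ler_pdivlMr// ltW.
Unshelve. all: by end_near. Qed.

End DirectionalDerivative.

Section SmoothBump.
Context {R : realType}.

(* The functions [x^(-n) exp(-1/x)] on the half-line, extended by 0; their span
   is closed under differentiation. *)
Definition flat (n : nat) (x : R) : R :=
  if 0 < x then x ^- n * expR (- x^-1) else 0.

Lemma flat_le0 n x : x <= 0 -> flat n x = 0.
Proof. by rewrite /flat leNgt => /negbTE ->. Qed.

Lemma flat_ge0 n x : 0 <= flat n x.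
Proof.
rewrite /flat; case: ifP => // x0.
by rewrite mulr_ge0 ?expR_ge0// invr_ge0 exprn_ge0// ltW.
Qed.

Lemma flat0_le1 x : flat 0 x <= 1.
Proof.
rewrite /flat; case: ifP => // x0; rewrite expr0 invr1 mul1r expR_le1.
by rewrite oppr_le0 invr_ge0 ltW.
Qed.

(** The exponential series gives exp(y) >= y^(n+2) / (n+2)!; with y = 1/x this becomes the quadratic
    smallness that makes the derivative at the origin vanish. *)
Lemma flat_le_sqr n x : flat n x <= (n.+2)`!%:R * x ^+ 2.
Proof.
rewrite /flat; case: ifP => x0; last by rewrite mulr_ge0// sqr_ge0.
have xi0 : 0 <= x^-1 by rewrite invr_ge0 ltW.
have := expR_ge1Dxn n.+1 xi0.
rewrite expRN => h.
have f0 : 0 < (n.+2)`!%:R :> R by rewrite ltr0n fact_gt0.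
have {}h : x^-1 ^+ n.+2 / (n.+2)`!%:R <= expR x^-1.
  by apply: le_trans h; rewrite lerDr.
have p0 : 0 < x^-1 ^+ n.+2 / (n.+2)`!%:R.
  by rewrite divr_gt0// exprn_gt0// invr_gt0.
apply: (@le_trans _ _ (x ^- n * (x^-1 ^+ n.+2 / (n.+2)`!%:R)^-1)).
  apply: ler_wpM2l; first by rewrite invr_ge0 exprn_ge0// ltW.
  by rewrite lef_pV2 ?posrE ?expR_gt0.
rewrite exprVn invf_div invrK exprS exprS mulrA.
have xn : x ^+ n != 0 by rewrite expf_neq0 ?gt_eqF.
rewrite le_eqVlt; apply/orP; left; apply/eqP; field.
exact: xn.
Qed.

Lemma is_derive_flat n (x : R) :
  is_derive x 1 (flat n) (flat n.+2 x - n%:R * flat n.+1 x).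
Proof.
have [x0|x0|x0] := ltgtP x 0.
- rewrite !flat_le0 ?ltW// mulr0 subr0.
  apply: (near_eq_is_derive (f := cst 0)).
  by near=> y; rewrite flat_le0// ltW//; near: y; exact: lt_nbhsl.
- have xn : x != 0 by rewrite gt_eqF.
  pose F : R -> R := (fun y => y^-1 ^+ n) \* (fun y => expR (- y^-1)).
  apply: (near_eq_is_derive (f := F)).
    near=> y; have y0 : 0 < y by near: y; exact: lt_nbhsr.
    by rewrite /flat y0 /F/= exprVn.
  have dV : is_derive x 1 (fun y : R => y^-1) (- x ^- 2).
    have h := @is_deriveV R (fun y => y) x 1 1 xn (is_derive_id _ _).
    by apply: is_derive_eq h _; exact: mulr1.
  have dX : is_derive x 1 (fun y : R => y^-1 ^+ n) (n%:R * x^-1 ^+ n.-1 * - x ^- 2).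
    have -> : (fun y : R => y^-1 ^+ n) = (fun y : R => y^-1) ^+ n.
      by apply/funext => y; rewrite exprfctE.
    exact: (is_deriveX n dV).
  have dE : is_derive x 1 (fun y : R => expR (- y^-1)) (expR (- x^-1) * x ^- 2).
    have h := is_deriveN dV.
    rewrite opprK in h.
    exact: (@is_derive1_comp R expR (- (fun y : R => y^-1)) x _ _ (is_derive_expR _) h).
  apply: is_derive_eq (is_deriveM dX dE) _.
  rewrite /flat x0 /GRing.scale/= -!exprVn; case: n {F dX} => [|n] /=.
    by rewrite !expr0 expr1; ring.
  rewrite !exprS; ring.
- rewrite x0 !flat_le0// mulr0 subr0.
  apply: (@is_derive_sqr _ _ _ _ _ _ ((n.+2)`!%:R) 1) => // h _.
  have -> : h *: 1 + 0 = h :> R by rewrite addr0; exact: mulr1.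
  rewrite mulr0 [flat n 0]flat_le0// !subr0 ger0_norm ?flat_ge0//.
  exact: flat_le_sqr.
Unshelve. all: by end_near. Qed.

End SmoothBump.

Section SmoothAlgebra.
Context {R : realType} {V : normedModType R}.
Implicit Types (f g : V -> R) (x v : V).

(** A syntactic class closed under directional derivatives, so that smoothness follows by induction
    on the order without ever differentiating a product of bumps by hand. *)
Inductive flat_algebra : (V -> R) -> Prop :=
| FlatCst c : flat_algebra (cst c)
| FlatComp n (l : V -> R) c : (forall h v x, l (h *: v + x) = h * l v + l x) ->
    continuous l -> flat_algebra (fun x => flat n (l x + c))
| FlatAdd f g : flat_algebra f -> flat_algebra g -> flat_algebra (f \+ g)
| FlatMul f g : flat_algebra f -> flat_algebra g -> flat_algebra (f \* g).

Lemma flat_continuous n : continuous (@flat R n).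
Proof.
move=> x; apply: differentiable_continuous; apply/derivable1_diffP.
by have [] := is_derive_flat n x.
Qed.

Lemma flat_algebra_continuous f : flat_algebra f -> continuous f.
Proof.
elim=> [c|n l c _ cl|{}f g _ cf _ cg|{}f g _ cf _ cg] x.
- exact: cvg_cst.
- apply: (continuous_comp (f := fun x => l x + c) (g := flat n)).
    by apply: cvgD; [exact: cl|exact: cvg_cst].
  exact: flat_continuous.
- by apply: cvgD; [exact: cf|exact: cg].
- by apply: cvgM; [exact: cf|exact: cg].
Qed.

Lemma flat_algebra_derive f v : flat_algebra f ->
  (forall x, derivable f x v) /\ flat_algebra ('D_v f).
Proof.
suff : flat_algebra f -> exists2 df, flat_algebra df & forall x, is_derive x v f (df x).
  move=> H /H[df fdf dfE]; split; first by move=> x; case: (dfE x).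
  by have -> : 'D_v f = df by apply/funext => x; case: (dfE x).
elim=> [c|n l c lin cl|{}f g _ [df fdf dfE] _ [dg fdg dgE]|
    {}f g fA [df fdf dfE] gA [dg fdg dgE]].
- by exists (cst 0); [exact: FlatCst|move=> x; exact: is_derive_cst].
- exists (fun x => (flat n.+2 (l x + c) + (- n%:R) * flat n.+1 (l x + c)) * l v).
    apply: (FlatMul (f := fun x => flat n.+2 (l x + c) + (- n%:R) * flat n.+1 (l x + c))
      (g := cst (l v))); last exact: FlatCst.
    apply: (FlatAdd (f := fun x => flat n.+2 (l x + c))); first exact: FlatComp.
    apply: (FlatMul (f := cst (- n%:R))); first exact: FlatCst.
    exact: FlatComp.
  move=> x; apply: is_derive_line.
  have e : (fun h : R => flat n (l (h *: v + x) + c)) =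
      flat n \o (fun h : R => h * l v + (l x + c)).
    by apply/funext => h /=; rewrite lin addrA.
  have dl : is_derive (0 : R) 1 (fun h : R => h * l v + (l x + c)) (l v).
    apply: (@is_derive_sqr _ _ _ _ _ _ 0 1) => // h _.
    have -> : h *: 1 + 0 = h :> R by rewrite addr0; exact: mulr1.
    by rewrite (_ : _ - _ - _ = 0) ?normr0 ?mul0r//; ring.
  rewrite e mulNr; apply: (is_derive1_comp _ dl).
  by rewrite mul0r add0r; exact: is_derive_flat.
- exists (df \+ dg); first exact: FlatAdd.
  by move=> x; exact: is_deriveD.
- exists ((f \* dg) \+ (g \* df)).
    by apply: FlatAdd; apply: FlatMul.
  by move=> x; apply: is_derive_eq (is_deriveM (dfE x) (dgE x)) _.
Qed.

Lemma flat_algebra_Coo f : flat_algebra f -> class_Coo setT f.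
Proof.
move=> fA n; elim: n f fA => [|n IH] f fA; split => //;
  try by move=> x _; exact: flat_algebra_continuous.
move=> v; have [df dA] := flat_algebra_derive v fA.
by split => //; exact: IH.
Qed.

Lemma flat_algebra_prod (I : finType) (f : I -> V -> R) :
  (forall i, flat_algebra (f i)) -> flat_algebra (fun x => \prod_i f i x).
Proof.
move=> fA; suff H (s : seq I) : flat_algebra (fun x => \prod_(i <- s) f i x) by exact: H.
elim: s => [|i s IH].
  by under eq_fun do rewrite big_nil; exact: FlatCst.
by under eq_fun do rewrite big_cons; exact: (FlatMul (f := f i)).
Qed.

End SmoothAlgebra.

Section SpaceTimeBump.
Context {R : realType} {d : nat}.
Local Notation E := 'rV[R]_d.
Local Notation ER := (E * R)%type.
Variables (a b : E) (s t : R).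

(* Smooth bumps increasing to the indicator of an open box, with supports
   staying away from the faces of the box. *)
Definition itv_bump (k : nat) (p q y : R) : R :=
  flat 0 (k%:R * y + (- (k%:R * p) - 1)) * flat 0 (- k%:R * y + (k%:R * q - 1)).

Definition sbox_bump (k : nat) (z : ER) : R :=
  (\prod_i itv_bump k (a 0 i) (b 0 i) (z.1 0 i)) * itv_bump k s t z.2.

Lemma itv_bump_ge0 k p q y : 0 <= itv_bump k p q y.
Proof. by rewrite mulr_ge0 ?flat_ge0. Qed.

Lemma itv_bump_le1 k p q y : itv_bump k p q y <= 1.
Proof. by rewrite mulr_ile1 ?flat_ge0 ?flat0_le1. Qed.

Lemma sbox_bump_ge0 k z : 0 <= sbox_bump k z.
Proof. by rewrite mulr_ge0 ?itv_bump_ge0 ?prodr_ge0// => i _; exact: itv_bump_ge0. Qed.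

Lemma sbox_bump_le1 k z : sbox_bump k z <= 1.
Proof.
rewrite mulr_ile1 ?itv_bump_ge0 ?itv_bump_le1//.
  by apply: prodr_ge0 => i _; exact: itv_bump_ge0.
by apply: prodr_ile1 => i _; rewrite itv_bump_ge0 itv_bump_le1.
Qed.

Lemma itv_bump_neq0 k p q y : itv_bump k p q y != 0 ->
  (0 < k)%N /\ p + k%:R^-1 <= y <= q - k%:R^-1.
Proof.
rewrite mulf_eq0 negb_or => /andP[h1 h2].
have {}h1 : 0 < k%:R * y + (- (k%:R * p) - 1).
  by rewrite ltNge; apply: contra h1 => ?; rewrite flat_le0.
have {}h2 : 0 < - k%:R * y + (k%:R * q - 1).
  by rewrite ltNge; apply: contra h2 => ?; rewrite flat_le0.
(* For k = 0 both arguments of [flat] equal -1 and the bump vanishes identically. *)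
case: k h1 h2 => [|k] h1 h2; first by exfalso; move: h1; rewrite !mul0r; lra.
split => //; have k0 : 0 < k.+1%:R :> R by rewrite ltr0n.
have e : k.+1%:R * k.+1%:R^-1 = 1 :> R by rewrite divff// gt_eqF.
by apply/andP; split; rewrite -(ler_pM2l k0) ?mulrDr ?mulrN e; lra.
Qed.

(** Inside the interval both arguments grow linearly in [k], and [flat 0] tends to exp(0) = 1 at
    infinity; outside, one of the arguments is at most -1 for every [k]. *)
Lemma itv_bump_cvg p q y :
  itv_bump k p q y @[k --> \oo] --> (if p < y < q then 1 else 0 : R).
Proof.
case: ifPn => [/andP[py yq]|].
  have flat_cvg (c : R) : 0 < c -> flat 0 (k%:R * c - 1) @[k --> \oo] --> (1 : R).
    move=> c0; have lin : k%:R * c - 1 @[k --> \oo] --> +oo.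
      apply/cvgryPge => A; near=> k.
      rewrite lerBrDr -ler_pdivrMr//; near: k; exact: nbhs_infty_ger.
    have inv : (k%:R * c - 1)^-1 @[k --> \oo] --> (0 : R).
      by apply/gtr0_cvgV0; last exact: lin; move/cvgryPgt : lin; exact.
    have : expR (- (k%:R * c - 1)^-1) @[k --> \oo] --> (1 : R).
      have h : - (k%:R * c - 1)^-1 @[k --> \oo] --> (0 : R).
        by rewrite -[X in _ --> X]oppr0; exact: cvgN.
      rewrite -[X in _ --> X]expR0.
      exact: (cvg_comp _ _ h (@continuous_expR R 0)).
    apply: cvg_trans; apply: near_eq_cvg; near=> k.
    have k0 : 0 < k%:R * c - 1 by near: k; move/cvgryPgt : lin; exact.
    by rewrite /flat k0 expr0 invr1 mul1r.
  rewrite -[X in _ --> X](mulr1 1); apply: cvgM.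
    have := flat_cvg (y - p); rewrite subr_gt0 => /(_ py).
    by under eq_fun do rewrite mulrBr -addrA.
  have := flat_cvg (q - y); rewrite subr_gt0 => /(_ yq).
  by apply: cvg_trans; apply: near_eq_cvg; apply: nearW => k; congr flat; ring.
move=> npq; apply: cvg_near_cst; apply: nearW => k; apply/eqP.
rewrite mulf_eq0; move: npq; rewrite negb_and -!leNgt => /orP[h|h].
  rewrite [flat 0 _]flat_le0 ?eqxx//.
  have : k%:R * (y - p) <= 0 by rewrite mulr_ge0_le0// subr_le0.
  lra.
rewrite [X in _ || (X == _)]flat_le0 ?eqxx ?orbT//.
have : k%:R * (q - y) <= 0 by rewrite mulr_ge0_le0// subr_le0.
lra.
Unshelve. all: by end_near. Qed.

Lemma sbox_bump_cvg z :
  sbox_bump k z @[k --> \oo] --> (\1_(sbox a b s t) z : R).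
Proof.
have -> : \1_(sbox a b s t) z =
    (\prod_i (if a 0 i < z.1 0 i < b 0 i then 1 else 0)) *
    (if s < z.2 < t then 1 else 0) :> R.
  rewrite indicE; case: (boolP (z \in sbox a b s t)) => [/set_mem[h1 h2]|zs].
    by rewrite h2 mulr1 big1// => i _; rewrite h1.
  apply/esym/eqP; rewrite mulf_eq0; apply/orP.
  have [h2|h2] := boolP (s < z.2 < t); last by right.
  left; apply/prodf_eq0.
  have [i hi] : exists i, ~~ (a 0 i < z.1 0 i < b 0 i).
    apply/existsP; rewrite -[X in is_true X]negbK negb_exists; apply/negP => /forallP h.
    move/negP: zs; apply; rewrite inE; split => // i.
    by have := h i; rewrite negbK.
  by exists i => //; rewrite (negbTE hi).
apply: cvgM; last exact: itv_bump_cvg.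
have H (r : seq 'I_d) : \prod_(i <- r) itv_bump k (a 0 i) (b 0 i) (z.1 0 i)
    @[k --> \oo] --> \prod_(i <- r) (if a 0 i < z.1 0 i < b 0 i then 1 else 0 : R).
  elim: r => [|i r IH].
    by rewrite big_nil; under eq_fun do rewrite big_nil; exact: cvg_cst.
  rewrite big_cons; under eq_fun do rewrite big_cons.
  by apply: cvgM => //; exact: itv_bump_cvg.
exact: H.
Qed.

Lemma sbox_bump_flat k : flat_algebra (sbox_bump k).
Proof.
have itv (l : ER -> R) p q : (forall h v x, l (h *: v + x) = h * l v + l x) ->
    continuous l -> flat_algebra (fun z => itv_bump k p q (l z)).
  move=> lin cl; apply: (FlatMul (f := fun z => flat 0 (k%:R * l z + _))).
    apply: (@FlatComp _ _ 0 (fun z => k%:R * l z)).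
      by move=> h v x; rewrite lin; ring.
    by move=> z; apply: cvgM; [exact: cvg_cst|exact: cl].
  apply: (@FlatComp _ _ 0 (fun z => - k%:R * l z)).
    by move=> h v x; rewrite lin; ring.
  by move=> z; apply: cvgM; [exact: cvg_cst|exact: cl].
apply: (@FlatMul _ _ (fun z : ER => \prod_i itv_bump k (a 0 i) (b 0 i) (z.1 0 i))
  (fun z : ER => itv_bump k s t z.2)).
  apply: flat_algebra_prod => i; apply: (itv (fun z => z.1 0 i)).
    by move=> h v x; rewrite /= !mxE.
  move=> z; apply: (continuous_coord (f := fst)); exact: cvg_fst.
apply: (itv snd) => // z; exact: cvg_snd.
Qed.

Lemma sbox_bump_support k z : sbox_bump k z != 0 ->
  sbox a b s t z /\ s + k%:R^-1 <= z.2 <= t - k%:R^-1.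
Proof.
rewrite mulf_eq0 negb_or => /andP[h1 /itv_bump_neq0[k0 h2]].
have ki : 0 < k%:R^-1 :> R by rewrite invr_gt0 ltr0n.
split => //; split.
  move=> i; have hi : itv_bump k (a 0 i) (b 0 i) (z.1 0 i) != 0.
    by apply: contra h1 => h1; apply/prodf_eq0; exists i.
  by have [_ /andP[? ?]] := itv_bump_neq0 hi; apply/andP; split; lra.
by move/andP: h2 => [? ?]; apply/andP; split; lra.
Qed.

End SpaceTimeBump.

Section BumpSupport.
Context {R : realType} {d : nat}.
Local Notation E := 'rV[R]_d.

Lemma box_bounded (a b : E) : exists n : nat, box a b `<=` cball n%:R.
Proof.
apply: bounded_sub_cball.
exists (enorm a + enorm b); split; first exact: num_real.
move=> M hM x bx; apply: (@le_trans _ _ (enorm a + enorm b)); last exact: ltW.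
have -> : `|x| = mx_norm x by [].
rewrite mx_normrE; apply/bigmax_leP; split => [|[i j] _ /=].
  by rewrite addr_ge0 ?enorm_ge0.
have /andP[? ?] := bx j; rewrite ord1.
have ha := coord_le_enorm a j; have hb := coord_le_enorm b j.
have ea := enorm_ge0 a; have eb := enorm_ge0 b.
move: ha hb; rewrite !ler_norml => /andP[? ?] /andP[? ?].
by apply/andP; split; lra.
Qed.

(** The gap 1/k left at the two time faces keeps the closed support inside the open slab even for s
    = 0 and t = T. *)
Lemma sbox_bump_test (T : R) (a b : E) (s t : R) k : 0 <= s -> t <= T ->
  let u := sbox_bump a b s t k in
  [/\ class_Coo setT u, compact (closure [set z | u z != 0]) &
    closure [set z | u z != 0] `<=` open_slab T].
Proof.
move=> s0 tT u; have [n Hn] := box_bounded a b.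
have sub : closure [set z | u z != 0] `<=`
    cball n%:R `*` `[s + k%:R^-1, t - k%:R^-1].
  have cl : closed (cball n%:R `*` `[s + k%:R^-1, t - k%:R^-1] : set (E * R)).
    apply: compact_closed; first exact: norm_hausdorff.
    by apply: compact_setX; [exact: compact_cball|exact: segment_compact].
  rewrite ((closure_id _).1 cl).
  apply: closureS => z /= /sbox_bump_support[[bz _] h].
  by split; [exact: Hn|rewrite /= in_itv].
split; first exact/flat_algebra_Coo/sbox_bump_flat.
- apply: subclosed_compact sub; first exact: closed_closure.
  by apply: compact_setX; [exact: compact_cball|exact: segment_compact].
- case: (posnP k) => [k0|k0].
    have -> : [set z | u z != 0] = set0.
      rewrite -subset0 => z /=.
      by rewrite mulf_eq0 negb_or => /andP[_ /itv_bump_neq0[]]; rewrite k0.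
    by rewrite closure0.
  move=> z /sub[_]; rewrite /= in_itv/= => /andP[? ?]; split => //=.
  have ki : 0 < k%:R^-1 :> R by rewrite invr_gt0 ltr0n.
  by rewrite in_itv/=; apply/andP; split; lra.
Qed.

End BumpSupport.

Section BoundedIntegrable.
Context {R : realType} {X : normedModType R}.
Variables (D : set X) (Kn : nat -> set X) (exD : exhausts D Kn).
Variables (m : set X -> R) (hm : locally_bounded_measure D m).

Lemma lb_abs_bounded_integrable (K : set X) (f : borel X -> R) (c : R) :
  compact K -> K `<=` D -> measurable_fun (K : set (borel X)) f ->
  (forall x, K x -> `|f x| <= c) -> (lb_abs exD hm).-integrable K (EFin \o f).
Proof.
move=> cK KD mf fc; have mK := compact_borel cK.
apply: (measurable_bounded_integrable mK) => //.
  exact: (lb_abs_lty exD hm cK KD mK (@subset_refl _ _)).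
exists c; split; first exact: num_real.
by move=> y cy x Kx; exact: le_trans (fc _ Kx) (ltW cy).
Qed.

End BoundedIntegrable.

(** * Measures given by families *)

Section SignedFamily.
Context {R : realType} {d : nat}.
Local Notation E := 'rV[R]_d.
Local Notation ER := (E * R)%type.
Variables (T : R) (m : R -> set E -> R) (mf : regular_family T m).
Variables (K : set E) (cK : compact K).

Let mK : measurable (K : set (borel E)). Proof. exact: compact_borel. Qed.

Let pair_meas t : measurable_fun setT (pair^~ t : borel E -> borel ER).
Proof.
apply: continuous_borel => x.
by apply: (@cvg_pair _ _ _ (nbhs x) (nbhs x) (nbhs t) _ _ _ id (cst t));
  [exact: cvg_id|exact: cvg_cst].
Qed.

Lemma section_borel d' (Z : measurableType d') (g : borel ER -> Z) t :
  measurable_fun setT g ->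
  measurable_fun setT (fun x : borel E => g (x, t)).
Proof. by move=> mg; exact: measurableT_comp mg (pair_meas t). Qed.

Lemma family_pos_Rintegral_measurable (g : borel ER -> R) :
  measurable_fun setT g ->
  measurable_fun setT (fun t : lebesgue_line R =>
    \int[family_pos mf t]_(x in K) g (x, t))%R.
Proof.
move=> mg.
have mgE : measurable_fun setT (EFin \o g) by exact/measurable_EFinP.
have hp := family_pos_integral_measurable mf cK
  (fun z => funepos_ge0 (EFin \o g) z) (measurable_funepos mgE).
have hn := family_pos_integral_measurable mf cK
  (fun z => funeneg_ge0 (EFin \o g) z) (measurable_funeneg mgE).
apply: eq_measurable_fun
  (measurableT_comp (fine_measurable measurableT) (emeasurable_funB hp hn)) => t _.
have h := congr1 fine (integralE (family_pos mf t) K (fun x => (g (x, t))%:E)).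
apply: etrans _ (esym h); congr (fine (_ - _)%E); apply: eq_integral => x _.
  by rewrite !funeposE.
by rewrite !funenegE.
Qed.

End SignedFamily.

Section SignedFamilyIntegral.
Context {R : realType} {d : nat}.
Local Notation E := 'rV[R]_d.
Local Notation ER := (E * R)%type.
Variables (T : R) (m : R -> set E -> R) (mf : regular_family T m).
Variables (K : set E) (cK : compact K).

Let mK : measurable (K : set (borel E)). Proof. exact: compact_borel. Qed.

Lemma lb_abs_integral_measurable (g : borel ER -> \bar R) :
  (forall z, (0 <= g z)%E) -> measurable_fun setT g ->
  measurable_fun setT (fun t : lebesgue_line R =>
    \int[abs_measure setT (m t)]_(x in K) g (x, t))%E.
Proof.
move=> g0 mg.
have hp := family_pos_integral_measurable mf cK g0 mg.
have hn := family_pos_integral_measurable (regular_familyN mf) cK g0 mg.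
apply: eq_measurable_fun (emeasurable_funD hp hn) => t _.
apply: etrans _ (esym (@integral_lb_abs _ _ _ _ (@exhausts_space R d) _ (family_lb mf t) K
  (fun x => g (x, t)) mK _ _)) => //.
by apply: measurable_funS (section_borel t mg).
Qed.

Lemma family_signed_measurable (g : borel ER -> R) : measurable_fun setT g ->
  (forall x t, ~ K x -> g (x, t) = 0) ->
  measurable_fun setT (fun t : lebesgue_line R =>
    signed_integral setT (m t) (fun x => g (x, t))).
Proof.
move=> mg g0.
have hp := family_pos_Rintegral_measurable mf cK mg.
have hn : measurable_fun setT (fun t : lebesgue_line R =>
    \int[lb_neg (@exhausts_space R d) (family_lb mf t)]_(x in K) g (x, t))%R.
  exact: (family_pos_Rintegral_measurable (regular_familyN mf) cK mg).
apply: eq_measurable_fun (measurable_funB hp hn) => t _.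
rewrite (signed_integralE (@exhausts_space R d) (family_lb mf t) mK (@subsetT _ K))//.
by move=> x _ nK; exact: g0.
Qed.

End SignedFamilyIntegral.

Section ZeroExtension.
Context {R : realType} {d : nat}.
Local Notation E := 'rV[R]_d.
Local Notation ER := (E * R)%type.

(** Nothing is known about m_t for t outside [0, T]; the value 0 there turns the family into a
    regular one. *)
Definition zero_extension (T : R) (m : R -> set E -> R) t : set E -> R :=
  if t \in `[0, T] then m t else cst 0.

Lemma zero_extensionE T m t : t \in `[0, T] -> zero_extension T m t = m t.
Proof. by rewrite /zero_extension => ->. Qed.

(** The dominating function is the total variation on [K]. It is finite at every time of [0, T], so
    that passing to its real value loses nothing. *)
Lemma given_by_regular (T : R) (mu : set ER -> R) (mut : R -> set E -> R) :
  given_by T mu mut -> regular_family T (zero_extension T mut).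
Proof.
move=> [_ lb ms igr _].
have mT : measurable (`[0, T] : set (lebesgue_line R)) := leb_measurable_itv _.
split.
- move=> t; have [tT|tT] := boolP (t \in `[0, T]).
    by rewrite zero_extensionE//; exact: lb.
  rewrite /zero_extension (negbTE tT) => K cK KT F mF tF.
  by under eq_fun do rewrite big1//; exact: cvg_cst.
- move=> B mB bB; have h := ms B (And3 mB bB (@subsetT _ B)).
  have -> : (fun t : lebesgue_line R => zero_extension T mut t B) =
      (fun t => mut t B) \_ `[0, T].
    apply/funext => t; rewrite /patch /zero_extension mem_setE.
    by case: ifPn.
  by apply/(measurable_restrictT _ mT).
- by move=> t B /negbTE tT; rewrite /zero_extension tT.
- move=> K cK; have iK := igr K cK.
  exists (fun t => fine (abs_measure setT (mut t) K)).
    apply: eq_integrable iK => //; move=> t /set_mem tT /=.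
    rewrite fineK// ge0_fin_numE.
      exact: (@lb_abs_lty _ _ _ _ (@exhausts_space R d) _ (lb t tT) K K cK (@subsetT _ K)
        (compact_borel cK) (@subset_refl _ K)).
    exact: (measure_ge0 (lb_abs (@exhausts_space R d) (lb t tT))).
  move=> t B tT mB BK; rewrite zero_extensionE//.
  have absK0 := measure_ge0 (lb_abs (@exhausts_space R d) (lb t tT)) (K : set (borel E)).
  have pos0 := measure_ge0 (lb_pos (@exhausts_space R d) (lb t tT)) (K : set (borel E)).
  have neg0 := measure_ge0 (lb_neg (@exhausts_space R d) (lb t tT)) (K : set (borel E)).
  have fin := @lb_abs_lty _ _ _ _ (@exhausts_space R d) _ (lb t tT) K K cK (@subsetT _ K)
        (compact_borel cK) (@subset_refl _ K).
  have bB : bounded_borel setT B.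
    by split => //; apply: sub_bounded_set BK _; exact: compact_bounded.
  rewrite -lee_fin fineK ?ge0_fin_numE//.
  have hp : ((mut t B)%:E <= pos_measure setT (mut t) K)%E.
    by apply: ereal_sup_ubound; exists B.
  have hn : ((- mut t B)%:E <= neg_measure setT (mut t) K)%E.
    by apply: ereal_sup_ubound; exists B.
  have [m0|m0] := leP 0 (mut t B).
    by rewrite ger0_norm//; apply: le_trans hp _; exact: leeDl.
  by rewrite ltr0_norm//; apply: le_trans hn _; exact: leeDr.
Qed.

End ZeroExtension.

(** * Identification of the space-time measure on the open slab *)

Section GivenByKernel.
Context {R : realType} {d : nat}.
Local Notation E := 'rV[R]_d.
Local Notation ER := (E * R)%type.
Variables (T : R) (T_gt0 : 0 < T) (mu : set ER -> R) (mut : R -> set E -> R).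
Hypothesis gb : given_by T mu mut.
Let m := zero_extension T mut.
Let mf : regular_family T m := given_by_regular gb.
Let hmu := given_by_measure gb.
Let mT : measurable (`[0, T] : set (lebesgue_line R)) := leb_measurable_itv _.

Let sliceS (A : set ER) (B : set E) : A `<=` B `*` setT ->
  forall t, slice A t `<=` B.
Proof. by move=> AB t x /AB[]. Qed.

(** Both sides are limits of the identity for test functions along bumps converging to the indicator
    of the box; dominated convergence is used for [mu], for each m_t, and finally in time. *)
Let kernel_sbox (n : nat) a b s t : 0 <= s -> t <= T -> box a b `<=` cball n%:R ->
  mu (sbox a b s t) = kernel_integral T m (cball n%:R) (sbox a b s t).
Proof.
move=> s0 tT bn.
set S := sbox a b s t.
have SO : S `<=` cball n%:R `*` `[0, T].
  move=> z [bz /andP[sz zt]]; split; first exact: bn.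
  by rewrite /= in_itv/= (ltW (le_lt_trans s0 sz)) (ltW (lt_le_trans zt tT)).
have cn : compact (cball n%:R : set E) := @compact_cball R d n%:R.
have cO : compact (cball n%:R `*` `[0, T] : set ER).
  by apply: compact_setX => //; exact: segment_compact.
have OT : (cball n%:R : set E) `*` `[0, T] `<=` slab T by move=> z [_ h]; split.
have mS : measurable (S : set (borel ER)).
  by apply: open_borel; exact: open_sbox.
have mO := compact_borel cO.
have mn := compact_borel cn.
pose u k : ER -> R := sbox_bump a b s t k.
have uc k : continuous (u k).
  by apply: flat_algebra_continuous; exact: sbox_bump_flat.
have mu_ k : measurable_fun setT (u k : borel ER -> R) by exact: continuous_borel_real.
have u1 k z : `|u k z| <= 1 by rewrite ger0_norm ?sbox_bump_le1 ?sbox_bump_ge0.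
have uS k z : ~ S z -> u k z = 0.
  by move=> nS; apply/eqP/negPn/negP => /sbox_bump_support[].
have limL : signed_integral (slab T) mu (u k) @[k --> \oo] --> mu S.
  rewrite -(signed_integral_indic (@exhausts_slab R d T) hmu cO OT mS SO).
  apply: (@signed_integral_cvg _ _ _ _ (@exhausts_slab R d T) _ hmu
    (cball n%:R `*` `[0, T]) u (\1_S) (cst 1) mO OT).
  - by move=> k z _ nz; apply: uS => /SO.
  - by move=> z _ nz; rewrite indicE memNset// => /SO.
  - by move=> k; exact: measurable_funS (mu_ k).
  - exact: measurable_indic.
  - by move=> z _; exact: sbox_bump_cvg.
  - by move=> k z _; exact: u1.
  - apply: (lb_abs_bounded_integrable _ _ (c := 1)) => //; by move=> z _; rewrite normr1.
have limt r : signed_integral setT (m r) (fun x => u k (x, r)) @[k --> \oo] -->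
    m r (slice S r `&` cball n%:R).
  rewrite -(signed_integral_indic (@exhausts_space R d) (family_lb mf r) cn (@subsetT _ _)
    (measurableI _ _ (slice_borel r mS) mn) (@subIsetr _ _ _)).
  apply: (@signed_integral_cvg _ _ _ _ (@exhausts_space R d) _ (family_lb mf r)
    (cball n%:R) (fun k x => u k (x, r)) (\1_(slice S r `&` cball n%:R)) (cst 1) mn
    (@subsetT _ _)).
  - by move=> k x _ nz; apply: uS => /SO[].
  - by move=> x _ nz; rewrite indicE memNset// => -[].
  - by move=> k; apply: measurable_funS (section_borel r (mu_ k)).
  - by apply: measurable_indic; apply: measurableI => //; exact: slice_borel.
  - move=> x cx; have := @sbox_bump_cvg R d a b s t (x, r).
    have -> // : \1_(sbox a b s t) (x, r) = \1_(slice S r `&` cball n%:R) x :> R.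
    rewrite !indicE; congr (_%:R); congr (nat_of_bool _).
    by apply/idP/idP; rewrite !inE => // -[].
  - by move=> k x _; exact: u1.
  - apply: (lb_abs_bounded_integrable _ _ (c := 1)) => //; by move=> z _; rewrite normr1.
have [g ig gB] := family_dominated mf cn.
have limR : (\int[leb R]_(r in `[0, T]) signed_integral setT (m r) (fun x => u k (x, r)))
    @[k --> \oo] --> kernel_integral T m (cball n%:R) S.
  (* The factor 2: with a Hahn set P, the total variation of m_r on the ball is the value inside P
     minus the value outside P, and [g] bounds each of them. *)
  apply: (Rintegral_dominated_cvg (g := fun r => 2 * g r) mT).
  - move=> k; apply: measurable_funS (family_signed_measurable mf cn (mu_ k) _) => //.
    by move=> x r nx; apply: uS => /SO[].
  - by apply: measurable_funS (family_slice_measurable mf cn mS).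
  - by move=> r _; exact: limt.
  - move=> k r rT.
    have i1 : (lb_abs (@exhausts_space R d) (family_lb mf r)).-integrable (cball n%:R)
        (EFin \o (fun x => u k (x, r))).
      apply: (lb_abs_bounded_integrable _ _ (c := 1)) => //.
      by apply: measurable_funS (section_borel r (mu_ k)).
    have u0 (x : E) : setT x -> ~ cball n%:R x -> u k (x, r) = 0.
      by move=> _ nx; apply: uS => /SO[].
    have h := signed_integral_abs mn (@subsetT _ _) u0 i1.
    rewrite -lee_fin; apply: (le_trans h).
    apply: (@le_trans _ _ (lb_abs (@exhausts_space R d) (family_lb mf r) (cball n%:R))).
      apply: (@le_trans _ _ (\int[lb_abs (@exhausts_space R d) (family_lb mf r)]_(x in cball n%:R) 1)%E).
        apply: ge0_le_integral => //.
        - apply/measurable_EFinP/measurableT_comp => //.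
          by apply: measurable_funS (section_borel r (mu_ k)).
        - by move=> x _; rewrite lee_fin.
      by rewrite integral_cst ?mul1e.
    have [P mP hP] := exists_hahn_on (family_lb mf r) cn (@subsetT _ _).
    have hp := pos_measureE (family_lb mf r) cn (@subsetT _ _) mP hP mn (@subset_refl _ _).
    have hn := neg_measureE (family_lb mf r) cn (@subsetT _ _) mP hP mn (@subset_refl _ _).
    rewrite /lb_abs /abs_measure hp hn lee_fin mulr2n mulrDl mul1r lerD//.
      by apply: le_trans (ler_norm _) _; apply: gB => //; exact: measurableI.
    by apply: le_trans (ler_norm _) _; rewrite normrN; apply: gB => //; exact: measurableD.
  - exact: (integrableZl mT 2 ig).
have eqk k : signed_integral (slab T) mu (u k) =
    \int[leb R]_(r in `[0, T]) signed_integral setT (m r) (fun x => u k (x, r)).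
  have [h1 h2 h3] := sbox_bump_test a b k s0 tT.
  rewrite (given_by_test gb h1 h2 h3); apply: eq_Rintegral => r /set_mem rT.
  by rewrite /m zero_extensionE.
apply: cvg_unique limL _; first exact: norm_hausdorff.
by move: limR; under eq_fun do rewrite -eqk.
Qed.

(** Test functions supported in the open slab do not see the slices t = 0 and t = T, hence the open
    time interval. All sets are cut by one open box [Om] containing K x ]0, T[, on whose subsets
    both sides are finite and additive, so that Dynkin's lemma applies. *)
Lemma given_by_kernel (K : set E) (A : set (borel ER)) : compact K ->
  measurable A -> A `<=` K `*` `]0, T[ -> mu A = kernel_integral T m K A.
Proof.
move=> cK mA AK.
have [n0 Kn0] := bounded_sub_cball (compact_bounded cK).
pose r : R := n0%:R + 1; pose bx : set E := box (const_mx (- r)) (const_mx r).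
have Kbx : K `<=` bx.
  move=> x /Kn0 Kx i; rewrite !mxE -ltr_norml /r.
  by apply: le_lt_trans (coord_le_enorm x i) _; rewrite (le_lt_trans Kx)// ltrDl.
have [n bn] : exists n : nat, bx `<=` cball n%:R := box_bounded _ _.
pose Om : set ER := sbox (const_mx (- r)) (const_mx r) 0 T.
have mOm : measurable (Om : set (borel ER)) by apply: open_borel; exact: open_sbox.
have cn : compact (cball n%:R : set E) := @compact_cball R d n%:R.
have cO : compact (cball n%:R `*` `[0, T] : set ER).
  by apply: compact_setX => //; exact: segment_compact.
have OT : (cball n%:R : set E) `*` `[0, T] `<=` slab T by move=> z [_ h]; split.
have OmO : Om `<=` cball n%:R `*` `[0, T].
  move=> z [bz /andP[sz zt]]; split; first exact: bn.
  by rewrite /= in_itv/= (ltW sz) (ltW zt).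
pose nu := kernel_charge mf cn.
suff H : forall B, measurable (B : set (borel ER)) ->
    (mu (B `&` Om))%:E = nu (B `&` Om).
  have AOm : A `<=` Om.
    by move=> z /AK[/Kbx bz]; rewrite /= in_itv/= => zt; split.
  have := H A mA; rewrite (setIidl AOm) => -[->].
  rewrite /kernel_integral; apply: eq_Rintegral => t _; congr (m t _).
  have AtK : slice A t `<=` K by apply: sliceS => z /AK[].
  by rewrite !setIidl// => x /AtK /Kbx /bn.
apply: sbox_induction.
- by rewrite setTI /Om (kernel_sbox (n := n)).
- move=> a b s t; rewrite sbox_setI (kernel_sbox (n := n))//.
  + by rewrite le_max lexx orbT.
  + by rewrite ge_min lexx orbT.
  + move=> x bx'; apply: bn => i; have := bx' i; rewrite !mxE gt_max lt_min.
    by move=> /andP[/andP[_ ->] /andP[_ ->]].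
- move=> S mS IH.
  have mI : measurable (S `&` Om : set (borel ER)) by exact: measurableI.
  have e : ~` S `&` Om = Om `\` (S `&` Om).
    by apply/seteqP; split => z /=; [move=> [h1 h2]; split=> // -[]|move=> [h1 h2]; split=> // h3; apply: h2].
  have h2 : nu (Om `\` (S `&` Om)) = (nu Om - nu (Om `&` (S `&` Om)))%E.
    exact: (@chargeD _ _ _ nu _ _ mOm mI).
  have i1 : Om `&` (S `&` Om) = S `&` Om by apply/setIidPr; exact: subIsetr.
  have h3 : (mu Om)%:E = nu Om by congr (_%:E); exact: kernel_sbox.
  rewrite i1 -IH -h3 in h2.
  by rewrite e h2 (lb_setD hmu cO OT mOm mI (@subIsetr _ _ _) OmO) EFinB.
- move=> F mF tF IH; rewrite setI_bigcupl.
  have mI k : measurable (F k `&` Om : set (borel ER)) by exact: measurableI.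
  have tI : trivIset setT (fun k => F k `&` Om).
    apply/trivIsetP => i j _ _ ij; rewrite setIACA setIid.
    by move/trivIsetP: tF => ->//; rewrite set0I.
  have h1 := hmu cO OT (fun k => conj (mI k) (subset_trans (@subIsetr _ _ _) OmO)) tI.
  have h2 : (\sum_(0 <= i < n) nu (F i `&` Om))%E @[n --> \oo] -->
      nu (\bigcup_i (F i `&` Om)).
    by apply: charge_semi_sigma_additive => //; exact: bigcupT_measurable.
  have h3 : (\sum_(0 <= i < n) mu (F i `&` Om))%:E @[n --> \oo] -->
      (mu (\bigcup_i (F i `&` Om)))%:E by apply: cvg_EFin h1; exact: nearW.
  have e k : (\sum_(0 <= i < k) nu (F i `&` Om))%E = (\sum_(0 <= i < k) mu (F i `&` Om))%:E.
    by rewrite -sumEFin; apply: eq_bigr => i _; rewrite -IH.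
  by move: h2; under eq_fun do rewrite e; move=> h2; exact: (cvg_unique _ h3 h2).
Qed.

End GivenByKernel.

Section GivenByIntegrable.
Context {R : realType} {d : nat}.
Local Notation E := 'rV[R]_d.
Local Notation ER := (E * R)%type.
Variables (T : R) (mu : set ER -> R) (mut : R -> set E -> R).
Hypothesis gb : given_by T mu mut.
Local Notation m := (zero_extension T mut).
Let mf : regular_family T m := given_by_regular gb.
Let hmu := given_by_measure gb.
Let mT : measurable (`[0, T] : set (lebesgue_line R)) := leb_measurable_itv _.
Variables (K : set E) (cK : compact K).
Let mK : measurable (K : set (borel E)). Proof. exact: compact_borel. Qed.

Variables (h : borel ER -> R).
Hypothesis mh : measurable_fun setT h.
Hypothesis ih : (abs_measure (slab T) mu).-integrable (K `*` `[0, T] : set (borel ER)) (EFin \o h).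

Let mO : measurable (K `*` `]0, T[ : set (borel ER)).
Proof. by apply: setX_borel => //; exact: measurable_itv. Qed.
Let mC : measurable (K `*` `[0, T] : set (borel ER)).
Proof. by apply: setX_borel => //; exact: measurable_itv. Qed.
Let OC : K `*` `]0, T[ `<=` K `*` `[0, T].
Proof. by move=> z [? /=]; rewrite !in_itv/= => /andP[/ltW-> /ltW->]. Qed.

Let mnh : measurable_fun setT (fun z : borel ER => `|h z|%:E).
Proof. by apply/measurable_EFinP/measurableT_comp. Qed.

(** The total variation of m_t is m_t^+ plus the positive part of -m_t; each is dominated by the
    corresponding part of [mu], against which [h] is integrable. *)
Lemma given_by_abs_integrable : (leb R).-integrable `[0, T]
  (fun t => \int[abs_measure setT (m t)]_(x in K) `|h (x, t)|%:E)%E.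
Proof.
have h0 z : (0 <= `|h z|%:E)%E by rewrite lee_fin.
have [ip iq] := integrable_lb_abs (exD := @exhausts_slab R d T) (hm := hmu) mC ih.
have mI : measurable_fun setT (fun t : lebesgue_line R =>
    \int[abs_measure setT (m t)]_(x in K) `|h (x, t)|%:E)%E.
  exact: (lb_abs_integral_measurable mf cK (g := fun z => `|h z|%:E)).
apply/integrableP; split; first by apply: measurable_funS mI.
rewrite (eq_integral (fun t : lebesgue_line R =>
    \int[family_pos mf t]_(x in K) `|h (x, t)|%:E +
    \int[family_pos (regular_familyN mf) t]_(x in K) `|h (x, t)|%:E)%E); last first.
  move=> t _; rewrite gee0_abs; last first.
    by apply: (@integral_ge0 _ _ _ (lb_abs (@exhausts_space R d) (family_lb mf t))) => x _; exact: h0.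
  apply: (@integral_lb_abs _ _ _ _ (@exhausts_space R d) _ (family_lb mf t) K
    (fun x => `|h (x, t)|%:E) mK).
    by apply: measurable_funS (section_borel t mnh).
  by move=> x _; exact: h0.
have m1 := family_pos_integral_measurable mf cK h0 mnh.
have m2 := family_pos_integral_measurable (regular_familyN mf) cK h0 mnh.
rewrite (ge0_integralD _ mT).
- have hN (A : set (borel ER)) : measurable A -> A `<=` K `*` `]0, T[ ->
      - mu A = kernel_integral T (fun t B => - m t B) K A.
    by move=> mA AK; rewrite (kernel_integralN mf)// -(given_by_kernel gb).
  apply: lte_add_pinfty.
    apply: le_lt_trans (family_pos_le_integral mf cK hmu (fun A => given_by_kernel gb cK)
      h0 mnh) _.
    have /integrableP[_] := ip; apply: le_lt_trans; apply: ge0_subset_integral => //.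
    by apply: measurable_funS mnh.
  apply: le_lt_trans (family_pos_le_integral (regular_familyN mf) cK (lbN hmu) hN
      h0 mnh) _.
  have /integrableP[_] := iq; apply: le_lt_trans.
  apply: (@ge0_subset_integral _ _ _ (lb_neg (@exhausts_slab R d T) hmu)) => //.
  by apply: measurable_funS mnh.
- by move=> t _; apply: integral_ge0 => x _; exact: h0.
- by apply: measurable_funS m1.
- by move=> t _; apply: integral_ge0 => x _; exact: h0.
- by apply: measurable_funS m2.
Qed.

Lemma given_by_ae_integrable : {ae leb R, forall t, t \in `[0, T] ->
  (lb_abs (@exhausts_space R d) (family_lb mf t)).-integrable K
     (EFin \o (fun x => h (x, t)))}.
Proof.
have H := integrable_ae mT given_by_abs_integrable.
apply: leb_aeS H _ => t H tT; apply/integrableP; split.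
  by apply/measurable_EFinP; apply: measurable_funS (section_borel t mh).
have := H tT; rewrite ge0_fin_numE//.
by apply: (@integral_ge0 _ _ _ (lb_abs (@exhausts_space R d) (family_lb mf t))) => x _; rewrite lee_fin.
Qed.

Lemma given_by_signed_integrable : (forall x t, ~ K x -> h (x, t) = 0) ->
  (leb R).-integrable `[0, T]
    (fun t => (signed_integral setT (m t) (fun x => h (x, t)))%:E).
Proof.
move=> h0.
pose G (t : lebesgue_line R) := (\int[abs_measure setT (m t)]_(x in K) `|h (x, t)|%:E)%E.
have mS := family_signed_measurable mf cK mh h0.
apply/integrableP; split; first by apply/measurable_EFinP; apply: measurable_funS mS.
have /integrableP[mG] := given_by_abs_integrable; apply: le_lt_trans.
apply: (ae_ge0_le_integral mT).
- by move=> t _; exact: abse_ge0.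
- apply: measurableT_comp (@abse_measurable R setT) _.
  by apply/measurable_EFinP; apply: measurable_funS mS.
- by move=> t _; exact: abse_ge0.
- exact: measurableT_comp (@abse_measurable R setT) mG.
apply: leb_aeS given_by_ae_integrable _ => t H tT.
apply: le_trans (signed_integral_abs mK (@subsetT _ K) _ (H tT)) _.
  by move=> x _; exact: h0.
by rewrite lee_abs.
Qed.

End GivenByIntegrable.

(** * Functions with Lipschitz gradient *)

Section MeanValue.
Context {R : realType} {V : normedModType R}.
Implicit Types (U : set V) (F : V -> R) (x v w : V).

Lemma is_derive_along F x v (s : R) : derivable F (s *: v + x) v ->
  is_derive s 1 (fun c : R => F (c *: v + x)) ('D_v F (s *: v + x)).
Proof.
move=> dF; apply: is_derive_line; apply: (DeriveDef (df := _)).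
  have /derivable1P := dF.
  rewrite (_ : (fun h : R => F (h *: v + (s *: v + x))) =
    (fun h : R => F ((h *: (1 : R) + s) *: v + x)))//.
  by apply/funext => h; rewrite [h *: 1]mulr1 scalerDl addrA.
have e : (fun h : R => h^-1 *: (((fun h : R => F ((h *: (1 : R) + s) *: v + x)) \o shift 0)
    (h *: (1 : R)) - F (((0 : R) *: (1 : R) + s) *: v + x))) =
  (fun h : R => h^-1 *: ((F \o shift (s *: v + x)) (h *: v) - F (s *: v + x))).
  apply/funext => h; rewrite /= scale0r add0r addr0.
  by rewrite ![_ *: (1 : R)]mulr1 scalerDl !addrA.
by rewrite /derive e.
Qed.

Lemma mean_value U F x v : class_C 1 U F ->
  (forall c, 0 <= c <= 1 -> U (c *: v + x)) ->
  exists2 c : R, 0 <= c <= 1 & F (v + x) - F x = 'D_v F (c *: v + x).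
Proof.
move=> [cF /= dF] Ux.
have [||c] := @MVT_segment R (fun c : R => F (c *: v + x))
  (fun c => 'D_v F (c *: v + x)) 0 1 (@ler01 R).
- move=> c; rewrite in_itv/= => /andP[c0 c1].
  apply: is_derive_along; apply: (dF v).1; apply: Ux.
  by rewrite !ltW.
- apply: continuous_in_subspaceT => c; rewrite inE/= in_itv/= => c01.
  apply: (@continuous_comp _ _ _ (fun c : R => c *: v + x) F).
    by apply: cvgD; [apply: cvgZr_tmp; exact: cvg_id|exact: cvg_cst].
  by apply: cF; exact: Ux.
- rewrite in_itv/= => c01; rewrite scale1r scale0r add0r subr0 mulr1 => e.
  by exists c.
Qed.

Lemma derive_scale F x v (a : R) : derivable F x v ->
  is_derive x (a *: v) F (a * 'D_v F x).
Proof.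
move=> dF; apply: is_derive_line; rewrite mulrC.
have h := @is_derive_along F x v 0; rewrite scale0r add0r in h.
have e : (fun h : R => F (h *: (a *: v) + x)) =
  (fun c : R => F (c *: v + x)) \o (fun h : R => h * a).
  by apply/funext => c /=; rewrite scalerA.
rewrite e; apply: is_derive1_comp; first by rewrite mul0r; exact: h.
apply: (is_derive_sqr (L := 0) ltr01) => c _.
by rewrite mul0r addr0 [c *: 1]mulr1 mul0r subr0 subrr normr0.
Qed.

(** [class_C] speaks of directional derivatives only, so linearity in the direction has to be
    recovered. The increment along h (v + w) is split at x + h v; by the mean value theorem the
    second half is a derivative in direction w at a nearby point, and it converges by continuity. *)
Lemma derive_add U F x v w : open U -> class_C 1 U F -> U x ->
  is_derive x (v + w) F ('D_v F x + 'D_w F x).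
Proof.
move=> oU CF Ux; have [cF /= dF] := CF.
suff c : h^-1 *: ((F \o shift x) (h *: (v + w)) - F x) @[h --> 0^'] -->
    ('D_v F x + 'D_w F x).
  by split; [apply/cvg_ex; exists ('D_v F x + 'D_w F x)|apply/cvg_lim].
have e (h : R) : h^-1 *: ((F \o shift x) (h *: (v + w)) - F x) =
  h^-1 *: ((F \o shift x) (h *: v) - F x) +
  h^-1 *: (F (h *: w + (h *: v + x)) - F (h *: v + x)).
  rewrite /= [h *: (v + w)]scalerDr.
  have -> : h *: w + (h *: v + x) = h *: v + h *: w + x by rewrite addrA [h *: w + _]addrC.
  rewrite /GRing.scale/=; ring.
under eq_fun do rewrite e.
apply: cvgD; first by have [] := dF v; move=> /(_ x Ux).
apply/cvgrPdist_le => eps eps0.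
have [_ [cw _]] := dF w.
have /cvgrPdist_le /(_ eps eps0) nw := cw x Ux.
have nU : \forall y \near x, U y by apply: open_nbhs_nbhs.
have [r r0 Hr] : exists2 r : R, 0 < r & forall y, `|x - y| < r -> U y /\
    `|'D_w F x - 'D_w F y| <= eps.
  have /nbhs_ballP[r /= r0 Hr] : \forall y \near x, U y /\ `|'D_w F x - 'D_w F y| <= eps.
    by near=> y; split; near: y.
  by exists r => // y xy; apply: Hr; rewrite -ball_normE.
near=> h.
have h0 : h != 0 by near: h; exact: nbhs_dnbhs_neq.
have M0 : 0 < `|v| + `|w| + 1 by rewrite ltr_wpDl ?addr_ge0.
have hr : `|h| < r / (`|v| + `|w| + 1).
  by near: h; apply: dnbhs0_lt; rewrite divr_gt0.
have near_x c : 0 <= c <= 1 -> `|x - (c *: (h *: w) + (h *: v + x))| < r.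
  move=> /andP[c0 c1].
  have -> : x - (c *: (h *: w) + (h *: v + x)) = - (c *: (h *: w) + h *: v).
    by rewrite addrA opprD addrA addrAC subrr add0r.
  rewrite normrN; apply: (@le_lt_trans _ _ (`|h| * (`|v| + `|w| + 1))); last first.
    by rewrite -ltr_pdivlMr.
  apply: (le_trans (ler_normD _ _)); rewrite !normrZ (ger0_norm c0) !mulrDr mulr1.
  have hw : c * (`|h| * `|w|) <= `|h| * `|w| by rewrite ler_piMl// mulr_ge0.
  have := normr_ge0 h; lra.
have [c c01 ->] := @mean_value U F (h *: v + x) (h *: w) CF
  (fun c c01 => (Hr _ (near_x c c01)).1).
have [Uc nc] := Hr _ (near_x c c01).
have [_ ->] := @derive_scale F (c *: (h *: w) + (h *: v + x)) w h ((dF w).1 _ Uc).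
by rewrite /GRing.scale/= mulKf.
Unshelve. all: by end_near. Qed.

Lemma derive_lincomb U F x (I : eqType) (s : seq I) (a : I -> R) (e : I -> V) :
  open U -> class_C 1 U F -> U x ->
  'D_(\sum_(i <- s) a i *: e i) F x = \sum_(i <- s) a i * 'D_(e i) F x.
Proof.
move=> oU CF Ux; have [cF /= dF] := CF.
elim: s => [|i s IH].
  by rewrite !big_nil derive0.
rewrite !big_cons -IH.
have [_ ->] := derive_add (a i *: e i) (\sum_(j <- s) a j *: e j) oU CF Ux.
by have [_ ->] := derive_scale (a i) ((dF (e i)).1 x Ux).
Qed.

End MeanValue.

Section ClassC.
Context {R : realType} {V W : normedModType R}.
Implicit Types (U : set V) (f g : V -> W).

Let nearU U f g x : open U -> (forall x, U x -> f x = g x) -> U x ->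
  \forall y \near x, f y = g y.
Proof.
move=> oU fg Ux; have : \forall y \near x, U y by exact: open_nbhs_nbhs.
by apply: filterS => y; exact: fg.
Qed.

Lemma class_C_eq n U f g : open U -> (forall x, U x -> f x = g x) ->
  class_C n U f -> class_C n U g.
Proof.
move=> oU; have cont f1 g1 : (forall x, U x -> f1 x = g1 x) ->
    (forall x, U x -> {for x, continuous f1}) -> forall x, U x -> {for x, continuous g1}.
  move=> fg cf x Ux; rewrite /prop_for /continuous_at -fg//.
  apply: cvg_trans (cf x Ux); apply: near_eq_cvg.
  exact: (nearU oU fg Ux).
elim: n f g => [|n IH] f g fg [cf df]; split => //; try exact: cont fg cf.
move=> v; have [d1 d2] := df v; split.
  by move=> x Ux; apply: (near_eq_derivable (nearU oU fg Ux)); exact: d1.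
by apply: IH d2 => x Ux; apply: near_eq_derive; exact: (nearU oU fg Ux).
Qed.

End ClassC.

Section CompactBounds.
Context {R : realType} {V : normedModType R}.
Implicit Types (K : set V).

Lemma compact_norm_bound (f : V -> R) K : compact K ->
  (forall x, K x -> {for x, continuous f}) ->
  exists2 M : R, 0 <= M & forall x, K x -> `|f x| <= M.
Proof.
move=> cK cf.
have /compact_bounded[M [_ HM]] : compact (f @` K).
  apply: continuous_compact => //; apply: continuous_in_subspaceT => x.
  by rewrite inE => /cf.
exists (`|M| + 1); first by rewrite addr_ge0.
move=> x Kx; apply: (HM (`|M| + 1)); last by exists x.
by rewrite (le_lt_trans (ler_norm M))// ltrDl.
Qed.

(** Used for the gradient of V, which is merely continuous, so that compactness has to replace a
    Lipschitz constant. *)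
Lemma heine_cantor (W : normedModType R) (f : V -> W) K : compact K ->
  (forall x, K x -> {for x, continuous f}) -> forall e, 0 < e ->
  exists2 r : R, 0 < r & forall x y, K x -> K y -> `|y - x| <= r -> `|f y - f x| <= e.
Proof.
move=> /compact_near_coveringP cK cf e e0.
have H := cK R (nbhs (0 : R)^'+) (fun r x => forall y, K y -> `|y - x| <= r ->
  `|f y - f x| <= e) _ _.
have [r] : exists r : R, 0 < r /\ K `<=` (fun x => forall y, K y -> `|y - x| <= r ->
    `|f y - f x| <= e).
  near (0 : R)^'+ => r; exists r; split; first by near: r; exact: nbhs_right_gt.
  near: r; apply: H => x Kx.
  have e20 : 0 < e / 2 by rewrite divr_gt0.
  have /cvgrPdist_le /(_ _ e20) /nbhs_ballP[s /= s0 Hs] := cf x Kx.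
  have Hs' y : `|x - y| < s -> `|f x - f y| <= e / 2.
    by move=> h; apply: Hs; rewrite -ball_normE.
  exists (ball x (s / 2), [set r | r < s / 2]) => /=.
    split; first by apply: nbhsx_ballx; rewrite divr_gt0.
    by apply: nbhs_right_lt; rewrite divr_gt0.
  move=> [z r] /= [xz rs] y Ky yz.
  have xz' : `|x - z| < s / 2 by move: xz; rewrite -ball_normE.
  have -> : f y - f z = (f x - f z) - (f x - f y) by rewrite opprB [RHS]addrC subrKA.
  rewrite (le_trans (ler_normB _ _))// [leRHS]splitr lerD//.
    by apply: Hs'; apply: lt_le_trans xz' _; rewrite ler_pdivrMr// ler_pMr// ler1n.
  apply: Hs'; have -> : x - y = (x - z) - (y - z) by rewrite opprB addrA subrK.
  rewrite (le_lt_trans (ler_normB _ _))// [ltRHS]splitr ltrD//.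
  exact: le_lt_trans yz rs.
by move=> [r0 Hr]; exists r => // x y Kx Ky; exact: Hr.
Unshelve. all: by end_near. Qed.

End CompactBounds.

Lemma lip_continuous {R : realType} {V W : normedModType R} (f : V -> W) (M : R) x :
  (forall y, `|f y - f x| <= M * `|y - x|) -> {for x, continuous f}.
Proof.
move=> lip; apply/cvgrPdist_le => e e0; near=> y.
have M0 : 0 < `|M| + 1 by rewrite ltr_wpDl.
have xy : `|y - x| < e / (`|M| + 1).
  near: y; have /cvgrPdist_lt h : @id V y @[y --> x] --> x by exact: cvg_id.
  have := h (e / (`|M| + 1)); rewrite divr_gt0// => /(_ isT).
  by apply: filterS => y; rewrite distrC.
rewrite distrC; apply: (le_trans (lip _)); apply: (@le_trans _ _ ((`|M| + 1) * `|y - x|)).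
  by rewrite ler_wpM2r// (le_trans (ler_norm _))// lerDl.
by rewrite mulrC -ler_pdivlMr// ltW.
Unshelve. all: by end_near. Qed.

Section C11.
Context {R : realType} {d : nat}.
Local Notation E := 'rV[R]_d.
Implicit Types (K : set E) (f : E -> R) (g : E -> E).

(* g is the gradient of f; the bound on the Taylor remainder makes sense on any
   set and, unlike class_C, is easily propagated through compositions. *)
Record C11 K (G L : R) f g : Prop := C11Intro {
  C11_grad : forall x, K x -> enorm (g x) <= G ;
  C11_taylor : forall x y, K x -> K y ->
    `|f y - f x - dotp (g x) (y - x)| <= L * enorm (y - x) ^+ 2 ;
  C11_lip : forall x y, K x -> K y -> enorm (g y - g x) <= L * enorm (y - x) }.

Lemma C11_is_derive G L f g x v : C11 setT G L f g ->
  is_derive x v f (dotp (g x) v).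
Proof.
move=> [_ tay _]; apply: (is_derive_sqr (L := L * enorm v ^+ 2) ltr01) => h _.
have := tay x (h *: v + x) I I; rewrite addrK dotpZr enormZ exprMn real_normK ?num_real//.
by rewrite mulrA mulrAC.
Qed.

Lemma C11_increment K G L f g x y : C11 K G L f g -> K x -> K y ->
  `|f y - f x| <= G * enorm (y - x) + L * enorm (y - x) ^+ 2.
Proof.
move=> [gb tay _] Kx Ky; have -> : f y - f x = dotp (g x) (y - x) +
    (f y - f x - dotp (g x) (y - x)) by ring.
apply: (le_trans (ler_normD _ _)); apply: lerD; last exact: tay.
by apply: (le_trans (normr_dotp _ _)); rewrite ler_wpM2r ?enorm_ge0// gb.
Qed.

Lemma enorm_lip_continuous f (M : R) : 0 <= M ->
  (forall x y, `|f y - f x| <= M * enorm (y - x)) -> continuous f.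
Proof.
move=> M0 lip x; apply: (lip_continuous (M := M * d%:R)) => y.
by apply: (le_trans (lip _ _)); rewrite -mulrA ler_wpM2l// enorm_le_normr.
Qed.

End C11.

Section SmoothFields.
Context {R : realType} {d : nat}.
Local Notation E := 'rV[R]_d.
Local Notation ER := (E * R)%type.

Let e (i : 'I_d) : ER := (unit_row i, 0).

Let space_dir (v : E) : ((v, 0) : ER) = \sum_i v 0 i *: e i.
Proof.
have H (s : seq 'I_d) : ((\sum_(i <- s) v 0 i *: unit_row i, 0) : ER) =
    \sum_(i <- s) v 0 i *: e i.
  elim: s => [|i s IH]; first by rewrite !big_nil.
  rewrite !big_cons -IH; congr pair.
  by rewrite /= scaler0 addr0.
by rewrite -H -row_unit_sum.
Qed.

Variables (U : set E) (oU : open U) (T r : R).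
Hypothesis KU : cball r `<=` U.
Let W : set ER := U `*` setT.
Let oW : open W.
Proof.
rewrite (_ : W = fst @^-1` U); first by apply: open_comp => // z _; exact: cvg_fst.
by apply/seteqP; split => z /=; [case|].
Qed.
Let C : set ER := cball r `*` `[0, T].
Let cC : compact C.
Proof. by apply: compact_setX; [exact: compact_cball|exact: segment_compact]. Qed.
Let CW : C `<=` W. Proof. by move=> z [/KU]. Qed.

Let seg (x y : E) (t c : R) : cball r x -> cball r y -> t \in `[0, T] ->
  0 <= c <= 1 -> C (c *: (y - x, 0) + (x, t)).
Proof.
move=> xr yr tT c01; split => /=; last by rewrite scaler0 add0r.
by rewrite /cball/= addrC; apply: enorm_convex.
Qed.

Let slope_lip (F : ER -> R) : class_C 1 W F -> exists2 M, 0 <= M &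
  forall x y t, cball r x -> cball r y -> t \in `[0, T] ->
  `|F (y, t) - F (x, t)| <= M * enorm (y - x).
Proof.
move=> CF; have [cF /= dF] := CF.
have Hb i : exists M : R, 0 <= M /\ forall z, C z -> `|'D_(e i) F z| <= M.
  have [M M0 HM] := @compact_norm_bound _ _ ('D_(e i) F) C cC
    (fun z Cz => ((dF (e i)).2.1 z (CW Cz))).
  by exists M.
pose M i := projT1 (cid (Hb i)).
have M0 i : 0 <= M i by have [] := projT2 (cid (Hb i)).
have HM i z : C z -> `|'D_(e i) F z| <= M i by have [_] := projT2 (cid (Hb i)); apply.
exists (\sum_i M i); first by rewrite sumr_ge0.
move=> x y t xr yr tT.
have Wc c : 0 <= c <= 1 -> W (c *: ((y - x, 0) : ER) + (x, t)).
  by move=> c01; apply: CW; exact: seg.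
have [c c01] := mean_value CF Wc.
have -> : (y - x, 0) + (x, t) = (y, t) :> ER by congr pair; rewrite /= ?subrK ?add0r.
have := seg xr yr tT c01; set z := c *: _ + _ => Cz ->.
rewrite space_dir (derive_lincomb _ _ _ oW CF); last exact: CW.
rewrite mulr_suml; apply: (le_trans (ler_norm_sum _ _ _)).
apply: ler_sum => i _; rewrite normrM mulrC; apply: ler_pM => //.
  exact: HM.
exact: coord_le_enorm.
Qed.

(** All constants are maxima over the compact set [cball r] x [0, T], so they do not depend on t.
    The mean value theorem turns the Lipschitz bounds of the first partial derivatives into the
    quadratic bound on the Taylor remainder. *)
Lemma smooth_field_C11 (F : ER -> R) : class_Coo W F -> exists2 M, 0 <= M &
  forall t, t \in `[0, T] -> [/\ C11 (cball r) M M (fun x => F (x, t)) (grad (fun x => F (x, t))),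
     forall x, cball r x -> `|F (x, t)| <= M &
     forall x s, cball r x -> s \in `[0, T] -> `|F (x, s) - F (x, t)| <= M * `|s - t|].
Proof.
move=> CF; have CF1 := CF 1%N; have CF2 := CF 2%N.
have D1 v : class_C 1 W ('D_v F) := (CF2.2 v).2.
have gradE x t : cball r x -> t \in `[0, T] ->
    forall v, dotp (grad (fun x => F (x, t)) x) v = 'D_(v, 0) F (x, t).
  move=> xr tT v; rewrite space_dir (derive_lincomb _ _ _ oW CF1); last exact: CW.
  rewrite /dotp; apply: eq_bigr => i _; rewrite mxE mulrC; congr (_ * _).
  rewrite /derive; congr (lim _).
  rewrite (_ : (fun h => h^-1 *: (((fun x0 => F (x0, t)) \o shift x) (h *: unit_row i) - F (x, t))) =
    (fun h => h^-1 *: ((F \o shift (x, t)) (h *: e i) - F (x, t))))//.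
  apply/funext => h /=; congr (_ *: (F _ - _)).
  by congr pair; rewrite /= scaler0 add0r.
have [M0 M00 HM0] := @compact_norm_bound _ _ F C cC (fun z Cz => CF1.1 z (CW Cz)).
have [Mt Mt0 HMt] := @compact_norm_bound _ _ ('D_(0, 1) F) C cC
  (fun z Cz => (CF1.2 (0, 1)).2.1 z (CW Cz)).
have Hl i : exists M : R, 0 <= M /\ forall x y t, cball r x -> cball r y -> t \in `[0, T] ->
    `|'D_(e i) F (y, t) - 'D_(e i) F (x, t)| <= M * enorm (y - x).
  by have [M ? ?] := slope_lip (D1 (e i)); exists M.
pose M i := projT1 (cid (Hl i)).
have Mi0 i : 0 <= M i by have [] := projT2 (cid (Hl i)).
have HM i := (projT2 (cid (Hl i))).2.
have Hb i : exists M : R, 0 <= M /\ forall z, C z -> `|'D_(e i) F z| <= M.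
  have [B B0 HB] := @compact_norm_bound _ _ ('D_(e i) F) C cC
    (fun z Cz => ((CF1.2 (e i)).2.1 z (CW Cz))).
  by exists B.
pose B i := projT1 (cid (Hb i)).
have B0 i : 0 <= B i by have [] := projT2 (cid (Hb i)).
have HB i := (projT2 (cid (Hb i))).2.
have SM : 0 <= \sum_i M i by rewrite sumr_ge0.
have SB : 0 <= \sum_i B i by rewrite sumr_ge0.
have coordE x t i : cball r x -> t \in `[0, T] ->
    grad (fun x => F (x, t)) x 0 i = 'D_(e i) F (x, t).
  by move=> xr tT; rewrite -dotp_unit gradE.
exists (M0 + Mt + \sum_i M i + \sum_i B i); first by rewrite !addr_ge0.
move=> t tT; split; [split|..].
- move=> x xr; apply: (le_trans (ler_enorm_sum _)).
  apply: (@le_trans _ _ (\sum_i B i)); last lra.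
  apply: ler_sum => i _; rewrite coordE//; exact: HB.
- move=> x y xr yr; rewrite gradE//.
  have Wc c : 0 <= c <= 1 -> W (c *: ((y - x, 0) : ER) + (x, t)).
    by move=> c01; apply: CW; exact: seg.
  have [c c01] := mean_value CF1 Wc.
  have -> : (y - x, 0) + (x, t) = (y, t) :> ER by congr pair; rewrite /= ?subrK ?add0r.
  have := seg xr yr tT c01; set z := c *: _ + _ => Cz ->.
  rewrite space_dir !(derive_lincomb _ _ _ oW CF1); [|exact: CW|exact: CW].
  rewrite -sumrB.
  apply: (@le_trans _ _ (\sum_i M i * enorm (y - x) ^+ 2)); last first.
    by rewrite -mulr_suml ler_wpM2r ?sqr_ge0//; lra.
  apply: (le_trans (ler_norm_sum _ _ _)); apply: ler_sum => i _.
  rewrite -mulrBr normrM expr2 mulrA mulrC; apply: ler_pM => //.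
    have -> : z = (c *: (y - x) + x, t) :> ER.
      by congr pair; rewrite /= scaler0 add0r.
    have h1 : cball r (c *: (y - x) + x) by have [] := Cz.
    apply: (le_trans (HM i _ _ _ xr h1 tT)); apply: ler_wpM2l; first exact: Mi0.
    rewrite addrK enormZ.
    by case/andP: c01 => c0 c1; rewrite ger0_norm// ler_piMl ?enorm_ge0.
  exact: coord_le_enorm.
- move=> x y xr yr; apply: (le_trans (ler_enorm_sum _)).
  apply: (@le_trans _ _ (\sum_i M i * enorm (y - x))); last first.
    by rewrite -mulr_suml ler_wpM2r ?enorm_ge0//; lra.
  by apply: ler_sum => i _; rewrite [X in `|X|]mxE [X in _ + X]mxE !coordE// HM.
- by move=> x xr; apply: (@le_trans _ _ M0); [exact: HM0|lra].
- move=> x s xr sT.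
  have Cc c : 0 <= c <= 1 -> C (c *: ((0, s - t) : ER) + (x, t)).
    move=> c01; split => /=; first by rewrite scaler0 add0r.
    move: tT sT; rewrite /= !in_itv/= => /andP[? ?] /andP[? ?]; case/andP: c01 => ? ?.
    rewrite /GRing.scale/=; apply/andP; split; nra.
  have [c c01] := mean_value CF1 (fun c c01 => CW (Cc c c01)).
  have -> : (0, s - t) + (x, t) = (x, s) :> ER by congr pair; rewrite /= ?subrK ?add0r.
  have := Cc c c01; set z := c *: _ + _ => Cz ->.
  have -> : (0, s - t) = (s - t) *: (0, 1) :> ER.
    by congr pair; rewrite /= ?scaler0// [_ *: _]mulr1.
  have [_ ->] := derive_scale (s - t) ((CF1.2 (0, 1)).1 _ (CW Cz)).
  rewrite normrM mulrC ler_wpM2r//; apply: (@le_trans _ _ Mt); last lra.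
  exact: HMt.
Qed.

End SmoothFields.

Section ClassCMore.
Context {R : realType} {V : normedModType R} {d : nat}.

Lemma class_C_sub (W : normedModType R) n (U U' : set V) (f : V -> W) :
  U' `<=` U -> class_C n U f -> class_C n U' f.
Proof.
move=> UU; elim: n f => [|n IH] f [cf df]; split=> //; try by move=> x /UU; exact: cf.
move=> v; have [d1 d2] := df v; split; last exact: IH.
by move=> x /UU; exact: d1.
Qed.

Lemma class_C_coord n (U : set V) (f : V -> 'rV[R]_d) i : open U ->
  class_C n U f -> class_C n U (fun z => f z 0 i).
Proof.
move=> oU; elim: n f => [|n IH] f [cf df]; split=> //;
  try by move=> x Ux; apply: continuous_coord; exact: cf.
move=> v; have [d1 d2] := df v; split.
  by move=> x Ux; have /derivable_mxP := d1 x Ux; apply.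
apply: class_C_eq (IH _ d2) => // x Ux.
by rewrite (derive_mx (d1 x Ux)) mxE.
Qed.

End ClassCMore.

Section C11Algebra.
Context {R : realType} {d : nat}.
Local Notation E := 'rV[R]_d.
Implicit Types (K : set E) (f : E -> R) (g : E -> E).

Lemma C11_weaken K G L G' L' f g : G <= G' -> L <= L' ->
  C11 K G L f g -> C11 K G' L' f g.
Proof.
move=> GG LL [h1 h2 h3]; split.
- by move=> x Kx; apply: le_trans GG; exact: h1.
- by move=> x y Kx Ky; apply: le_trans (h2 _ _ Kx Ky) _; rewrite ler_wpM2r ?sqr_ge0.
- by move=> x y Kx Ky; apply: le_trans (h3 _ _ Kx Ky) _; rewrite ler_wpM2r ?enorm_ge0.
Qed.

(** If one point lies in the ball of radius r and the other outside that of radius s, their distance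
    is at least s - r, so the plain bound G is at most G / (s - r) times the distance and G / (s -
    r)^2 times its square. All other pairs are covered by the hypothesis or have zero data at both
    points. *)
Lemma C11_extend (r s G L : R) f g : r < s -> 0 <= G -> 0 <= L ->
  C11 (cball s) G L f g ->
  (forall x, cball s x -> `|f x| <= G) -> (forall x, ~ cball r x -> f x = 0 /\ g x = 0) ->
  C11 setT G (L + G / (s - r) + G / (s - r) ^+ 2) f g.
Proof.
move=> rs G0 L0 [h1 h2 h3] fG out.
have p0 : 0 < s - r by rewrite subr_gt0.
have D0 : 0 <= G / (s - r) by rewrite divr_ge0// ltW.
have D20 : 0 <= G / (s - r) ^+ 2 by rewrite divr_ge0// sqr_ge0.
have far (x y : E) : cball r x -> ~ cball s y -> s - r <= enorm (y - x).
  rewrite /cball/= => xr /negP; rewrite -ltNge => ys.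
  by apply: le_trans (enorm_subl _ _); lra.
have D1 (x y : E) : s - r <= enorm (y - x) -> G <= G / (s - r) * enorm (y - x).
  by move=> h; rewrite mulrAC ler_pdivlMr// ler_wpM2l.
have D2 (x y : E) : s - r <= enorm (y - x) -> G <= G / (s - r) ^+ 2 * enorm (y - x) ^+ 2.
  move=> h; rewrite mulrAC ler_pdivlMr ?exprn_gt0// ler_wpM2l// lerXn2r// nnegrE ?ltW//.
  exact: lt_le_trans p0 h.
have outs (x : E) : ~ cball s x -> f x = 0 /\ g x = 0.
  move=> nx; apply: out => xr; apply: nx; rewrite /cball/=.
  by apply: le_trans xr _; exact: ltW.
split.
- move=> x _; have [xs|xs] := pselect (cball s x); first exact: h1.
  by have [_ ->] := outs _ xs; rewrite enorm0.
- move=> x y _ _; have e0 := enorm_ge0 (y - x); have e20 := sqr_ge0 (enorm (y - x)).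
  have [xs|xs] := pselect (cball s x); have [ys|ys] := pselect (cball s y).
  + apply: le_trans (h2 _ _ xs ys) _; rewrite ler_wpM2r//; lra.
  + have [-> _] := outs _ ys; have [xr|xr] := pselect (cball r x); last first.
      have [-> ->] := out _ xr; rewrite dotp0l !subr0 normr0 mulr_ge0//; lra.
    have hf := far _ _ xr ys; rewrite sub0r -opprD normrN.
    apply: (le_trans (ler_normD _ _)).
    have b1 := fG _ xs; have b2 := normr_dotp (g x) (y - x).
    have b3 : enorm (g x) * enorm (y - x) <= G * enorm (y - x) by rewrite ler_wpM2r// h1.
    have b4 := D2 _ _ hf.
    have b5 : G * enorm (y - x) <= G / (s - r) * enorm (y - x) ^+ 2.
      by rewrite expr2 mulrA ler_wpM2r// D1.
    have b6 : 0 <= L * enorm (y - x) ^+ 2 by rewrite mulr_ge0.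
    rewrite !mulrDl; lra.
  + have [-> ->] := outs _ xs; rewrite dotp0l !subr0; have [yr|yr] := pselect (cball r y); last first.
      have [-> _] := out _ yr; rewrite normr0 mulr_ge0//; lra.
    have hf : s - r <= enorm (y - x) by rewrite enormB; exact: far.
    have b4 := D2 _ _ hf; have b1 := fG _ ys.
    have b6 : 0 <= L * enorm (y - x) ^+ 2 by rewrite mulr_ge0.
    have b7 : 0 <= G / (s - r) * enorm (y - x) ^+ 2 by rewrite mulr_ge0.
    rewrite !mulrDl; lra.
  + have [-> ->] := outs _ xs; have [-> _] := outs _ ys.
    rewrite dotp0l !subr0 normr0 mulr_ge0//; lra.
- move=> x y _ _; have e0 := enorm_ge0 (y - x).
  have b6 : 0 <= L * enorm (y - x) by rewrite mulr_ge0.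
  have b8 : 0 <= G / (s - r) ^+ 2 * enorm (y - x) by rewrite mulr_ge0.
  have b7 : 0 <= G / (s - r) * enorm (y - x) by rewrite mulr_ge0.
  have [xs|xs] := pselect (cball s x); have [ys|ys] := pselect (cball s y).
  + apply: le_trans (h3 _ _ xs ys) _; rewrite ler_wpM2r//; lra.
  + have [_ ->] := outs _ ys; rewrite sub0r enormN; have [xr|xr] := pselect (cball r x); last first.
      have [_ ->] := out _ xr; rewrite enorm0 mulr_ge0//; lra.
    have := D1 _ _ (far _ _ xr ys); have := h1 _ xs; rewrite !mulrDl; lra.
  + have [_ ->] := outs _ xs; rewrite subr0; have [yr|yr] := pselect (cball r y); last first.
      have [_ ->] := out _ yr; rewrite enorm0 mulr_ge0//; lra.
    have hf : s - r <= enorm (y - x) by rewrite enormB; exact: far.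
    have := D1 _ _ hf; have := h1 _ ys; rewrite !mulrDl; lra.
  + have [_ ->] := outs _ xs; have [_ ->] := outs _ ys.
    rewrite subr0 enorm0 mulr_ge0//; lra.
Qed.

(** The Taylor bound gives a linear estimate up to distance 1; at larger distances the bound on [f]
    itself does. *)
Lemma C11_lipschitz G L M f g : 0 <= L -> C11 setT G L f g -> (forall x, `|f x| <= M) ->
  forall x y, `|f y - f x| <= (G + L + 2 * M) * enorm (y - x).
Proof.
move=> L0 h fM x y; have e0 := enorm_ge0 (y - x).
have M0 : 0 <= M by exact: le_trans (fM x).
have G0 : 0 <= G by apply: le_trans (enorm_ge0 _) (C11_grad h (x := x) I).
have [e1|e1] := leP (enorm (y - x)) 1.
  apply: (le_trans (C11_increment h _ _)) => //.
  have : L * enorm (y - x) ^+ 2 <= L * enorm (y - x) by rewrite ler_wpM2l// expr2 ler_piMl.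
  have : 0 <= M * enorm (y - x) by rewrite mulr_ge0.
  lra.
apply: (le_trans (ler_normB _ _)); have := fM x; have := fM y.
have : 0 <= (G + L) * enorm (y - x) by rewrite mulr_ge0// addr_ge0.
have : M <= M * enorm (y - x) by rewrite ler_peMr// ltW.
lra.
Qed.

(** The new constant depends only on [r] and [M]. The order of the quantifiers matters: the lemma is
    applied to a field at every time, with one constant for all of them. *)
Lemma C11_mul (r M : R) : 0 <= r -> 0 <= M -> exists2 M', 0 <= M' & forall f1 g1 f2 g2,
  C11 (cball r) M M f1 g1 -> C11 (cball r) M M f2 g2 ->
  (forall x, cball r x -> `|f1 x| <= M) -> (forall x, cball r x -> `|f2 x| <= M) ->
  (forall x, cball r x -> `|f1 x * f2 x| <= M') /\
  C11 (cball r) M' M' (fun x => f1 x * f2 x) (fun x => f1 x *: g2 x + f2 x *: g1 x).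
Proof.
move=> r0 M0; pose P := M + M * (2 * r).
have P0 : 0 <= P by rewrite addr_ge0// mulr_ge0// mulr_ge0.
have PM : 0 <= P * M by rewrite mulr_ge0.
have MM : 0 <= M * M by rewrite mulr_ge0.
exists (2 * (M * M) + 2 * (P * M)); first by rewrite addr_ge0// mulr_ge0.
move=> f1 g1 f2 g2 c1 c2 b1 b2.
have incr f g (x y : E) : C11 (cball r) M M f g -> cball r x -> cball r y ->
    `|f y - f x| <= P * enorm (y - x).
  move=> c xr yr; apply: (le_trans (C11_increment c xr yr)).
  rewrite mulrDl lerD2l expr2 mulrA ler_wpM2r ?enorm_ge0// ler_wpM2l//.
  by apply: (le_trans (enorm_sub _ _)); move: xr yr; rewrite /cball/=; lra.
split.
  move=> x xr; rewrite normrM; apply: (@le_trans _ _ (M * M)); last lra.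
  by apply: ler_pM => //; [exact: b1|exact: b2].
split.
- move=> x xr; apply: (le_trans (enormD _ _)); rewrite !enormZ.
  apply: (@le_trans _ _ (M * M + M * M)); last lra.
  by apply: lerD; apply: ler_pM; rewrite ?enorm_ge0//; [exact: b1|exact: C11_grad c2 _ _|exact: b2|exact: C11_grad c1 _ _].
- move=> x y xr yr; rewrite dotpDl !dotpZl.
  have -> : f1 y * f2 y - f1 x * f2 x - (f1 x * dotp (g2 x) (y - x) + f2 x * dotp (g1 x) (y - x)) =
    f1 y * (f2 y - f2 x - dotp (g2 x) (y - x)) + f2 x * (f1 y - f1 x - dotp (g1 x) (y - x)) +
    (f1 y - f1 x) * dotp (g2 x) (y - x) by ring.
  set e := enorm (y - x).
  have e0 : 0 <= e := enorm_ge0 _.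
  have t1 : `|f1 y * (f2 y - f2 x - dotp (g2 x) (y - x))| <= M * (M * e ^+ 2).
    by rewrite normrM; apply: ler_pM => //; [exact: b1|exact: C11_taylor c2 _ _ _ _].
  have t2 : `|f2 x * (f1 y - f1 x - dotp (g1 x) (y - x))| <= M * (M * e ^+ 2).
    by rewrite normrM; apply: ler_pM => //; [exact: b2|exact: C11_taylor c1 _ _ _ _].
  have t3 : `|(f1 y - f1 x) * dotp (g2 x) (y - x)| <= (P * e) * (M * e).
    rewrite normrM; apply: ler_pM => //; first exact: incr c1 _ _.
    apply: (le_trans (normr_dotp _ _)); rewrite ler_wpM2r//; exact: C11_grad c2 _ _.
  apply: (le_trans (ler_normD _ _)); apply: (@le_trans _ _ (M * (M * e ^+ 2) + M * (M * e ^+ 2) + (P * e) * (M * e))).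
    by apply: lerD => //; apply: (le_trans (ler_normD _ _)); apply: lerD.
  have : 0 <= (P * M) * e ^+ 2 by rewrite mulr_ge0// sqr_ge0.
  have : 0 <= (M * M) * e ^+ 2 by rewrite mulr_ge0// sqr_ge0.
  have -> : M * (M * e ^+ 2) + M * (M * e ^+ 2) + P * e * (M * e) =
    2 * ((M * M) * e ^+ 2) + (P * M) * e ^+ 2 by ring.
  rewrite mulrDl; lra.
- move=> x y xr yr; set e := enorm (y - x).
  have e0 : 0 <= e := enorm_ge0 _.
  have -> : f1 y *: g2 y + f2 y *: g1 y - (f1 x *: g2 x + f2 x *: g1 x) =
    (f1 y *: (g2 y - g2 x) + (f1 y - f1 x) *: g2 x) +
    (f2 y *: (g1 y - g1 x) + (f2 y - f2 x) *: g1 x).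
    by apply/rowP => i; rewrite !mxE; ring.
  have t f g f' g' : C11 (cball r) M M f g -> C11 (cball r) M M f' g' ->
      (forall x, cball r x -> `|f x| <= M) ->
      enorm (f y *: (g' y - g' x) + (f y - f x) *: g' x) <= (M * M) * e + (P * M) * e.
    move=> c c' bf; apply: (le_trans (enormD _ _)); rewrite !enormZ; apply: lerD.
      by rewrite -mulrA; apply: ler_pM; rewrite ?enorm_ge0//; [exact: bf|exact: C11_lip c' _ _ _ _].
    rewrite mulrAC; apply: ler_pM; rewrite ?enorm_ge0//; first exact: incr c _ _.
    exact: C11_grad c' _ _.
  apply: (le_trans (enormD _ _)).
  have := t _ _ _ _ c1 c2 b1; have := t _ _ _ _ c2 c1 b2; rewrite !mulrDl; lra.
Qed.

End C11Algebra.

(** * Quadratic splines and cut-offs *)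

Section QuadraticSpline.
Context {R : realType}.
Implicit Types y : R.

Definition ramp y : R := Num.max 0 y.
(** The tent on [0, 2] with value 1 at 1. Its primitive [spline] rises from 0 to 1 and is
    continuously differentiable, as a test function has to be in time; linear interpolation would
    not be. *)
Definition hat y : R := ramp y - 2 * ramp (y - 1) + ramp (y - 2).
Definition spline y : R :=
  ramp y ^+ 2 / 2 - ramp (y - 1) ^+ 2 + ramp (y - 2) ^+ 2 / 2.

Let ramp_cases y : y <= 0 /\ ramp y = 0 \/ 0 <= y /\ ramp y = y.
Proof.
by rewrite /ramp; case: (leP 0 y) => h; [right|left; rewrite ltW].
Qed.

Lemma spline_le0 y : y <= 0 -> spline y = 0 /\ hat y = 0.
Proof.
rewrite /spline /hat => y0.
have [[_ ->]|[h ->]] := ramp_cases y; have [[_ ->]|[h1 ->]] := ramp_cases (y - 1);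
  have [[_ ->]|[h2 ->]] := ramp_cases (y - 2); split; nra.
Qed.

Lemma spline_ge2 y : 2 <= y -> spline y = 1 /\ hat y = 0.
Proof.
rewrite /spline /hat => y0.
have [[? ->]|[h ->]] := ramp_cases y; have [[? ->]|[h1 ->]] := ramp_cases (y - 1);
  have [[? ->]|[h2 ->]] := ramp_cases (y - 2); split; nra.
Qed.

Lemma spline_01 y : 0 <= spline y <= 1.
Proof.
have [/spline_le0[-> _]|y0] := leP y 0; first by rewrite lexx ler01.
have [/spline_ge2[-> _]|y2] := leP 2 y; first by rewrite lexx ler01.
rewrite /spline; apply/andP.
have [[? ->]|[_ ->]] := ramp_cases y; first lra.
have [[_ ->]|[? ->]] := ramp_cases (y - 2); last lra.
by have [[? ->]|[h1 ->]] := ramp_cases (y - 1); split; nra.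
Qed.

Lemma hat_01 y : 0 <= hat y <= 1.
Proof.
rewrite /hat; apply/andP.
have [[? ->]|[h ->]] := ramp_cases y; have [[? ->]|[h1 ->]] := ramp_cases (y - 1);
  have [[? ->]|[h2 ->]] := ramp_cases (y - 2); split; lra.
Qed.

Lemma hat_near y : 0 <= y <= 1 -> hat y = y /\ hat (y + 1) = 1 - y.
Proof.
move=> /andP[? ?]; rewrite /hat (_ : y + 1 - 1 = y); last by ring.
have [[? ->]|[h ->]] := ramp_cases y; have [[? ->]|[h1 ->]] := ramp_cases (y - 1);
  have [[? ->]|[h2 ->]] := ramp_cases (y - 2); have [[? ->]|[h3 ->]] := ramp_cases (y + 1);
  have [[? ->]|[h4 ->]] := ramp_cases (y + 1 - 2); split; lra.
Qed.

Let ramp_taylor y z : `|ramp z ^+ 2 / 2 - ramp y ^+ 2 / 2 - ramp y * (z - y)| <= (z - y) ^+ 2 / 2.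
Proof.
rewrite ler_norml; apply/andP.
have sy := sqr_ge0 y; have sz := sqr_ge0 z; have szy := sqr_ge0 (z - y).
have [[h ->]|[h ->]] := ramp_cases y; have [[h1 ->]|[h1 ->]] := ramp_cases z.
- split; lra.
- by have := mulr_le0_ge0 h h1; split; lra.
- by have := mulr_ge0_le0 h h1; split; lra.
- split; lra.
Qed.

Lemma ramp_lip y z : `|ramp z - ramp y| <= `|z - y|.
Proof.
rewrite ler_norml; have := ler_norm (z - y); have := ler_norm (- (z - y)); rewrite normrN => ? ?.
have := normr_ge0 (z - y) => ?; apply/andP.
have [[? ->]|[h ->]] := ramp_cases y; have [[? ->]|[h1 ->]] := ramp_cases z; split; lra.
Qed.

Lemma spline_taylor y z : `|spline z - spline y - hat y * (z - y)| <= 2 * (z - y) ^+ 2.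
Proof.
have h0 := ramp_taylor y z; have h1 := ramp_taylor (y - 1) (z - 1).
have h2 := ramp_taylor (y - 2) (z - 2).
have e1 : z - 1 - (y - 1) = z - y by ring.
have e2 : z - 2 - (y - 2) = z - y by ring.
rewrite e1 in h1; rewrite e2 in h2; rewrite /spline /hat.
move: h0 h1 h2; rewrite !ler_norml => /andP[? ?] /andP[? ?] /andP[? ?]; apply/andP; split; lra.
Qed.

Lemma hat_lip y z : `|hat z - hat y| <= 4 * `|z - y|.
Proof.
have h0 := ramp_lip y z; have h1 := ramp_lip (y - 1) (z - 1).
have h2 := ramp_lip (y - 2) (z - 2).
have e1 : z - 1 - (y - 1) = z - y by ring.
have e2 : z - 2 - (y - 2) = z - y by ring.
rewrite e1 in h1; rewrite e2 in h2; rewrite /hat.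
move: h0 h1 h2; rewrite !ler_norml => /andP[? ?] /andP[? ?] /andP[? ?]; apply/andP; split; lra.
Qed.

Lemma is_derive_spline y : is_derive y 1 spline (hat y).
Proof.
apply: (is_derive_sqr (L := 2) ltr01) => h _.
have := spline_taylor y (h *: (1 : R) + y); rewrite [h *: 1]mulr1 addrK.
by rewrite [h * _]mulrC.
Qed.

End QuadraticSpline.

Section Cutoff.
Context {R : realType} {d : nat}.
Local Notation E := 'rV[R]_d.
Variables (r : R) (r_gt0 : 0 < r).

(** A polynomial in |x|^2, so that the origin needs no special care. It equals 2 for |x| = r and 0
    for |x| = 2 r, the two ends of the transition of [spline]. *)
Let q (x : E) : R := 2 * (4 * r ^+ 2 - dotp x x) / (3 * r ^+ 2).
Definition cutoff (x : E) : R := spline (q x).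
Definition cutoff_grad (x : E) : E := (- (4 * hat (q x) / (3 * r ^+ 2))) *: x.

Let r2 : 0 < 3 * r ^+ 2. Proof. by rewrite mulr_gt0// exprn_gt0. Qed.

Let q_in x : enorm x <= r -> 2 <= q x.
Proof.
move=> h; rewrite /q ler_pdivlMr// -sqr_enorm.
have : enorm x ^+ 2 <= r ^+ 2 by rewrite lerXn2r// nnegrE ?enorm_ge0// ltW.
lra.
Qed.

Let q_out x : 2 * r <= enorm x -> q x <= 0.
Proof.
move=> h; rewrite /q pmulr_lle0 ?invr_gt0// -sqr_enorm.
have : (2 * r) ^+ 2 <= enorm x ^+ 2.
  by rewrite lerXn2r// nnegrE ?enorm_ge0// mulr_ge0// ltW.
rewrite exprMn; lra.
Qed.

Lemma cutoff_01 x : 0 <= cutoff x <= 1. Proof. exact: spline_01. Qed.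

Lemma cutoff_in x : enorm x <= r -> cutoff x = 1.
Proof. by move=> /q_in /spline_ge2[]. Qed.

Lemma cutoff_out x : 2 * r <= enorm x -> cutoff x = 0.
Proof. by move=> /q_out /spline_le0[]. Qed.

Lemma cutoff_grad_out x : ~~ (r < enorm x < 2 * r) -> cutoff_grad x = 0.
Proof.
rewrite negb_and -!leNgt /cutoff_grad => /orP[/q_in /spline_ge2|/q_out /spline_le0] [_ ->];
  by rewrite mulr0 mul0r oppr0 scale0r.
Qed.

(** On the shell the gradient is at most 4 |x| / (3 r^2) < 8 / (3 r), rounded up to 3 / r. *)
Lemma cutoff_grad_le x : enorm (cutoff_grad x) <= 3 / r.
Proof.
have [/andP[_ xr]|nx] := boolP (r < enorm x < 2 * r); last first.
  by rewrite cutoff_grad_out// enorm0 divr_ge0// ltW.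
have /andP[h0 h1] := hat_01 (q x).
rewrite enormZ normrN ger0_norm; last by rewrite divr_ge0 ?mulr_ge0// ltW.
rewrite mulrAC ler_pdivrMr//.
have -> : 3 / r * (3 * r ^+ 2) = 9 * r by field; rewrite gt_eqF.
have := enorm_ge0 x; move: (enorm x) xr (hat (q x)) h0 h1 => e er k k0 k1 e0.
have : k * e <= e by rewrite ler_piMl.
lra.
Qed.

(** On a bounded ball [q] is Lipschitz and the bounds on [spline] compose with it; [C11_extend]
    makes them global. The 1 in 3 / r + 1 bounds the function itself, because the extension uses one
    constant for the function and its gradient. *)
Lemma cutoff_C11 : exists2 L, 0 <= L & C11 setT (3 / r + 1) L cutoff cutoff_grad.
Proof.
pose c := 2 / (3 * r ^+ 2).
have c0 : 0 < c by rewrite divr_gt0.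
have cW := ltW c0; have rW := ltW r_gt0.
have qE x y : q y - q x = - c * (dotp y y - dotp x x) by rewrite /q /c; ring.
pose Q := c * (6 * r).
have Q0 : 0 <= Q by rewrite mulr_ge0// mulr_ge0.
have qlip x y : cball (3 * r) x -> cball (3 * r) y -> `|q y - q x| <= Q * enorm (y - x).
  move=> xr yr; rewrite qE normrM normrN (gtr0_norm c0) -[Q * _]mulrA.
  apply: ler_wpM2l; first exact: ltW.
  have -> : dotp y y - dotp x x = dotp (y + x) (y - x).
    by rewrite dotpBr !dotpDl (dotpC y x); ring.
  apply: (le_trans (normr_dotp _ _)); rewrite ler_wpM2r ?enorm_ge0//.
  by apply: (le_trans (enormD _ _)); move: xr yr; rewrite /cball/=; lra.
have L0 : 0 <= 2 * Q ^+ 2 + c + 12 * r * c * 4 * Q + 2 * c.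
  by have := sqr_ge0 Q; have := mulr_ge0 (mulr_ge0 rW cW) Q0; lra.
have G0 : 0 <= 3 / r + 1 by rewrite addr_ge0// divr_ge0// ltW.
have rs : 2 * r < 3 * r by rewrite ltr_pM2r// ltr_nat.
eexists; last first.
  apply: (@C11_extend _ _ (2 * r) (3 * r) _ _ _ _ rs G0 L0).
  - split.
    + by move=> x _; apply: (le_trans (cutoff_grad_le x)); rewrite lerDl.
    + move=> x y xr yr; set e := enorm (y - x).
      have e0 : 0 <= e := enorm_ge0 _.
      have /andP[h0 h1] := hat_01 (q x).
      have -> : cutoff y - cutoff x - dotp (cutoff_grad x) (y - x) =
        (spline (q y) - spline (q x) - hat (q x) * (q y - q x)) - c * hat (q x) * e ^+ 2.
        rewrite /cutoff /cutoff_grad dotpZl /e sqr_enorm qE dotpBl !dotpBr (dotpC y x) /c.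
        by field; rewrite gt_eqF// exprn_gt0.
      have t1 := spline_taylor (q x) (q y).
      have t2 : (q y - q x) ^+ 2 <= (Q * e) ^+ 2.
        rewrite -[leLHS]real_normK ?num_real//; apply: lerXn2r; rewrite ?nnegrE.
        - exact: normr_ge0.
        - exact: mulr_ge0 Q0 e0.
        - exact: qlip.
      rewrite exprMn in t2.
      have t3 : 0 <= c * hat (q x) * e ^+ 2 := mulr_ge0 (mulr_ge0 cW h0) (sqr_ge0 _).
      have t4 : c * hat (q x) * e ^+ 2 <= c * e ^+ 2.
        by rewrite -mulrA; apply: (ler_wpM2l cW); rewrite ler_piMl ?sqr_ge0.
      have t5 : 0 <= r * c * Q * e ^+ 2 := mulr_ge0 (mulr_ge0 (mulr_ge0 rW cW) Q0) (sqr_ge0 _).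
      have t6 : 0 <= c * e ^+ 2 := mulr_ge0 cW (sqr_ge0 _).
      move: t1 t2 t3 t4 t5 t6.
      move: (spline (q y) - spline (q x) - hat (q x) * (q y - q x)) ((q y - q x) ^+ 2) (hat (q x)) => A X k.
      clearbody Q c; rewrite !ler_norml => /andP[? ?] ? ? ? ? ?.
      by rewrite !mulrDl; apply/andP; split; lra.
    + move=> x y xr yr; set e := enorm (y - x).
      have e0 : 0 <= e := enorm_ge0 _.
      have /andP[h0 h1] := hat_01 (q y).
      have -> : cutoff_grad y - cutoff_grad x =
        (- (2 * c * hat (q y))) *: (y - x) + (- (2 * c * (hat (q y) - hat (q x)))) *: x.
        apply/rowP => i; rewrite /cutoff_grad !mxE /c; field; by rewrite gt_eqF// exprn_gt0.
      apply: (le_trans (enormD _ _)); rewrite !enormZ !normrN.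
      have t1 : `|2 * c * hat (q y)| * e <= 2 * c * e.
        rewrite ger0_norm; last exact: (mulr_ge0 (mulr_ge0 (ler0n _ 2) cW) h0).
        by rewrite ler_wpM2r// ler_piMr//; exact: (mulr_ge0 (ler0n _ 2) cW).
      have t2 : `|2 * c * (hat (q y) - hat (q x))| * enorm x <= (2 * c * (4 * (Q * e))) * (3 * r).
        apply: ler_pM; [exact: normr_ge0|exact: enorm_ge0| |exact: xr].
        rewrite normrM (ger0_norm (mulr_ge0 (ler0n _ 2) cW)).
        apply: ler_wpM2l; first exact: (mulr_ge0 (ler0n _ 2) cW).
        by apply: (le_trans (hat_lip _ _)); apply: ler_wpM2l => //; exact: qlip.
      have t3 : 0 <= Q ^+ 2 * e := mulr_ge0 (sqr_ge0 _) e0.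
      have t4 : 0 <= c * e := mulr_ge0 cW e0.
      have t5 : 0 <= r * c * Q * e := mulr_ge0 (mulr_ge0 (mulr_ge0 rW cW) Q0) e0.
      rewrite -/e; move: t1 t2; move: (`|2 * c * hat (q y)| * e) (`|2 * c * _| * _) => A X.
      clearbody Q c e; rewrite !mulrDl; lra.
  - move=> x _; have /andP[h0 h1] := cutoff_01 x; rewrite ger0_norm//.
    by apply: (le_trans h1); rewrite lerDr divr_ge0// ltW.
  - move=> x; rewrite /cball/= => /negP; rewrite -ltNge => /ltW xr; split.
      exact: cutoff_out.
    by apply: cutoff_grad_out; rewrite negb_and -!leNgt xr orbT.
have h : 0 <= (3 / r + 1) / (3 * r - 2 * r) by rewrite divr_ge0//; lra.
have h' : 0 <= (3 / r + 1) / (3 * r - 2 * r) ^+ 2 by rewrite divr_ge0// sqr_ge0.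
by rewrite addr_ge0// addr_ge0.
Qed.

End Cutoff.

(** * The Euler scheme *)

Section EulerScheme.
Context {R : realType} {d : nat}.
Local Notation E := 'rV[R]_d.
Implicit Types (x y v w : E) (f : E -> R) (g : E -> E).

(* A x is the adjoint of the derivative of the field B at x. *)
Record field_bounds (M : R) (B : E -> E) (A : E -> E -> E) : Prop := FieldBounds {
  field_bound : forall x, enorm (B x) <= M ;
  field_lip : forall x y, enorm (B y - B x) <= M * enorm (y - x) ;
  field_linear : forall x v w, A x (v - w) = A x v - A x w ;
  field_adj : forall x v, enorm (A x v) <= M * enorm v ;
  field_adj_lip : forall x y v,
    enorm (A y v - A x v) <= M * enorm v * enorm (y - x) ;
  field_taylor : forall x y v,
    `|dotp v (B y - B x) - dotp (A x v) (y - x)| <= M * enorm v * enorm (y - x) ^+ 2 }.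

Definition step (h : R) (B : E -> E) x : E := x + h *: B x.

Fixpoint euler (h : R) (B : nat -> E -> E) f j : E -> R :=
  if j is k.+1 then fun x => euler h B f k (step h (B k) x) else f.

(** The chain rule: composition with x + h B x multiplies the gradient, taken at the image point, by
    the identity plus h times the transposed Jacobian of B. *)
Fixpoint euler_grad (h : R) (B : nat -> E -> E) (A : nat -> E -> E -> E) g j : E -> E :=
  if j is k.+1 then fun x =>
    let v := euler_grad h B A g k (step h (B k) x) in v + h *: A k x v
  else g.

Lemma field_bound_ge0 M B A : field_bounds M B A -> 0 <= M.
Proof. by move=> F; apply: le_trans (enorm_ge0 _) (field_bound F 0). Qed.

Lemma step_lip h M B A x y : 0 <= h -> field_bounds M B A ->
  enorm (step h B y - step h B x) <= (1 + h * M) * enorm (y - x).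
Proof.
move=> h0 F; rewrite /step.
have -> : y + h *: B y - (x + h *: B x) = (y - x) + h *: (B y - B x).
  by apply/rowP => i; rewrite !mxE; ring.
apply: (le_trans (enormD _ _)); rewrite enormZ ger0_norm// mulrDl mul1r lerD2l -mulrA.
by apply: ler_wpM2l => //; exact: field_lip F _ _.
Qed.

Lemma step_dist h M B A x : 0 <= h -> field_bounds M B A ->
  enorm (step h B x - x) <= h * M.
Proof.
move=> h0 F; rewrite /step addrAC subrr add0r enormZ ger0_norm//.
by apply: ler_wpM2l => //; exact: field_bound F _.
Qed.

(** The remainder of the composition is the remainder of [f] between the image points plus h times
    that of the field in the direction of the gradient. Both are controlled by bounds of the same
    kind as those to be proved, so that the estimate can be iterated. *)
Lemma C11_step h M B A G L f g : 0 <= h -> field_bounds M B A -> 0 <= G -> 0 <= L ->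
  C11 setT G L f g ->
  C11 setT ((1 + h * M) * G) ((1 + h * M) ^+ 2 * L + h * M * G)
    (fun x => f (step h B x))
    (fun x => g (step h B x) + h *: A x (g (step h B x))).
Proof.
move=> h0 F G0 L0 [c1 c2 c3]; have M0 := field_bound_ge0 F.
have hM : 0 <= h * M by rewrite mulr_ge0.
split.
- move=> x _; apply: (le_trans (enormD _ _)); rewrite enormZ ger0_norm// mulrDl mul1r.
  have h1 : enorm (g (step h B x)) <= G by exact: c1.
  apply: lerD => //; rewrite -mulrA; apply: ler_wpM2l => //.
  by apply: (le_trans (field_adj F _ _)); apply: ler_wpM2l.
- move=> x y _ _; set e := enorm (y - x).
  have e0 : 0 <= e := enorm_ge0 _.
  set v := g (step h B x).
  have vG : enorm v <= G by exact: c1.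
  have -> : f (step h B y) - f (step h B x) - dotp (v + h *: A x v) (y - x) =
    (f (step h B y) - f (step h B x) - dotp v (step h B y - step h B x)) +
    h * (dotp v (B y - B x) - dotp (A x v) (y - x)).
    by rewrite /step !dotpDl dotpZl !dotpBr !dotpDr !dotpZr; ring.
  have t1 := c2 (step h B x) (step h B y) I I.
  have t2 := step_lip x y h0 F; rewrite -/e in t2.
  have t3 := field_taylor F x y v; rewrite -/e in t3.
  have t4 : enorm (step h B y - step h B x) ^+ 2 <= ((1 + h * M) * e) ^+ 2.
    by apply: lerXn2r t2; rewrite nnegrE ?enorm_ge0// mulr_ge0// addr_ge0.
  have t5 : M * enorm v * e ^+ 2 <= M * G * e ^+ 2.
    by rewrite ler_wpM2r ?sqr_ge0// ler_wpM2l.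
  rewrite exprMn in t4.
  apply: (le_trans (ler_normD _ _)); rewrite mulrDl; apply: lerD.
    by apply: (le_trans t1); rewrite [_ * L]mulrC -mulrA; apply: ler_wpM2l.
  rewrite normrM ger0_norm// -!mulrA; apply: ler_wpM2l => //.
  by rewrite mulrA; apply: (le_trans t3).
- move=> x y _ _; set e := enorm (y - x).
  have e0 : 0 <= e := enorm_ge0 _.
  set v := g (step h B x); set w := g (step h B y).
  have vG : enorm v <= G by exact: c1.
  have wv : enorm (w - v) <= L * ((1 + h * M) * e).
    by apply: (le_trans (c3 _ _ I I)); apply: ler_wpM2l => //; exact: (step_lip _ _ h0 F).
  have -> : w + h *: A y w - (v + h *: A x v) =
    (w - v) + h *: (A y (w - v) + (A y v - A x v)).
    by rewrite (field_linear F); apply/rowP => i; rewrite !mxE; ring.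
  apply: (le_trans (enormD _ _)); rewrite enormZ ger0_norm//.
  have t1 : enorm (A y (w - v) + (A y v - A x v)) <= M * (L * ((1 + h * M) * e)) + M * G * e.
    apply: (le_trans (enormD _ _)); apply: lerD.
      by apply: (le_trans (field_adj F _ _)); apply: ler_wpM2l.
    apply: (le_trans (field_adj_lip F _ _ _)); rewrite -/e.
    by rewrite ler_wpM2r// ler_wpM2l.
  apply: (@le_trans _ _ (L * ((1 + h * M) * e) + h * (M * (L * ((1 + h * M) * e)) + M * G * e))).
    by apply: lerD => //; apply: ler_wpM2l.
  by rewrite le_eqVlt; apply/orP; left; apply/eqP; ring.
Qed.

(** Discrete Gronwall: (1 + h M)^n <= exp(M T) as long as n h <= T. The constants grow with [M],
    hence with k in the application, but not with the number of steps; they enter only terms that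
    vanish with h. *)
Lemma euler_C11 (M T G0 L0 : R) f g : 0 <= G0 -> 0 <= L0 -> 0 <= M -> 0 <= T ->
  C11 setT G0 L0 f g ->
  exists G L : R, [/\ 0 <= G, 0 <= L & forall (h : R) B A n, 0 <= h -> n%:R * h <= T ->
    (forall j, field_bounds M (B j) (A j)) ->
    forall j, (j <= n)%N -> C11 setT G L (euler h B f j) (euler_grad h B A g j)].
Proof.
move=> G00 L00 M0 T0 cfg; pose K := expR (M * T).
have K1 : 1 <= K by apply: le_trans (expR_ge1Dx _); rewrite lerDl mulr_ge0.
have K0 : 0 <= K by exact: le_trans ler01 K1.
exists (K * G0), (K ^+ 2 * (L0 + T * (M * K * G0))).
have MK : 0 <= M * K * G0 by rewrite !mulr_ge0.
split; rewrite ?mulr_ge0 ?addr_ge0 ?exprn_ge0// ?mulr_ge0// => h B A n h0 nh F j jn.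
have hM0 : 0 <= h * M by rewrite mulr_ge0.
pose q := 1 + h * M.
have q1 : 1 <= q by rewrite lerDl.
have q0 : 0 <= q by exact: le_trans ler01 q1.
have qK i : (i <= n)%N -> q ^+ i <= K.
  move=> ii; apply: (@le_trans _ _ (expR (h * M) ^+ i)).
    by apply: lerXn2r; rewrite ?nnegrE ?expR_ge0//; exact: expR_ge1Dx.
  rewrite -expRM_natl ler_expR; apply: (@le_trans _ _ (M * (n%:R * h))); last exact: ler_wpM2l.
  have -> : i%:R * (h * M) = M * (i%:R * h) by ring.
  by do 2!(rewrite ?(ler_wpM2l, ler_wpM2r)//); rewrite ler_nat.
have Hj i : (i <= n)%N -> C11 setT (q ^+ i * G0)
    ((q ^+ i) ^+ 2 * (L0 + i%:R * (h * (M * K * G0)))) (euler h B f i) (euler_grad h B A g i).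
  elim: i => [|i IH] ii; first by rewrite !expr0 mul0r addr0 expr1n !mul1r.
  have qi0 : 0 <= q ^+ i by rewrite exprn_ge0.
  have H := @C11_step h M (B i) (A i) (q ^+ i * G0) _ _ _ h0 (F i) _ _ (IH (ltnW ii)).
  apply: C11_weaken (H _ _).
  - by rewrite exprS -mulrA.
  - have e1 : (q ^+ i.+1) ^+ 2 = q ^+ 2 * (q ^+ i) ^+ 2 by rewrite [q ^+ i.+1]exprS exprMn.
    have s1 : h * (M * (q ^+ i * G0)) <= h * (M * (K * G0)).
      by do 2!(apply: ler_wpM2l => //); apply: ler_wpM2r => //; apply: qK; exact: ltnW.
    have s2 : h * (M * (K * G0)) <= (q ^+ i.+1) ^+ 2 * (h * (M * (K * G0))).
      rewrite ler_peMl//; first by rewrite !mulr_ge0.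
      by rewrite exprn_ege1// exprn_ege1.
    rewrite -/q -natr1 [leRHS](_ : _ = q ^+ 2 * ((q ^+ i) ^+ 2 * (L0 + i%:R * (h * (M * K * G0)))) +
      (q ^+ i.+1) ^+ 2 * (h * (M * (K * G0)))); last by rewrite e1; ring.
    by rewrite lerD2l -mulrA (le_trans s1).
  - by rewrite mulr_ge0.
  - by rewrite mulr_ge0 ?sqr_ge0// addr_ge0// mulr_ge0// mulr_ge0.
apply: C11_weaken (Hj j jn).
  by apply: ler_wpM2r => //; exact: qK.
apply: ler_pM; rewrite ?sqr_ge0//.
- by rewrite addr_ge0// mulr_ge0// mulr_ge0.
- by apply: lerXn2r (qK _ jn); rewrite nnegrE// exprn_ge0.
rewrite lerD2l mulrA; apply: ler_wpM2r => //; apply: le_trans nh.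
by apply: ler_wpM2r => //; rewrite ler_nat.
Qed.

Lemma euler_bound h B f (c : R) j : (forall x, `|f x| <= c) ->
  forall x, `|euler h B f j x| <= c.
Proof. by move=> fc; elim: j => [|j IH] x //=; exact: fc. Qed.

(** The displacement of one step is h B, of length at most h M. The Taylor bound therefore leaves a
    consistency error of order h^2, and cruder bounds of order h on the function and its gradient
    serve where only smallness matters. *)
Lemma euler_increment (h T M G L : R) B A f g : 0 <= h -> h <= T -> 0 <= G -> 0 <= L ->
  field_bounds M B A -> C11 setT G L f g ->
  let F x := f (step h B x) in
  let g' x := g (step h B x) + h *: A x (g (step h B x)) in
  [/\ forall x, `|F x - f x - h * dotp (B x) (g x)| <= L * M ^+ 2 * h ^+ 2,
      forall x, `|F x - f x| <= (G * M + L * M ^+ 2 * T) * h &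
      forall x, enorm (g' x - g x) <= (L * M + M * G) * h].
Proof.
move=> h0 hT G0 L0 FB cfg F g'; have M0 := field_bound_ge0 FB.
have s1 x : enorm (step h B x - x) ^+ 2 <= (h * M) ^+ 2.
  by apply: lerXn2r (step_dist _ h0 FB); rewrite nnegrE ?enorm_ge0// mulr_ge0.
have a x : `|F x - f x - h * dotp (B x) (g x)| <= L * M ^+ 2 * h ^+ 2.
  have := C11_taylor cfg (x := x) (y := step h B x) I I.
  have -> : dotp (g x) (step h B x - x) = h * dotp (B x) (g x).
    by rewrite /step addrAC subrr add0r dotpZr dotpC.
  move=> /le_trans; apply; rewrite -mulrA; apply: ler_wpM2l => //.
  by rewrite -exprMn [M * h]mulrC.
split => //.
- move=> x; have -> : F x - f x = (F x - f x - h * dotp (B x) (g x)) + h * dotp (B x) (g x) by ring.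
  apply: (le_trans (ler_normD _ _)); rewrite mulrDl addrC; apply: lerD.
    rewrite normrM ger0_norm// mulrC; apply: ler_wpM2r => //.
    apply: (le_trans (normr_dotp _ _)); rewrite mulrC.
    by apply: ler_pM; rewrite ?enorm_ge0//; [exact: C11_grad cfg _ _|exact: field_bound FB _].
  have t : h ^+ 2 <= T * h by rewrite expr2; apply: ler_wpM2r.
  apply: (le_trans (a x)); rewrite -[leRHS]mulrA; apply: ler_wpM2l => //.
  by rewrite mulr_ge0// sqr_ge0.
- move=> x; rewrite /g' addrAC; apply: (le_trans (enormD _ _)); rewrite mulrDl; apply: lerD.
    apply: (le_trans (C11_lip cfg _ _)) => //; rewrite -mulrA; apply: ler_wpM2l => //.
    by rewrite mulrC; exact: step_dist FB.
  rewrite enormZ ger0_norm// mulrC; apply: ler_wpM2r => //.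
  apply: (le_trans (field_adj FB _ _)); apply: ler_wpM2l => //.
  exact: C11_grad cfg _ _.
Qed.

Section Lyapunov.
Variables (r3 r4 : R) (h M c1 A0 : R) (B : nat -> E -> E) (A : nat -> E -> E -> E) (V : E -> R) (gV : E -> E) (g : E -> E).
Hypothesis r34 : r3 <= r4.
Hypothesis h_ge0 : 0 <= h.
Hypothesis hM : h * M <= r4 - r3.
Hypothesis FB : forall j, field_bounds M (B j) (A j).
Hypothesis outB : forall j x, ~ cball r3 x -> B j x = 0 /\ forall v, A j x v = 0.
Hypothesis V_gt0 : forall x, cball r4 x -> 0 < V x.
Hypothesis c1_ge0 : 0 <= c1.
Hypothesis dissipative : forall j x v, cball r3 x ->
  enorm v ^+ 2 * dotp (B j x) (gV x) + 2 * dotp (A j x v) v * V x <=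
  c1 * enorm v ^+ 2 * V x.
Hypothesis V_taylor : forall j x, cball r3 x ->
  V (step h (B j) x) <= V x + h * dotp (B j x) (gV x) + h * V x.
Hypothesis h_small : h * M <= 1 /\ h * (M ^+ 2 + 3 * M * (c1 + 2 * M + 1)) <= 1.
Hypothesis A0_ge0 : 0 <= A0.
Hypothesis init : forall x, cball r4 x -> enorm (g x) ^+ 2 <= A0 * V x.

Let step_ball j x : cball r3 x -> cball r4 (step h (B j) x).
Proof.
rewrite /cball/= => x3; have -> : step h (B j) x = (step h (B j) x - x) + x by rewrite subrK.
apply: (le_trans (enormD _ _)); apply: (le_trans (lerD (step_dist x h_ge0 (FB j)) x3)).
by rewrite -lerBrDr.
Qed.

(** Let s = <A v, v> / |v|^2 and w = <B, grad V> / V. The squared norm gains at most the factor 1 +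
    2 h s + h^2 M^2 and V at most 1 + h (w + 1), with w <= c1 - 2 s by dissipativity. In the product
    the terms 2 h s cancel. Of the two extra units in c1 + 2, one is the Taylor error of V and the
    other pays for the terms of order h^2. *)
Let one_step j x v : cball r3 x ->
  enorm (v + h *: A j x v) ^+ 2 * V (step h (B j) x) <=
  (1 + h * (c1 + 2)) * (enorm v ^+ 2 * V x).
Proof.
move=> x3; have M0 := field_bound_ge0 (FB 0%N).
have x4 : cball r4 x by apply: le_trans r34.
have Vx := V_gt0 x4; have VP := V_gt0 (step_ball j x3).
have e1 : enorm (v + h *: A j x v) ^+ 2 = enorm v ^+ 2 + 2 * h * dotp (A j x v) v + h ^+ 2 * enorm (A j x v) ^+ 2.
  by rewrite !sqr_enorm !dotpDl !dotpDr !dotpZl !dotpZr (dotpC v); ring.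
have [n0|n0] := eqVneq (enorm v) 0.
  have := enorm_eq0 n0 => v0; have a0 : enorm (A j x v) = 0.
    apply/eqP; rewrite eq_le enorm_ge0 andbT.
    by have := field_adj (FB j) x v; rewrite n0 mulr0.
  by rewrite e1 v0 dotp0r -v0 a0 n0 expr0n/= !mulr0 !mul0r !addr0 mul0r mulr0.
have np : 0 < enorm v by rewrite lt_neqAle eq_sym n0 enorm_ge0.
pose N := enorm v ^+ 2; have Np : 0 < N by rewrite exprn_gt0.
pose s := dotp (A j x v) v / N; have sE : dotp (A j x v) v = s * N by rewrite /s divfK// gt_eqF.
have sM : `|s| <= M.
  rewrite /s normrM normfV (gtr0_norm Np) ler_pdivrMr//.
  apply: (le_trans (normr_dotp _ _)); rewrite /N expr2 mulrA ler_wpM2r ?enorm_ge0//.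
  exact: field_adj (FB j) _ _.
pose w := dotp (B j x) (gV x) / V x.
have wE : dotp (B j x) (gV x) = w * V x by rewrite /w divfK// gt_eqF.
have D := @dissipative j x v x3; rewrite -/N sE wE in D.
have ws : w + 2 * s <= c1.
  have : (w + 2 * s) * (N * V x) <= c1 * (N * V x).
    by apply: le_trans (le_trans _ D) _; rewrite le_eqVlt; apply/orP; left; apply/eqP; ring.
  by rewrite ler_pM2r// mulr_gt0.
have P1 : enorm (v + h *: A j x v) ^+ 2 <= (1 + 2 * h * s + h ^+ 2 * M ^+ 2) * N.
  have a2 : enorm (A j x v) ^+ 2 <= M ^+ 2 * N.
    rewrite /N -exprMn; apply: lerXn2r (field_adj (FB j) _ _).
      by rewrite nnegrE enorm_ge0.
    by rewrite nnegrE mulr_ge0// ltW.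
  have a3 : h ^+ 2 * enorm (A j x v) ^+ 2 <= h ^+ 2 * (M ^+ 2 * N).
    by apply: ler_wpM2l a2; exact: sqr_ge0.
  rewrite e1 sE -/N; lra.
have W1 : V (step h (B j) x) <= (1 + h * (c1 - 2 * s + 1)) * V x.
  apply: (le_trans (V_taylor j x3)); rewrite wE.
  have : h * V x * w <= h * V x * (c1 - 2 * s).
    by apply: ler_wpM2l; [rewrite mulr_ge0// ltW|lra].
  lra.
apply: (@le_trans _ _ (((1 + 2 * h * s + h ^+ 2 * M ^+ 2) * N) * ((1 + h * (c1 - 2 * s + 1)) * V x))).
  by apply: ler_pM P1 W1; [exact: sqr_ge0|exact: ltW].
rewrite [leLHS]mulrACA; apply: ler_wpM2r; first by rewrite mulr_ge0// ltW.
move: sM; rewrite ler_norml => /andP[s1 s2]; have [h1 h2] := h_small.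
have m1 : `|2 * s + h * M ^+ 2| <= 3 * M.
  have : h * M ^+ 2 <= M by rewrite expr2 mulrA ler_piMl.
  have : 0 <= h * M ^+ 2 by rewrite mulr_ge0// sqr_ge0.
  by move=> ? ?; rewrite ler_norml; apply/andP; split; lra.
have m2 : `|c1 - 2 * s + 1| <= c1 + 2 * M + 1.
  by have := c1_ge0; rewrite ler_norml => ?; apply/andP; split; lra.
have m3 : (2 * s + h * M ^+ 2) * (c1 - 2 * s + 1) <= 3 * M * (c1 + 2 * M + 1).
  by apply: (le_trans (ler_norm _)); rewrite normrM; apply: ler_pM.
have m4 : h * (M ^+ 2 + (2 * s + h * M ^+ 2) * (c1 - 2 * s + 1)) <= 1.
  by apply: le_trans h2; apply: ler_wpM2l => //; rewrite lerD2l.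
have m5 : h * (h * (M ^+ 2 + (2 * s + h * M ^+ 2) * (c1 - 2 * s + 1))) <= h * 1.
  exact: ler_wpM2l.
apply: (@le_trans _ _ (1 + h * (c1 + 1) + h * (h * (M ^+ 2 + (2 * s + h * M ^+ 2) * (c1 - 2 * s + 1))))).
  by rewrite le_eqVlt; apply/orP; left; apply/eqP; ring.
lra.
Qed.

(** The induction hypothesis at the image point contains the value of V there, which cancels against
    the same factor in [one_step]. Off [cball r3] the step is the identity; from [cball r3] it leads
    into [cball r4], where V is positive. *)
Lemma euler_lyapunov j x : cball r4 x ->
  enorm (euler_grad h B A g j x) ^+ 2 <= A0 * (1 + h * (c1 + 2)) ^+ j * V x.
Proof.
have q1 : 1 <= 1 + h * (c1 + 2) by rewrite lerDl mulr_ge0// addr_ge0.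
elim: j x => [|j IH] x x4; first by rewrite expr0 mulr1; exact: init.
have Vx := V_gt0 x4.
have Q0 : 0 <= A0 * (1 + h * (c1 + 2)) ^+ j.
  by rewrite mulr_ge0// exprn_ge0// (le_trans ler01 q1).
rewrite /=; have [x3|x3] := pselect (cball r3 x); last first.
  have [b0 a0] := outB j x3; rewrite /step b0 a0 !scaler0 !addr0.
  apply: (le_trans (IH _ x4)); apply: ler_wpM2r; first exact: ltW.
  by apply: ler_wpM2l => //; rewrite exprS ler_peMl// exprn_ge0// (le_trans ler01 q1).
set v := euler_grad _ _ _ _ _ _.
have VP := V_gt0 (step_ball j x3).
rewrite -(ler_pM2r VP); apply: (le_trans (one_step j v x3)).
have h1 := IH _ (step_ball j x3); rewrite -/v in h1.
have q0 : 0 <= (1 + h * (c1 + 2)) * V x by rewrite mulr_ge0// ?(le_trans ler01 q1)// ltW.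
have h2 := ler_wpM2l q0 h1.
rewrite [leLHS](_ : _ = (1 + h * (c1 + 2)) * V x * enorm v ^+ 2); last by ring.
apply: (le_trans h2); rewrite exprS; move: (_ ^+ j) => P.
by rewrite le_eqVlt; apply/orP; left; apply/eqP; ring.
Qed.

End Lyapunov.

End EulerScheme.

(** * Test functions interpolating the scheme *)

Section SeparatedTest.
Context {R : realType} {d : nat}.
Local Notation E := 'rV[R]_d.
Local Notation ER := (E * R)%type.

(** The filter of increments that stay in [0, T[ is nontrivial at every point, including the
    one-sided point 0, so that the limit in [derive_within] is unique. *)
Lemma within_itv_proper (T t : R) : t \in `[0, T[ ->
  ProperFilter (within [set h | `[0, T[%classic (t + h)] (0 : R)^').
Proof.
rewrite in_itv/= => /andP[t0 tT].
apply: Build_ProperFilter_ex => P HP.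
have /nbhs_ballP[e /= e0 He] : nbhs (0 : R) (fun h => h != 0 -> `[0, T[%classic (t + h) -> P h).
  exact: HP.
pose h := Num.min e (T - t) / 2.
have m0 : 0 < Num.min e (T - t) by rewrite lt_min e0 subr_gt0.
have me : Num.min e (T - t) <= e by rewrite ge_min lexx.
have mT : Num.min e (T - t) <= T - t by rewrite ge_min lexx orbT.
have h0 : 0 < h by rewrite divr_gt0.
exists h; apply: He.
- rewrite -ball_normE /ball_/= sub0r normrN gtr0_norm// /h; lra.
- by rewrite gt_eqF.
- rewrite /= in_itv/= /h; apply/andP; split; lra.
Qed.

Lemma quotient_within_cvg (A : set R) (f : R -> R) (t df : R) : is_derive t (1 : R) f df ->
  quotient_within A f t --> df.
Proof.
move=> [dfx <-]; rewrite /quotient_within.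
apply: cvg_within_filter; rewrite /derive.
have e : (fun h : R => h^-1 * (f (t + h) - f t)) =
    (fun h : R => h^-1 *: ((f \o shift t) (h *: (1 : R)) - f t)).
  by apply/funext => h; rewrite /= [h *: (1 : R)]mulr1 [t + h]addrC.
by rewrite e; exact: dfx.
Qed.

Variables (T : R) (m : nat) (c dc : nat -> R -> R) (P : nat -> E -> R) (p : nat -> E -> E).
Variable (r : R).
Hypothesis c_derive : forall j (s : R), is_derive s (1 : R) (c j) (dc j s).
Hypothesis dc_cont : forall j, continuous (dc j).
Hypothesis P_derive : forall j x i, is_derive x (unit_row i) (P j) (p j x 0 i).
Hypothesis P_cont : forall j, continuous (P j).
Hypothesis p_cont : forall j, continuous (p j).
Hypothesis P_out : forall j x, r < enorm x -> P j x = 0.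

(** Sums of products of a function of time and a function of space: derivatives and continuity are
    checked factor by factor, and joint differentiability is never discussed. *)
Definition separated (z : ER) : R := \sum_(j < m) c j z.2 * P j z.1.
Definition separated_time (z : ER) : R := \sum_(j < m) dc j z.2 * P j z.1.
Definition separated_grad (z : ER) : E := \sum_(j < m) c j z.2 *: p j z.1.

Let c_cont j : continuous (c j).
Proof.
move=> s; apply: differentiable_continuous; apply/derivable1_diffP.
by have [] := c_derive j s.
Qed.

Let sep_cont (a : nat -> R -> R) : (forall j, continuous (a j)) ->
  continuous (fun z : ER => \sum_(j < m) a j z.2 * P j z.1).
Proof.
move=> ca z; apply: (cvg_sum_cont (f := fun (j : 'I_m) (z : ER) => a j z.2 * P j z.1)) => j.
apply: cvgM.
  by apply: (@continuous_comp _ _ _ (fun z : ER => z.2) (a j)); [exact: cvg_snd|exact: ca].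
by apply: (@continuous_comp _ _ _ (fun z : ER => z.1) (P j)); [exact: cvg_fst|exact: P_cont].
Qed.

Lemma continuous_separated : continuous separated.
Proof. exact: sep_cont. Qed.

Lemma continuous_separated_time : continuous separated_time.
Proof. exact: sep_cont. Qed.

Lemma continuous_separated_grad : continuous separated_grad.
Proof.
move=> z; apply: continuous_row => i.
rewrite (_ : (fun z : ER => separated_grad z 0 i) =
  (fun z : ER => \sum_(j < m) c j z.2 * p j z.1 0 i)); last first.
  by apply/funext => w; rewrite /separated_grad summxE; apply: eq_bigr => j _; rewrite mxE.
apply: (cvg_sum_cont (f := fun (j : 'I_m) (z : ER) => c j z.2 * p j z.1 0 i)) => j.
apply: cvgM.
  by apply: (@continuous_comp _ _ _ (fun z : ER => z.2) (c j)); [exact: cvg_snd|exact: c_cont].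
apply: (continuous_coord (f := fun z : ER => p j z.1)).
by apply: (@continuous_comp _ _ _ (fun z : ER => z.1) (p j)); [exact: cvg_fst|exact: p_cont].
Qed.

Let is_derive_fsum (V : normedModType R) (n : nat) (f : nat -> V -> R) (x v : V) (df : nat -> R) :
  (forall j, is_derive x v (f j) (df j)) ->
  is_derive x v (fun y => \sum_(j < n) f j y) (\sum_(j < n) df j).
Proof.
move=> H; elim: n => [|n IH].
  rewrite big_ord0 (_ : (fun y => _) = cst 0); first exact: is_derive_cst.
  by apply/funext => y; rewrite big_ord0.
rewrite big_ord_recr (_ : (fun y => _) = (fun y => \sum_(j < n) f j y) + f n).
  exact: is_deriveD.
by apply/funext => y; rewrite big_ord_recr.
Qed.

Lemma separated_time_derive x (s : R) :
  is_derive s (1 : R) (fun s => separated (x, s)) (separated_time (x, s)).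
Proof.
apply: (@is_derive_fsum _ m (fun j s => c j s * P j x) _ _ (fun j => dc j s * P j x)) => j.
rewrite (_ : (fun s => _) = P j x *: c j); last first.
  by apply/funext => y; rewrite mulrC.
by rewrite mulrC; exact: is_deriveZ.
Qed.

Lemma separated_space_derive x s i :
  is_derive x (unit_row i) (fun x => separated (x, s)) (separated_grad (x, s) 0 i).
Proof.
have -> : separated_grad (x, s) 0 i = \sum_(j < m) c j s * p j x 0 i.
  by rewrite /separated_grad summxE; apply: eq_bigr => j _; rewrite mxE.
apply: (@is_derive_fsum _ m (fun j x => c j s * P j x) _ _ (fun j => c j s * p j x 0 i)) => j.
Qed.

Lemma time_derive_separated z : ([set: E] `*` `[0, T[) z ->
  time_derive T separated z = separated_time z.
Proof.
case: z => x s [_ /= sT]; rewrite /time_derive/= /derive_within.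
have PF := within_itv_proper sT.
apply: (@cvg_lim _ (@Rhausdorff R)).
exact: (quotient_within_cvg _ (separated_time_derive x s)).
Qed.

Lemma space_grad_separated z : space_grad separated z = separated_grad z.
Proof.
case: z => x s; apply/rowP => i; rewrite mxE.
by have [_ ->] := separated_space_derive x s i.
Qed.

Lemma separated_test : test_function T separated.
Proof.
split.
- exact/continuous_subspaceT/continuous_separated.
- move=> [x s] _ /=; apply/cvg_ex; exists (separated_time (x, s)).
  exact: (quotient_within_cvg _ (separated_time_derive x s)).
- apply: (@subspace_eq_continuous _ ([set: E] `*` `[0, T[) _ separated_time).
    by move=> z /set_mem Qz; exact: esym (time_derive_separated Qz).
  exact/continuous_subspaceT/continuous_separated_time.
- by move=> [x s] i _ /=; have [] := separated_space_derive x s i.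
- rewrite (_ : space_grad separated = separated_grad); last first.
    by apply/funext => z; exact: space_grad_separated.
  exact/continuous_subspaceT/continuous_separated_grad.
- by exists r => z _ rz; rewrite /separated big1// => j _; rewrite P_out// mulr0.
Qed.

End SeparatedTest.

Section SplineInterpolation.
Context {R : realType}.
Implicit Types (a b : nat -> R) (y tau : R).

Lemma spline_cell n tau : (2 <= n)%N -> 1 <= tau <= n%:R ->
  exists k, [/\ (0 < k)%N, (k < n)%N & k%:R <= tau <= k.+1%:R].
Proof.
elim: n => // n IH n2 /andP[t1 tn].
have [tn'|tn'] := leP tau n%:R; last first.
  exists n; split => //; last by rewrite (ltW tn').
case: n IH n2 tn tn' => [|[|n]] IH n2 tn tn'.
- by move: t1; rewrite leNgt; have -> : tau < 1 by apply: le_lt_trans tn' _.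
- by exists 1%N; split => //; rewrite t1.
by have [|k [k0 kn hk]] := IH isT _; [rewrite t1|exists k; split => //; exact: ltnW].
Qed.

(** On the cell [k, k + 1] only the tents with indices k - 1 and k are nonzero, and their weights
    add up to 1. *)
Lemma hat_sum n a k tau : (0 < k)%N -> (k < n)%N -> k%:R <= tau <= k.+1%:R ->
  \sum_(j < n) hat (tau - j%:R) * a j =
  (1 - (tau - k%:R)) * a k.-1 + (tau - k%:R) * a k.
Proof.
move=> k0 kn /andP[t0 t1].
have kk : (k.-1 < n)%N by apply: leq_ltn_trans kn; exact: leq_pred.
have kS : k%:R = k.-1%:R + 1 :> R by rewrite natr1 prednK.
rewrite -natr1 in t1.
have yy : 0 <= tau - k%:R <= 1 by apply/andP; split; lra.
have [h1 h2] := hat_near yy.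
rewrite (bigD1 (Ordinal kk))//= (bigD1 (Ordinal kn))/=; last first.
  by rewrite -val_eqE/= gtn_eqF// prednK.
rewrite big1 ?addr0.
  by rewrite h1 (_ : tau - k.-1%:R = tau - k%:R + 1) ?h2// kS; ring.
move=> j /andP[]; rewrite -!val_eqE/= => j1 j2.
have [jk|jk] := ltnP j k.-1.
  have /spline_ge2[_ ->] : 2 <= tau - j%:R; last by rewrite mul0r.
  have : (j.+1%:R <= k.-1%:R :> R) by rewrite ler_nat.
  rewrite -natr1; lra.
have kj : (k < j)%N.
  by rewrite ltn_neqAle eq_sym j2/= -(prednK k0) ltn_neqAle eq_sym j1.
have /spline_le0[_ ->] : tau - j%:R <= 0; last by rewrite mul0r.
have : (k.+1%:R <= j%:R :> R) by rewrite ler_nat.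
rewrite -natr1; lra.
Qed.

(** On the cell [k, k + 1] the splines with j <= k - 2 have reached 1 and their increments telescope
    to [b k.-1], those with j > k are still 0, and two transitions are under way. *)
Lemma spline_sum n b k tau : (0 < k)%N -> (k < n)%N -> k%:R <= tau <= k.+1%:R ->
  b 0%N + \sum_(j < n) spline (tau - j%:R) * (b j.+1 - b j) =
  b k.-1 + spline (tau - k%:R + 1) * (b k - b k.-1) +
  spline (tau - k%:R) * (b k.+1 - b k).
Proof.
move=> k0 kn /andP[t0 t1].
have kS : k%:R = k.-1%:R + 1 :> R by rewrite natr1 prednK.
rewrite -natr1 in t1.
have H i : (i <= n)%N -> b 0%N + \sum_(j < i) spline (tau - j%:R) * (b j.+1 - b j) =
    if (i <= k.-1)%N then b i else
    if (i <= k)%N then b k.-1 + spline (tau - k%:R + 1) * (b k - b k.-1) else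
    b k.-1 + spline (tau - k%:R + 1) * (b k - b k.-1) + spline (tau - k%:R) * (b k.+1 - b k).
  elim: i => [|i IH] ii; first by rewrite big_ord0 addr0.
  rewrite big_ord_recr/= addrA IH; last exact: ltnW.
  have [ik|ik] := leqP i.+1 k.-1.
    rewrite (ltnW ik).
    have /spline_ge2[-> _] : 2 <= tau - i%:R; last by ring.
    have : (i.+1%:R <= k.-1%:R :> R) by rewrite ler_nat.
    rewrite -natr1; lra.
  have [ik2|ik2] := leqP i k.-1.
    have e : i = k.-1 by apply/eqP; rewrite eqn_leq ik2 -ltnS.
    rewrite e prednK// leqnn (_ : tau - k.-1%:R = tau - k%:R + 1)//.
    by rewrite kS; ring.
  have [ik3|ik3] := leqP i k.
    have e : i = k by apply/eqP; rewrite eqn_leq ik3 -(prednK k0).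
    by rewrite e ltnn.
  rewrite [(i < k)%N]ltnNge (ltnW ik3)/=.
  have /spline_le0[-> _] : tau - i%:R <= 0; last by rewrite mul0r addr0.
  have : (k.+1%:R <= i%:R :> R) by rewrite ler_nat.
  rewrite -natr1; lra.
rewrite H// leqNgt (leq_ltn_trans (leq_pred k) kn)/=.
by rewrite leqNgt kn.
Qed.

(** 5 = 1 + 2 + 2: one node value and two increments, each at most 2 D, with weights in [0, 1]. *)
Lemma spline_sum_bound n b tau (D : R) : (2 <= n)%N -> 1 <= tau <= n%:R ->
  (forall j, (j <= n)%N -> `|b j| <= D) ->
  `|b 0%N + \sum_(j < n) spline (tau - j%:R) * (b j.+1 - b j)| <= 5 * D.
Proof.
move=> n2 ht bD; have [k [k0 kn hk]] := spline_cell n2 ht.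
rewrite (spline_sum _ k0 kn hk).
have b1 := bD k.-1 (leq_trans (leq_pred k) (ltnW kn)).
have b2 := bD k (ltnW kn); have b3 := bD k.+1 kn.
have t (y e e' : R) : `|e| <= D -> `|e'| <= D -> `|spline y * (e - e')| <= 2 * D.
  move=> he he'; have /andP[s0 s1] := spline_01 y.
  rewrite normrM (ger0_norm s0); apply: (@le_trans _ _ (1 * `|e - e'|)).
    by rewrite ler_wpM2r.
  by rewrite mul1r (le_trans (ler_normB _ _))//; lra.
have t1 := t (tau - k%:R + 1) _ _ b2 b1; have t2 := t (tau - k%:R) _ _ b3 b2.
apply: (le_trans (ler_normD _ _)); apply: (le_trans (lerD (ler_normD _ _) (lexx _))).
lra.
Qed.

(** Between one and two steps only the first two increments are active; this is the window in which
    the interpolation is still close to the initial datum. *)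
Lemma spline_sum_first n b tau (D : R) : (2 <= n)%N -> 1 <= tau <= 2 ->
  (forall j, (j < n)%N -> `|b j.+1 - b j| <= D) ->
  `|\sum_(j < n) spline (tau - j%:R) * (b j.+1 - b j)| <= 2 * D.
Proof.
move=> n2 ht bD.
have := @spline_sum n b 1%N tau isT n2 ht.
move=> /(congr1 (fun z => z - b 0%N)); rewrite [X in X - _]addrC addrK => ->.
rewrite /= [X in X - _]addrAC -addrA addrAC; 
have t y (e : R) : `|e| <= D -> `|spline y * e| <= D.
  move=> he; have /andP[s0 s1] := spline_01 y.
  rewrite normrM (ger0_norm s0); apply: le_trans he; rewrite ler_piMl//.
have t1 := t (tau - 1%:R + 1) _ (bD 0%N (ltnW n2)).
have t2 := t (tau - 1%:R) _ (bD 1%N n2).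
set X := spline _ * _; set Y := spline _ * _.
rewrite (_ : _ + _ = X + Y); last by rewrite /X /Y; ring.
by apply: (le_trans (ler_normD _ _)); lra.
Qed.

(* [a j / h] is the rate of change of the scheme in step j and [b j] the value
   of the transport term there. *)
Lemma spline_residual n a b h tau (D1 D2 : R) : (2 <= n)%N -> 1 <= tau <= n%:R ->
  0 < h -> 0 <= D2 ->
  (forall j, (j < n)%N -> `|tau - j%:R| <= 2 -> `|h^-1 * a j - b j| <= D1) ->
  (forall j, (j < n)%N -> `|b j.+1 - b j| <= D2) ->
  `|- h^-1 * (\sum_(j < n) hat (tau - j%:R) * a j) +
    (b 0%N + \sum_(j < n) spline (tau - j%:R) * (b j.+1 - b j))| <= D1 + 3 * D2.
Proof.
move=> n2 ht h0 D20 Ha Hb; have [k [k0 kn hk]] := spline_cell n2 ht.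
rewrite (spline_sum _ k0 kn hk) (hat_sum _ k0 kn hk).
have /andP[hk1 hk2] := hk; rewrite -natr1 in hk2.
have kS : k%:R = k.-1%:R + 1 :> R by rewrite natr1 prednK.
have kk : (k.-1 < n)%N by apply: leq_ltn_trans kn; exact: leq_pred.
have a1 : `|h^-1 * a k.-1 - b k.-1| <= D1.
  by apply: Ha => //; rewrite ler_norml; apply/andP; split; lra.
have a2 : `|h^-1 * a k - b k| <= D1.
  by apply: Ha => //; rewrite ler_norml; apply/andP; split; lra.
have b1 : `|b k - b k.-1| <= D2 by have := Hb _ kk; rewrite prednK.
have b2 := Hb _ kn.
have t y (e : R) : `|e| <= D2 -> `|spline y * e| <= D2.
  move=> he; have /andP[s0 s1] := spline_01 y.
  by rewrite normrM (ger0_norm s0); apply: le_trans he; rewrite ler_piMl.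
have t1 := t (tau - k%:R + 1) _ b1; have t2 := t (tau - k%:R) _ b2.
set y := tau - k%:R in t1 t2 *.
have y0 : 0 <= y by rewrite /y; lra.
have y1 : y <= 1 by rewrite /y; lra.
set X := spline (y + 1) * _ in t1 *; set Y := spline y * _ in t2 *.
have -> : - h^-1 * ((1 - y) * a k.-1 + y * a k) + (b k.-1 + X + Y) =
  (1 - y) * (- (h^-1 * a k.-1 - b k.-1)) + y * (- (h^-1 * a k - b k)) +
  (- (y * (b k - b k.-1)) + X + Y) by ring.
have u1 : `|(1 - y) * (- (h^-1 * a k.-1 - b k.-1))| <= (1 - y) * D1.
  by rewrite normrM normrN ger0_norm ?subr_ge0// ler_wpM2l// subr_ge0.
have u2 : `|y * (- (h^-1 * a k - b k))| <= y * D1.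
  by rewrite normrM normrN ger0_norm// ler_wpM2l.
have u3 : `|y * (b k - b k.-1)| <= D2.
  by rewrite normrM ger0_norm//; apply: le_trans b1; rewrite ler_piMl.
move: u1 u2 u3 t1 t2; move: (_ * - _) (y * - _) (y * (_ - _)) X Y => p1 p2 p3 X Y.
rewrite !ler_norml => /andP[? ?] /andP[? ?] /andP[? ?] /andP[? ?] /andP[? ?].
by apply/andP; split; lra.
Qed.

End SplineInterpolation.

Section ContinuouslyDifferentiable.
Context {R : realType} {d : nat}.
Local Notation E := 'rV[R]_d.
Implicit Types (f : E -> R) (g : E -> E).

Definition C1_grad f g := [/\ forall x i, is_derive x (unit_row i) f (g x 0 i),
  continuous f & continuous g].

Lemma C11_C1_grad (G L M : R) f g : 0 <= L -> C11 setT G L f g ->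
  (forall x, `|f x| <= M) -> C1_grad f g.
Proof.
move=> L0 cf fM; split.
- by move=> x i; have := C11_is_derive x (unit_row i) cf; rewrite dotp_unit.
- have M0 : 0 <= M by exact: le_trans (fM 0).
  have G0 : 0 <= G by apply: le_trans (enorm_ge0 _) (C11_grad cf (x := 0) I).
  apply: (enorm_lip_continuous _ (C11_lipschitz L0 cf fM)).
  by rewrite !addr_ge0// mulr_ge0.
- move=> x; apply: (lip_continuous (M := L * d%:R)) => y.
  apply: (le_trans (normr_le_enorm _)); apply: (le_trans (C11_lip cf _ _)) => //.
  by rewrite -mulrA; apply: ler_wpM2l => //; exact: enorm_le_normr.
Qed.

Lemma C1_gradB f1 g1 f2 g2 : C1_grad f1 g1 -> C1_grad f2 g2 ->
  C1_grad (fun x => f1 x - f2 x) (fun x => g1 x - g2 x).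
Proof.
move=> [d1 c1 k1] [d2 c2 k2]; split.
- by move=> x i; rewrite !mxE; exact: (is_deriveB (f := f1) (g := f2)).
- by move=> x; exact: cvgB (c1 x) (c2 x).
- by move=> x; exact: cvgB (k1 x) (k2 x).
Qed.

Lemma C1_gradM f1 g1 f2 g2 : C1_grad f1 g1 -> C1_grad f2 g2 ->
  C1_grad (fun x => f1 x * f2 x) (fun x => f1 x *: g2 x + f2 x *: g1 x).
Proof.
move=> [d1 c1 k1] [d2 c2 k2]; split.
- by move=> x i; rewrite !mxE; exact: (is_deriveM (f := f1) (g := f2)).
- by move=> x; exact: cvgM (c1 x) (c2 x).
- by move=> x; exact: cvgD (cvgZ (c1 x) (k2 x)) (cvgZ (c2 x) (k1 x)).
Qed.

End ContinuouslyDifferentiable.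

(** [S] has to be uniform in k, while [C] may depend on the field and on V, because it only
    multiplies h. The last inequality is stated for every vector [w], which later is the value of
    the merely measurable field b. The window of [s] for the comparison with psi lies between one
    and two steps before n h. Booleans cast to numbers act as indicators. *)
Definition scheme_estimate {R : realType} {d : nat} (T r S C h : R) (n : nat)
    (psi : 'rV[R]_d -> R) (bk : 'rV[R]_d * R -> 'rV[R]_d) (V : 'rV[R]_d -> R)
    (u ut : 'rV[R]_d * R -> R) (ug : 'rV[R]_d * R -> 'rV[R]_d) : Prop :=
  [/\ test_function T u,
      [/\ continuous u, continuous ut & continuous ug],
      (forall z, ([set: 'rV[R]_d] `*` `[0, T[) z -> time_derive T u z = ut z) /\
      (forall z, space_grad u z = ug z),
      forall z, 2 * r <= enorm z.1 -> [/\ u z = 0, ut z = 0 & ug z = 0] &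
      (forall x s, n%:R * h - 2 * h <= s <= n%:R * h - h ->
        `|u (x, s) - psi x * cutoff r x| <= C * h) /\
      (forall x s w, 0 <= s <= n%:R * h - h ->
        `|ut (x, s) + dotp w (ug (x, s))| <=
        (enorm x < 2 * r)%R%:R * (C * h + 5 * Num.sqrt (S * V x) * enorm (bk (x, s) - w)) +
        (r < enorm x < 2 * r)%R%:R * (15 / r * enorm w))].

(** * The test function built from the Euler scheme *)

Section SchemeTest.
Context {R : realType} {d : nat}.
Local Notation E := 'rV[R]_d.
Local Notation ER := (E * R)%type.
Variables (T r r3 r4 h0 M c1 A0 G0 L0 : R).
Variables (psi : E -> R) (gpsi : E -> E).
Variables (bk B : ER -> E) (A : ER -> E -> E) (V : E -> R) (gV : E -> E).
Hypothesis T_ge0 : 0 <= T.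
Hypothesis r_gt0 : 0 < r.
Hypothesis r23 : 2 * r <= r3.
Hypothesis r34 : r3 <= r4.
Hypothesis G0_ge0 : 0 <= G0.
Hypothesis L0_ge0 : 0 <= L0.
Hypothesis M_ge0 : 0 <= M.
Hypothesis psi_C11 : C11 setT G0 L0 psi gpsi.
Hypothesis psi_le1 : forall x, `|psi x| <= 1.
Hypothesis FB : forall s, s \in `[0, T] -> field_bounds M (fun x => B (x, s)) (fun x => A (x, s)).
Hypothesis B_time : forall x s t, s \in `[0, T] -> t \in `[0, T] ->
  enorm (B (x, s) - B (x, t)) <= M * `|s - t|.
Hypothesis B_out : forall x s, ~ cball r3 x -> B (x, s) = 0 /\ forall v, A (x, s) v = 0.
Hypothesis B_in : forall x s, enorm x < 2 * r -> s \in `[0, T] -> B (x, s) = bk (x, s).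
Hypothesis V_gt0 : forall x, cball r4 x -> 0 < V x.
Hypothesis c1_ge0 : 0 <= c1.
Hypothesis dissipative : forall x s v, cball r3 x -> s \in `[0, T] ->
  enorm v ^+ 2 * dotp (B (x, s)) (gV x) + 2 * dotp (A (x, s) v) v * V x <=
  c1 * enorm v ^+ 2 * V x.
Hypothesis V_taylor : forall h x s, 0 <= h <= h0 -> cball r3 x -> s \in `[0, T] ->
  V (x + h *: B (x, s)) <= V x + h * dotp (B (x, s)) (gV x) + h * V x.
Hypothesis h0_small : [/\ h0 * M <= r4 - r3, h0 * M <= 1 &
  h0 * (M ^+ 2 + 3 * M * (c1 + 2 * M + 1)) <= 1].
Hypothesis A0_ge0 : 0 <= A0.
Hypothesis init : forall x, cball r4 x -> enorm (gpsi x) ^+ 2 <= A0 * V x.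

Let Ainf := A0 * expR (T * (c1 + 2)).

(** The derivative of u along (1, w) has three parts: phi times the defect of the scheme for B, of
    order h by [spline_residual]; phi times the transport by w - B, bounded by the Lyapunov estimate
    and |b_k - w| because B = b_k on the support of phi; and f <w, grad phi>, which lives on the
    annulus. *)
Lemma scheme_test : exists2 C : R, 0 <= C & forall (n : nat) (h : R),
  (2 <= n)%N -> 0 < h -> h <= h0 -> n%:R * h <= T ->
  exists u ut ug, scheme_estimate T r Ainf C h n psi bk V u ut ug.
Proof.
have [G [L [Gge0 Lge0 HC]]] := euler_C11 G0_ge0 L0_ge0 M_ge0 T_ge0 psi_C11.
pose C1 := L * M ^+ 2 + 2 * M * G + 3 * (M * (L * M + M * G)).
pose C2 := 2 * (G * M + L * M ^+ 2 * T).
have C1_0 : 0 <= C1 by rewrite !(addr_ge0, mulr_ge0, sqr_ge0).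
have C2_0 : 0 <= C2 by rewrite !(addr_ge0, mulr_ge0, sqr_ge0)//; exact: T_ge0.
exists (C1 + C2); first exact: addr_ge0.
move=> n h n2 hp hh0 nhT.
have hge0 := ltW hp.
have hT : h <= T.
  apply: le_trans nhT; rewrite ler_peMl// ler1n; exact: ltnW.
(* Node j lies j steps before the starting time n h. Indices beyond the scheme get the time 0, so
   that the bounds on the field hold for every j. *)
pose tm (j : nat) : R := if (j < n)%N then n%:R * h - j%:R * h else 0.
have tmT j : tm j \in `[0, T].
  rewrite /tm in_itv/=; case: ifP => jn; last by rewrite lexx T_ge0.
  have : j%:R * h <= n%:R * h by apply: ler_wpM2r => //; rewrite ler_nat ltnW.
  have : 0 <= j%:R * h by rewrite mulr_ge0.
  by move=> ? ?; apply/andP; split; lra.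
pose Bs j x := B (x, tm j); pose As j x := A (x, tm j).
have Fs j : field_bounds M (Bs j) (As j) := FB (tmT j).
(* The scheme is frozen after n steps, which makes its bounds valid for all indices. *)
pose F j := euler h Bs psi (minn j n).
pose g j := euler_grad h Bs As gpsi (minn j n).
have CF j : C11 setT G L (F j) (g j).
  by apply: (HC h Bs As n hge0 nhT Fs); exact: geq_minr.
have F1 j x : `|F j x| <= 1 by exact: euler_bound.
have incr j : (j < n)%N ->
  [/\ forall x, `|F j.+1 x - F j x - h * dotp (Bs j x) (g j x)| <= L * M ^+ 2 * h ^+ 2,
      forall x, `|F j.+1 x - F j x| <= (G * M + L * M ^+ 2 * T) * h &
      forall x, enorm (g j.+1 x - g j x) <= (L * M + M * G) * h].
  move=> jn; have := euler_increment hge0 hT Gge0 Lge0 (Fs j) (CF j).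
  by rewrite /F /g (minn_idPl (ltnW jn)) (minn_idPl jn).
have small : [/\ h * M <= r4 - r3, h * M <= 1 & h * (M ^+ 2 + 3 * M * (c1 + 2 * M + 1)) <= 1].
  have P0 : 0 <= M ^+ 2 + 3 * M * (c1 + 2 * M + 1).
    by rewrite !(addr_ge0, mulr_ge0, sqr_ge0)//; exact: c1_ge0.
  have [s1 s2 s3] := h0_small; split.
  - by apply: le_trans s1; apply: ler_wpM2r.
  - by apply: le_trans s2; apply: ler_wpM2r.
  - by apply: le_trans s3; apply: ler_wpM2r.
have [sm1 sm2 sm3] := small.
have lyap j x : cball r4 x -> enorm (g j x) <= Num.sqrt (Ainf * V x).
  move=> x4.
  have H : enorm (g j x) ^+ 2 <= A0 * (1 + h * (c1 + 2)) ^+ (minn j n) * V x.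
    apply: (euler_lyapunov (M := M) (r3 := r3) (r4 := r4) (gV := gV)) => //.
    - by move=> i y y3; exact: B_out.
    - by move=> i y v y3; exact: dissipative.
    - by move=> i y y3; apply: V_taylor => //; rewrite hge0.
  have -> : enorm (g j x) = Num.sqrt (enorm (g j x) ^+ 2) by rewrite sqrtr_sqr ger0_norm ?enorm_ge0.
  rewrite ler_sqrt; last first.
    by rewrite mulr_ge0 ?(ltW (V_gt0 x4))// mulr_ge0 ?expR_ge0.
  apply: (le_trans H); apply: ler_wpM2r; first exact/ltW/V_gt0.
  apply: ler_wpM2l => //.
  have c20 : 0 <= c1 + 2 by rewrite addr_ge0.
  apply: (@le_trans _ _ (expR (h * (c1 + 2)) ^+ minn j n)).
    by apply: lerXn2r; rewrite ?nnegrE ?expR_ge0 ?expR_ge1Dx// addr_ge0// mulr_ge0.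
  rewrite -expRM_natl ler_expR mulrA; apply: ler_wpM2r => //.
  apply: le_trans nhT; apply: ler_wpM2r => //; rewrite ler_nat; exact: geq_minr.
pose phi := cutoff (d := d) r; pose gphi := cutoff_grad (d := d) r.
have [Lp Lp0 Cphi] := cutoff_C11 (d := d) r_gt0.
have phi01 x : 0 <= phi x <= 1 by exact: cutoff_01.
have phi1 x : `|phi x| <= 1 by have /andP[? ?] := phi01 x; rewrite ger0_norm.
have D1phi : C1_grad phi gphi := C11_C1_grad Lp0 Cphi phi1.
have D1F j : C1_grad (F j) (g j) := C11_C1_grad Lge0 (CF j) (F1 j).
(* Increments rather than values: weighted by splines rising from 0 to 1 they rebuild the scheme
   from its start, which has index 0 and the constant weight 1. *)
pose P (j : nat) : E -> R := if j is k.+1 then fun x => phi x * (F k.+1 x - F k x)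
  else fun x => phi x * F 0%N x.
pose p (j : nat) : E -> E := if j is k.+1
  then fun x => phi x *: (g k.+1 x - g k x) + (F k.+1 x - F k x) *: gphi x
  else fun x => phi x *: g 0%N x + F 0%N x *: gphi x.
have D1P j : C1_grad (P j) (p j).
  case: j => [|k]; first exact: C1_gradM.
  exact: (C1_gradM (f2 := fun x => F k.+1 x - F k x) (g2 := fun x => g k.+1 x - g k x)
    D1phi (C1_gradB _ _)).
(* Backward time counted in steps, equal to 0 at s = n h. *)
pose tau s : R := (n%:R * h - s) / h.
pose c (j : nat) : R -> R := if j is k.+1 then fun s => spline (tau s - k%:R) else cst 1.
pose dc (j : nat) : R -> R := if j is k.+1 then fun s => hat (tau s - k%:R) * (- h^-1) else cst 0.
have tau_diff s t : tau t - tau s = - h^-1 * (t - s) by rewrite /tau; field; rewrite gt_eqF.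
have c_derive j (s : R) : is_derive s (1 : R) (c j) (dc j s).
  case: j => [|k]; first exact: is_derive_cst.
  apply: (@is_derive1_comp _ spline (fun s => tau s - k%:R)); first exact: is_derive_spline.
  apply: (is_derive_sqr (L := 0) ltr01) => e _; rewrite mul0r [e *: 1]mulr1.
  have := tau_diff s (e + s); rewrite addrK => td.
  have -> : tau (e + s) - k%:R - (tau s - k%:R) - e * - h^-1 = (tau (e + s) - tau s) + e * h^-1 by ring.
  by rewrite td mulNr mulrC addNr normr0.
have dc_cont j : continuous (dc j).
  case: j => [|k] s; first exact: cvg_cst.
  apply: (lip_continuous (M := 4 * h^-1 * h^-1)) => t.
  rewrite /= -mulrBl normrM normrN (gtr0_norm (_ : 0 < h^-1)) ?invr_gt0//.
  have e : tau t - k%:R - (tau s - k%:R) = - h^-1 * (t - s) by rewrite -tau_diff; ring.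
  have := hat_lip (tau s - k%:R) (tau t - k%:R).
  rewrite e normrM normrN (gtr0_norm (_ : 0 < h^-1)) ?invr_gt0// => hl.
  rewrite [leRHS]mulrAC; apply: ler_wpM2r; first by rewrite invr_ge0.
  by rewrite -mulrA.
have P_out j x : 2 * r < enorm x -> P j x = 0.
  move=> rx; have p0 : phi x = 0 by apply: cutoff_out => //; exact: ltW.
  by case: j => [|k]; rewrite /P p0 mul0r.
have P_derive j x i : is_derive x (unit_row i) (P j) (p j x 0 i) by have [] := D1P j.
have P_cont j : continuous (P j) by have [] := D1P j.
have p_cont j : continuous (p j) by have [] := D1P j.
pose u := separated n.+1 c P; pose ut := separated_time n.+1 dc P; pose ug := separated_grad n.+1 c p.
pose f x s := F 0%N x + \sum_(j < n) spline (tau s - j%:R) * (F j.+1 x - F j x).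
have uE x s : u (x, s) = phi x * f x s.
  rewrite /u /separated big_ord_recl /= mul1r /f mulrDr mulr_sumr; congr (_ + _).
  by apply: eq_bigr => j _; rewrite mulrCA.
have utE x s : ut (x, s) = phi x * (- h^-1 * \sum_(j < n) hat (tau s - j%:R) * (F j.+1 x - F j x)).
  rewrite /ut /separated_time big_ord_recl /= mul0r add0r mulr_sumr mulr_sumr.
  by apply: eq_bigr => j _; ring.
have ugE x s w : dotp w (ug (x, s)) =
    phi x * (dotp w (g 0%N x) + \sum_(j < n) spline (tau s - j%:R) * (dotp w (g j.+1 x) - dotp w (g j x))) +
    f x s * dotp w (gphi x).
  have dsum (I : finType) (q : I -> E) : dotp w (\sum_i q i) = \sum_i dotp w (q i).
    by apply: (big_morph (dotp w) (dotpDr w) (dotp0r w)).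
  rewrite /ug /separated_grad dsum big_ord_recl /= dotpZr mul1r dotpDr [dotp w (phi x *: _)]dotpZr [dotp w (F 0%N x *: _)]dotpZr /f.
  rewrite [X in _ + X = _](_ : _ = phi x * (\sum_(j < n) spline (tau s - j%:R) * (dotp w (g j.+1 x) - dotp w (g j x))) +
    (\sum_(j < n) spline (tau s - j%:R) * (F j.+1 x - F j x)) * dotp w (gphi x)); last first.
    rewrite mulr_sumr mulr_suml -big_split/=; apply: eq_bigr => j _.
    by rewrite dotpZr dotpDr !dotpZr dotpBr; ring.
  ring.
have tau_range s : 0 <= s <= n%:R * h - h -> 1 <= tau s <= n%:R.
  move=> /andP[s0 s1]; rewrite /tau ler_pdivlMr// ler_pdivrMr//; apply/andP; split; lra.
exists u, ut, ug; split.
- exact: (@separated_test R d T n.+1 c dc P p (2 * r) c_derive dc_cont P_derive P_cont p_cont P_out).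
- split.
  + exact: (continuous_separated c_derive P_cont).
  + exact: (continuous_separated_time dc_cont P_cont).
  + exact: (continuous_separated_grad c_derive p_cont).
- split.
  + by move=> z Qz; rewrite /u /ut (time_derive_separated n.+1 P c_derive Qz).
  + by move=> z; exact: (space_grad_separated _ _ P_derive).
- move=> [x s] /= rx.
  have p0 : phi x = 0 by exact: cutoff_out.
  have g0 : gphi x = 0 by apply: cutoff_grad_out => //; rewrite negb_and -!leNgt rx orbT.
  split; first by rewrite uE p0 mul0r.
    by rewrite utE p0 mul0r.
  apply: big1 => j _ /=; case: (nat_of_ord j) => [|k] /=.
    by rewrite p0 g0 scale0r !scaler0 addr0 scaler0.
  by rewrite p0 g0 scale0r !scaler0 addr0 scaler0.
- split.
  + move=> x s /andP[s1 s2].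
    have tr : 1 <= tau s <= 2.
      by rewrite /tau ler_pdivlMr// ler_pdivrMr//; apply/andP; split; lra.
    have F0 : F 0%N x = psi x by rewrite /F min0n.
    have := spline_sum_first (b := fun j => F j x) n2 tr (fun j jn => let: And3 _ q _ := incr j jn in q x).
    rewrite uE /f F0 => hb.
    have -> : phi x * (psi x + \sum_(j < n) spline (tau s - j%:R) * (F j.+1 x - F j x)) - psi x * cutoff r x =
      phi x * \sum_(j < n) spline (tau s - j%:R) * (F j.+1 x - F j x) by rewrite /phi; ring.
    rewrite normrM; apply: (@le_trans _ _ (1 * (2 * ((G * M + L * M ^+ 2 * T) * h)))).
      by apply: ler_pM.
    have : 0 <= C1 * h by rewrite mulr_ge0.
    rewrite /C2; lra.
  + move=> x s w sr; have tr := tau_range s sr.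
    have sT : s \in `[0, T].
      by case/andP: sr => ? ?; rewrite in_itv/=; apply/andP; split; lra.
    have [rx|rx] := ltP (enorm x) (2 * r); last first.
      have p0 : phi x = 0 by exact: cutoff_out.
      have g0 : gphi x = 0 by apply: cutoff_grad_out => //; rewrite negb_and -!leNgt rx orbT.
      by rewrite utE ugE p0 g0 dotp0r !mul0r mulr0 !addr0 normr0 andbF mul0r.
    have x4 : cball r4 x by rewrite /cball/=; have := r23; have := r34; lra.
    have f5 : `|f x s| <= 5 * 1.
      by apply: (spline_sum_bound (b := fun j => F j x)) => // j _.
    set Sw := 5 * Num.sqrt (Ainf * V x) * enorm (bk (x, s) - w).
    (* The vector w is written as B + (w - B): the transport by B nearly cancels the time
       derivative, and w - B is the approximation error. *)
    pose beta j := dotp (B (x, s)) (g j x).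
    pose gamma j := dotp (w - B (x, s)) (g j x).
    have gB : `|gamma 0%N + \sum_(j < n) spline (tau s - j%:R) * (gamma j.+1 - gamma j)| <= Sw.
      rewrite /Sw -mulrA; apply: spline_sum_bound => // j _.
      apply: (le_trans (normr_dotp _ _)); rewrite mulrC enormB B_in//.
      by apply: ler_wpM2r; [exact: enorm_ge0|exact: lyap].
    have bB : `|- h^-1 * (\sum_(j < n) hat (tau s - j%:R) * (F j.+1 x - F j x)) +
        (beta 0%N + \sum_(j < n) spline (tau s - j%:R) * (beta j.+1 - beta j))| <= C1 * h.
      have -> : C1 * h = (L * M ^+ 2 + 2 * M * G) * h + 3 * (M * ((L * M + M * G) * h)) by rewrite /C1; ring.
      apply: (spline_residual (a := fun j => F j.+1 x - F j x)) => //.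
      - by rewrite !(addr_ge0, mulr_ge0).
      - move=> j jn tj; have [i1 _ _] := incr j jn.
        have -> : h^-1 * (F j.+1 x - F j x) - beta j =
          h^-1 * (F j.+1 x - F j x - h * dotp (Bs j x) (g j x)) + dotp (Bs j x - B (x, s)) (g j x).
          by rewrite dotpBl /beta; field; rewrite gt_eqF.
        apply: (le_trans (ler_normD _ _)); rewrite mulrDl; apply: lerD.
          rewrite normrM gtr0_norm ?invr_gt0// ler_pdivrMl//.
          by apply: (le_trans (i1 x)); rewrite [h ^+ 2]expr2 mulrA [leRHS]mulrC.
        apply: (le_trans (normr_dotp _ _)).
        have q1 : enorm (Bs j x - B (x, s)) <= M * (h * 2).
          apply: (le_trans (B_time _ (tmT j) sT)); apply: ler_wpM2l => //.
          have -> : tm j - s = h * (tau s - j%:R).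
            by rewrite /tm jn /tau; field; rewrite gt_eqF.
          by rewrite normrM gtr0_norm//; apply: ler_wpM2l.
        have -> : 2 * M * G * h = (M * (h * 2)) * G by ring.
        apply: ler_pM => //; rewrite ?enorm_ge0//; exact: C11_grad (CF j) _ _.
      - move=> j jn; have [_ _ i3] := incr j jn.
        rewrite /beta -dotpBr; apply: (le_trans (normr_dotp _ _)).
        by apply: ler_pM; rewrite ?enorm_ge0//; exact: field_bound (FB sT) _.
    have -> : ut (x, s) + dotp w (ug (x, s)) =
      phi x * ((- h^-1 * (\sum_(j < n) hat (tau s - j%:R) * (F j.+1 x - F j x)) +
        (beta 0%N + \sum_(j < n) spline (tau s - j%:R) * (beta j.+1 - beta j))) +
      (gamma 0%N + \sum_(j < n) spline (tau s - j%:R) * (gamma j.+1 - gamma j))) +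
      f x s * dotp w (gphi x).
      rewrite utE ugE addrA; congr (_ + _); rewrite -mulrDr; congr (_ * _).
      rewrite -!addrA; congr (_ + _).
      have -> : \sum_(j < n) spline (tau s - j%:R) * (gamma j.+1 - gamma j) =
        \sum_(j < n) spline (tau s - j%:R) * (dotp w (g j.+1 x) - dotp w (g j x)) -
        \sum_(j < n) spline (tau s - j%:R) * (beta j.+1 - beta j).
        by rewrite -sumrB; apply: eq_bigr => j _; rewrite /gamma /beta !dotpBl; ring.
      by rewrite /gamma dotpBl -/(beta 0%N); ring.
    rewrite andbT mul1r.
    have t3 : `|f x s * dotp w (gphi x)| <= (r < enorm x)%R%:R * (15 / r * enorm w).
      have [rx1|rx1] := ltP r (enorm x); last first.
        rewrite /gphi cutoff_grad_out//; last by rewrite negb_and -leNgt rx1.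
        by rewrite dotp0r mulr0 normr0 mul0r.
      rewrite mul1r normrM (_ : 15 / r * enorm w = (5 * 1) * (enorm w * (3 / r))); last by ring.
      apply: ler_pM => //; apply: (le_trans (normr_dotp _ _)); apply: ler_wpM2l; first exact: enorm_ge0.
      exact: cutoff_grad_le.
    apply: (le_trans (ler_normD _ _)); apply: lerD => //.
    rewrite normrM; apply: (@le_trans _ _ (1 * (C1 * h + Sw))).
      by apply: ler_pM => //; apply: (le_trans (ler_normD _ _)); apply: lerD.
    have : 0 <= C2 * h by rewrite mulr_ge0.
    by rewrite mul1r [(C1 + C2) * h]mulrDl => ?; rewrite lerD2r lerDl.
Qed.

End SchemeTest.

Section FieldFromCoordinates.
Context {R : realType} {d : nat}.
Local Notation E := 'rV[R]_d.

Lemma enorm_sum_le (I : finType) (v : I -> E) : enorm (\sum_i v i) <= \sum_i enorm (v i).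
Proof.
elim/big_ind2: _ => [|x a y b xa yb|//]; first by rewrite enorm0.
by apply: (le_trans (enormD _ _)); exact: lerD.
Qed.

Lemma dotp_sumr (I : finType) (w : E) (v : I -> E) :
  dotp w (\sum_i v i) = \sum_i dotp w (v i).
Proof. exact: (big_morph (dotp w) (dotpDr w) (dotp0r w)). Qed.

(** Coordinatewise bounds are summed, whence the factor d; 3 G + L is the Lipschitz constant G + L +
    2 G of [C11_lipschitz], which is large enough for the other estimates as well. *)
Lemma C11_field_bounds (G L : R) (B : E -> E) (J : 'I_d -> E -> E) : 0 <= G -> 0 <= L ->
  (forall i, C11 setT G L (fun x => B x 0 i) (J i)) ->
  (forall i x, `|B x 0 i| <= G) ->
  field_bounds (d%:R * (3 * G + L)) B (fun x v => \sum_i v 0 i *: J i x).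
Proof.
move=> G0 L0 CB BG.
have dE (c : R) : d%:R * c = \sum_(i < d) c by rewrite sumr_const card_ord mulr_natl.
have d0 : 0 <= d%:R :> R by [].
have M1 : d%:R * G <= d%:R * (3 * G + L) by apply: ler_wpM2l => //; lra.
have M2 : d%:R * L <= d%:R * (3 * G + L) by apply: ler_wpM2l => //; lra.
have ML : d%:R * (G + L + 2 * G) <= d%:R * (3 * G + L) by apply: ler_wpM2l => //; lra.
split.
- move=> x; apply: (le_trans (ler_enorm_sum _)); apply: le_trans M1.
  by rewrite dE; apply: ler_sum => i _; exact: BG.
- move=> x y; apply: (le_trans (ler_enorm_sum _)); apply: (@le_trans _ _ (d%:R * (G + L + 2 * G) * enorm (y - x))).
    rewrite -mulrA dE; apply: ler_sum => i _; rewrite [X in `|X|]mxE [X in _ + X]mxE.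
    exact: (C11_lipschitz L0 (CB i) (BG i)).
  by rewrite ler_wpM2r ?enorm_ge0.
- by move=> x v w; rewrite -sumrB; apply: eq_bigr => i _; rewrite !mxE scalerBl.
- move=> x v; apply: (le_trans (enorm_sum_le _)); apply: (@le_trans _ _ (d%:R * G * enorm v)).
    rewrite -mulrA dE; apply: ler_sum => i _; rewrite enormZ mulrC.
    by apply: ler_pM; rewrite ?enorm_ge0//; [exact: C11_grad (CB i) _ _|exact: coord_le_enorm].
  by rewrite ler_wpM2r ?enorm_ge0.
- move=> x y v; rewrite -sumrB; apply: (le_trans (enorm_sum_le _)).
  apply: (@le_trans _ _ (d%:R * L * enorm v * enorm (y - x))).
    rewrite -!mulrA dE; apply: ler_sum => i _; rewrite -scalerBr enormZ mulrCA.
    apply: ler_pM; rewrite ?enorm_ge0//; first exact: coord_le_enorm.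
    exact: C11_lip (CB i) _ _ _ _.
  by rewrite ler_wpM2r ?enorm_ge0// ler_wpM2r ?enorm_ge0.
- move=> x y v.
  have -> : dotp v (B y - B x) - dotp (\sum_i v 0 i *: J i x) (y - x) =
      \sum_i v 0 i * (B y 0 i - B x 0 i - dotp (J i x) (y - x)).
    rewrite dotpC [dotp _ (y - x)]dotpC dotp_sumr /dotp -sumrB; apply: eq_bigr => i _.
    rewrite !mxE mulrBr; congr (_ - _); first by rewrite mulrC.
    by rewrite mulr_sumr; apply: eq_bigr => j _; rewrite !mxE; ring.
  apply: (le_trans (ler_norm_sum _ _ _)).
  apply: (@le_trans _ _ (d%:R * L * enorm v * enorm (y - x) ^+ 2)).
    rewrite -!mulrA dE; apply: ler_sum => i _; rewrite normrM mulrCA.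
    apply: ler_pM => //; first exact: coord_le_enorm.
    exact: C11_taylor (CB i) _ _ _ _.
  by rewrite ler_wpM2r ?sqr_ge0// ler_wpM2r ?enorm_ge0.
Qed.

Lemma le_max_form (P : 'M[R]_d) (v : E) :
  dotp (v *m P^T) v <= max_form P * enorm v ^+ 2.
Proof.
have [v0|v0] := eqVneq (enorm v) 0.
  by rewrite v0 expr0n mulr0 (enorm_eq0 v0) dotp0r.
have vp : 0 < enorm v by rewrite lt_neqAle eq_sym v0 enorm_ge0.
(* [sup] is informative only for a set bounded above; the sum of the absolute values of the entries
   bounds the form on the unit sphere. *)
have bnd : has_ubound [set dotp (xi *m P^T) xi | xi in [set xi : E | enorm xi = 1]].
  exists (\sum_j \sum_i `|P j i|) => _ [xi /= xi1 <-]; rewrite /dotp.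
  apply: (le_trans (ler_norm _)); apply: (le_trans (ler_norm_sum _ _ _)); apply: ler_sum => j _.
  have c1 i : `|xi 0 i| <= 1 by rewrite -xi1 coord_le_enorm.
  rewrite normrM mxE; apply: (@le_trans _ _ ((\sum_i `|P j i|) * 1)); last by rewrite mulr1.
  apply: ler_pM => //; apply: (le_trans (ler_norm_sum _ _ _)); apply: ler_sum => i _.
  by rewrite normrM mxE ler_piMl.
pose xi := (enorm v)^-1 *: v.
have vE : v = enorm v *: xi by rewrite scalerA mulfV// scale1r.
have xi1 : enorm xi = 1 by rewrite enormZ gtr0_norm ?invr_gt0// mulVf.
have H : dotp (xi *m P^T) xi <= max_form P by apply: (ub_le_sup bnd); exists xi.
rewrite {1 2}vE -scalemxAl dotpZl dotpZr mulrA -expr2 mulrC.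
by apply: ler_wpM2r => //; exact: sqr_ge0.
Qed.

End FieldFromCoordinates.

Lemma taylor_algebra (R : realType) (a b h u v w : R) :
  a - b = h * u -> h * (u - v) <= h * w -> a <= b + h * v + h * w.
Proof. by move=> *; lra. Qed.

Lemma sum_bounds (R : realType) (a b c : R) : 0 <= a -> 0 <= b -> 0 <= c ->
  [/\ 0 < a + b + c + 1, a <= a + b + c + 1 & b + c <= a + b + c + 1].
Proof. by move=> *; split; lra. Qed.

(** The end of the dissipativity proof, kept on bare variables for the arithmetic. [et] stands for
    th^2, [t] for th, [e] for <b_k, grad V>, [a] for the quadratic form of the Jacobian of b_k at v,
    [m] for its maximum on the unit sphere, [B] for |b_k|^2, [b] for <grad th, v>, [c] for <b_k, v>,
    [n] for |v|^2, [D] and [de] for the constants C and delta of (ii), and [k] for the price of the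
    cut-off. The terms in [m] and in [de] cancel. *)
Lemma dissipative_algebra (R : realType) (de D a b c e k V et m B n t : R) :
  n * (et * e) <= n * (et * ((D - de * B - 2 * m) * V)) ->
  et * a * V <= et * (m * n) * V ->
  4 * (t * b) * c * V <= (de * (et * B) + k) * n * V ->
  et * (D * (n * V)) <= D * (n * V) ->
  n * (et * e) + 2 * (et * a + 2 * (t * b) * c) * V <= (D + k) * n * V.
Proof. by move=> *; lra. Qed.

(** * Localisation of the approximating field *)

Section LocalScheme.
Context {R : realType} {d : nat}.
Local Notation E := 'rV[R]_d.
Local Notation ER := (E * R)%type.
Variables (T r C delta v0 G0 L0 : R) (psi : E -> R) (gpsi : E -> E).
Variables (bk : ER -> E) (V : E -> R).
Hypothesis T_ge0 : 0 <= T.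
Hypothesis r_gt0 : 0 < r.
Hypothesis C_gt0 : 0 < C.
Hypothesis delta_gt0 : 0 < delta.
Hypothesis v0_gt0 : 0 < v0.
Hypothesis G0_ge0 : 0 <= G0.
Hypothesis L0_ge0 : 0 <= L0.
Hypothesis psi_C11 : C11 setT G0 L0 psi gpsi.
Hypothesis psi_le1 : forall x, `|psi x| <= 1.
Let U : set E := eball 0 (6 * r).
Hypothesis bk_smooth : class_Coo (U `*` setT) bk.
Hypothesis V_smooth : class_C 1 U V.
Hypothesis V_ge : forall x, U x -> v0 <= V x.
Hypothesis lyapunov : forall x t, U x -> t \in `[0, T] ->
  dotp (bk (x, t)) (grad V x) <=
  (C - delta * enorm (bk (x, t)) ^+ 2 - 2 * max_form (partials (fun y => bk (y, t)) x)) * V x.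

(** Nothing here depends on k. The second summand is the price of the cut-off th of radius 2 r: 3 /
    (2 r) + 1 bounds its gradient, and the factor 4 / delta comes from Young's inequality against
    the reserve delta |b_k|^2. *)
Definition scheme_rate (r C delta : R) : R := C + 4 * (3 / (2 * r) + 1) ^+ 2 / delta.

(** Four radii are nested: the test function ends at 2 r, up to where [th] = 1; [th] vanishes from 4
    r on; Euler steps from there stay within 5 r; and the closed ball of radius 5 r is a compact
    subset of the open ball of radius 6 r on which the data are regular. *)
Lemma local_scheme : exists C' h0 : R, [/\ 0 <= C', 0 < h0 & forall (n : nat) (h : R),
  (2 <= n)%N -> 0 < h -> h <= h0 -> n%:R * h <= T ->
  exists u ut ug, scheme_estimate T r
    (G0 ^+ 2 / v0 * expR (T * (scheme_rate r C delta + 2))) C' h n psi bk V u ut ug].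
Proof.
have rW := ltW r_gt0.
have oU : open U by exact: open_eball.
have KU : cball (5 * r) `<=` U.
  move=> x; rewrite /cball /U /eball/= subr0 => /le_lt_trans; apply.
  by rewrite ltr_pM2r// ltr_nat.
have oW : open (U `*` [set: R]).
  rewrite (_ : U `*` _ = fst @^-1` U); first by apply: open_comp => // z _; exact: cvg_fst.
  by apply/seteqP; split => z /=; [case|].
have r2 : 0 < 2 * r by rewrite mulr_gt0.
pose th := cutoff (d := d) (2 * r); pose gth := cutoff_grad (d := d) (2 * r).
pose Gt := 3 / (2 * r) + 1.
have Gt1 : 1 <= Gt by rewrite lerDr divr_ge0// ltW.
have Gt0 : 0 <= Gt by exact: le_trans ler01 Gt1.
have [Lt Lt0 Cth] := cutoff_C11 (d := d) r2.
have th01 x : 0 <= th x <= 1 by exact: cutoff_01.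
have th_out x : ~ cball (4 * r) x -> th x = 0.
  rewrite /cball/= => /negP; rewrite -ltNge => h; apply: cutoff_out => //; lra.
have comp i : class_Coo (U `*` [set: R]) (fun z => bk z 0 i).
  by move=> n; apply: class_C_coord.
have Hb i : exists M : R, 0 <= M /\ forall t, t \in `[0, T] ->
   [/\ C11 (cball (5 * r)) M M (fun x => bk (x, t) 0 i) (grad (fun x => bk (x, t) 0 i)),
     forall x, cball (5 * r) x -> `|bk (x, t) 0 i| <= M &
     forall x s, cball (5 * r) x -> s \in `[0, T] -> `|bk (x, s) 0 i - bk (x, t) 0 i| <= M * `|s - t|].
  by have [M M0 HM] := smooth_field_C11 oU T KU (comp i); exists M.
pose Mi i := projT1 (cid (Hb i)).
have Mi0 i : 0 <= Mi i by have [] := projT2 (cid (Hb i)).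
have HM i := (projT2 (cid (Hb i))).2.
pose Mb := Gt + Lt + \sum_i Mi i.
have SM : 0 <= \sum_i Mi i by rewrite sumr_ge0.
have Mb0 : 0 <= Mb by rewrite addr_ge0// addr_ge0.
have MiMb i : Mi i <= Mb.
  apply: (@le_trans _ _ (\sum_i Mi i)); last by rewrite /Mb lerDr addr_ge0.
  by rewrite (bigD1 i)//= lerDl sumr_ge0.
have r5 : 0 <= 5 * r by rewrite mulr_ge0.
have Cth5 : C11 (cball (5 * r)) Mb Mb th gth.
  have [a1 a2 a3] := Cth; split.
  - by move=> x _; apply: (le_trans (a1 x I)); rewrite /Mb -/Gt -addrA lerDl addr_ge0.
  - move=> x y _ _; apply: (le_trans (a2 x y I I)); apply: ler_wpM2r; first exact: sqr_ge0.
    by rewrite /Mb; lra.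
  - move=> x y _ _; apply: (le_trans (a3 x y I I)); apply: ler_wpM2r; first exact: enorm_ge0.
    by rewrite /Mb; lra.
have thMb x : cball (5 * r) x -> `|th x| <= Mb.
  move=> _; have /andP[t0 t1] := th01 x; rewrite ger0_norm//.
  by apply: (le_trans t1); apply: (le_trans Gt1); rewrite /Mb -addrA lerDl addr_ge0.
have [M1 M10 H1] := C11_mul (d := d) r5 Mb0.
have [eM eC] := H1 _ _ _ _ Cth5 Cth5 thMb thMb.
pose M2 := M1 + Mb; have M20 : 0 <= M2 by rewrite addr_ge0.
have M12 : M1 <= M2 by rewrite lerDl.
have Mb2 : Mb <= M2 by rewrite lerDr.
have [M3 M30 H3] := C11_mul (d := d) r5 M20.
pose eta x := th x * th x.
pose geta x := th x *: gth x + th x *: gth x.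
pose B (z : ER) : E := eta z.1 *: bk z.
pose J (i : 'I_d) t x := eta x *: grad (fun y => bk (y, t) 0 i) x + bk (x, t) 0 i *: geta x.
have prodC i t : t \in `[0, T] ->
  (forall x, cball (5 * r) x -> `|B (x, t) 0 i| <= M3) /\
  C11 (cball (5 * r)) M3 M3 (fun x => B (x, t) 0 i) (J i t).
  move=> tT; have [c1 c2 _] := HM i t tT.
  have le2 := le_trans (MiMb i) Mb2.
  have := H3 _ _ _ _ (C11_weaken M12 M12 eC) (C11_weaken le2 le2 c1)
    (fun x xr => le_trans (eM x xr) M12) (fun x xr => le_trans (c2 x xr) le2).
  have -> : (fun x => th x * th x * bk (x, t) 0 i) = (fun x => B (x, t) 0 i).
    by apply/funext => x; rewrite /B mxE.
  move=> [b1 b2]; split => // x xr.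
  by have := b1 x xr; rewrite /B mxE.
have r45 : 4 * r < 5 * r by rewrite ltr_pM2r// ltr_nat.
pose L4 := M3 + M3 / (5 * r - 4 * r) + M3 / (5 * r - 4 * r) ^+ 2.
have L40 : 0 <= L4.
  have p0 : 0 <= 5 * r - 4 * r by rewrite subr_ge0 ltW.
  by rewrite !addr_ge0// divr_ge0// sqr_ge0.
have out i x t : ~ cball (4 * r) x -> B (x, t) 0 i = 0 /\ J i t x = 0.
  move=> /th_out t0; split; first by rewrite /B mxE /eta t0 mul0r mul0r.
  by rewrite /J /geta /eta t0 mulr0 !scale0r addr0 scaler0 addr0.
have CB i t : t \in `[0, T] -> C11 setT M3 L4 (fun x => B (x, t) 0 i) (J i t).
  move=> tT; have [b1 b2] := prodC i t tT.
  by apply: (C11_extend r45 M30 M30 b2 b1) => x; exact: out.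
have BM i t : t \in `[0, T] -> forall x, `|B (x, t) 0 i| <= M3.
  move=> tT x; have [xr|xr] := pselect (cball (5 * r) x).
    by have [b1 _] := prodC i t tT; exact: b1.
  have x4 : ~ cball (4 * r) x by move=> x4; apply: xr; apply: le_trans x4 (ltW r45).
  by rewrite (out i x t x4).1 normr0.
(* The first summand serves the estimates in space, the second the Lipschitz bound in time. *)
pose M := d%:R * (3 * M3 + L4) + \sum_i Mi i.
have M0 : 0 <= M by rewrite addr_ge0// mulr_ge0// addr_ge0// mulr_ge0.
pose A (z : ER) (v : E) : E := \sum_i v 0 i *: J i z.2 z.1.
have FB s : s \in `[0, T] -> field_bounds M (fun x => B (x, s)) (fun x => A (x, s)).
  move=> sT; have [a1 a2 a3 a4 a5 a6] := C11_field_bounds M30 L40 (fun i => CB i s sT) (fun i => BM i s sT).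
  have le : d%:R * (3 * M3 + L4) <= M by rewrite lerDl.
  split.
  - by move=> x; apply: le_trans (a1 x) le.
  - by move=> x y; apply: le_trans (a2 x y) _; rewrite ler_wpM2r ?enorm_ge0.
  - exact: a3.
  - by move=> x v; apply: le_trans (a4 x v) _; rewrite ler_wpM2r ?enorm_ge0.
  - by move=> x y v; apply: le_trans (a5 x y v) _; rewrite ler_wpM2r ?enorm_ge0// ler_wpM2r ?enorm_ge0.
  - by move=> x y v; apply: le_trans (a6 x y v) _; rewrite ler_wpM2r ?sqr_ge0// ler_wpM2r ?enorm_ge0.
have Bt x s t : s \in `[0, T] -> t \in `[0, T] ->
    enorm (B (x, s) - B (x, t)) <= M * `|s - t|.
  move=> sT tT; have Mst : 0 <= M * `|s - t| by rewrite mulr_ge0.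
  have [xr|xr] := pselect (cball (4 * r) x); last first.
    have t0 := th_out x xr; rewrite /B /eta /= t0 mul0r !scale0r subr0.
    by rewrite enorm0.
  have x5 : cball (5 * r) x by apply: le_trans xr (ltW r45).
  have /andP[e0 e1] : 0 <= eta x <= 1.
    by have /andP[? ?] := th01 x; rewrite mulr_ge0//= mulr_ile1.
  rewrite /B /= -scalerBr enormZ ger0_norm//; apply: (@le_trans _ _ (1 * enorm (bk (x, s) - bk (x, t)))).
    by rewrite ler_wpM2r ?enorm_ge0.
  rewrite mul1r; apply: (le_trans (ler_enorm_sum _)).
  apply: (@le_trans _ _ ((\sum_i Mi i) * `|s - t|)).
    rewrite mulr_suml; apply: ler_sum => i _; rewrite [X in `|X|]mxE [X in _ + X]mxE.
    by have [_ _ h] := HM i t tT; exact: h.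
  apply: ler_wpM2r => //; rewrite /M lerDr mulr_ge0// addr_ge0// mulr_ge0//.
have B_out x s : ~ cball (4 * r) x -> B (x, s) = 0 /\ forall v, A (x, s) v = 0.
  move=> xr; split; first by apply/rowP => i; rewrite (out i x s xr).1 mxE.
  by move=> v; rewrite /A big1// => i _; rewrite (out i x s xr).2 scaler0.
have B_in x s : enorm x < 2 * r -> s \in `[0, T] -> B (x, s) = bk (x, s).
  by move=> xr _; rewrite /B /eta /= /th cutoff_in ?mulr1 ?scale1r// ltW.
have V_gt0 x : cball (5 * r) x -> 0 < V x.
  by move=> /KU /V_ge; exact: lt_le_trans.
have c10 : 0 <= scheme_rate r C delta.
  by rewrite addr_ge0 ?(ltW C_gt0)// divr_ge0 ?(ltW delta_gt0)// mulr_ge0// sqr_ge0.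
have diss x s v : cball (4 * r) x -> s \in `[0, T] ->
  enorm v ^+ 2 * dotp (B (x, s)) (grad V x) + 2 * dotp (A (x, s) v) v * V x <=
  scheme_rate r C delta * enorm v ^+ 2 * V x.
  move=> xr sT; have Ux : U x by apply: KU; apply: le_trans xr (ltW r45).
  have Vp : 0 < V x by exact: lt_le_trans (V_ge Ux).
  set mf := max_form (partials (fun y => bk (y, s)) x).
  set b2 := enorm (bk (x, s)) ^+ 2; set N := enorm v ^+ 2.
  have N0 : 0 <= N by exact: sqr_ge0.
  have /andP[t0 t1] := th01 x.
  have AE : dotp (A (x, s) v) v = eta x * dotp (v *m (partials (fun y => bk (y, s)) x)^T) v +
      2 * (th x * dotp (gth x) v) * dotp (bk (x, s)) v.
    rewrite /A dotpC dotp_sumr /=.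
    rewrite (eq_bigr (fun i => eta x * (v 0 i * dotp v (grad (fun y => bk (y, s) 0 i) x)) +
      2 * (th x * dotp (gth x) v) * (bk (x, s) 0 i * v 0 i))); last first.
      move=> i _; rewrite /J /geta; move: (gth x) => gx.
      by rewrite dotpZr dotpDr !dotpZr dotpDr !dotpZr (dotpC v gx); ring.
    rewrite big_split/= -!mulr_sumr; congr (_ * _ + _).
    rewrite /dotp; under [RHS]eq_bigr do rewrite mxE mulr_suml.
    rewrite exchange_big/=; apply: eq_bigr => i _; rewrite mulr_sumr.
    by apply: eq_bigr => j _; rewrite !mxE; ring.
  have h1 : dotp (v *m (partials (fun y => bk (y, s)) x)^T) v <= mf * N by exact: le_max_form.
  have g1 : enorm (gth x) <= Gt by exact: C11_grad Cth _ _.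
  have h2 : 4 * (th x * dotp (gth x) v) * dotp (bk (x, s)) v <=
      (delta * (eta x * b2) + 4 * Gt ^+ 2 / delta) * N.
    have k1 : `|(th x * dotp (gth x) v) * dotp (bk (x, s)) v| <= (th x * enorm (bk (x, s))) * Gt * N.
      rewrite !normrM (ger0_norm t0) -!mulrA; apply: ler_wpM2l => //.
      apply: (@le_trans _ _ ((Gt * enorm v) * (enorm (bk (x, s)) * enorm v))).
        apply: ler_pM => //; last exact: normr_dotp.
        by apply: (le_trans (normr_dotp _ _)); rewrite ler_wpM2r ?enorm_ge0.
      by rewrite /N le_eqVlt; apply/orP; left; apply/eqP; ring.
    (* AM-GM for [th |b|] and [Gt] with weight [delta] *)
    have k2 : 4 * ((th x * enorm (bk (x, s))) * Gt) <= delta * (eta x * b2) + 4 * Gt ^+ 2 / delta.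
      have := sqr_ge0 (delta * (th x * enorm (bk (x, s))) - 2 * Gt).
      rewrite -(pmulr_rge0 _ (_ : 0 < delta^-1)) ?invr_gt0// => h.
      rewrite -subr_ge0; apply: le_trans h _; rewrite le_eqVlt; apply/orP; left; apply/eqP.
      by rewrite /b2 /eta; field; rewrite gt_eqF.
    rewrite -[4 * _ * _]mulrA; apply: (@le_trans _ _ (4 * ((th x * enorm (bk (x, s))) * Gt * N))).
      by rewrite ler_wpM2l// (le_trans (ler_norm _)).
    by rewrite mulrA; apply: ler_wpM2r.
  have h3 := lyapunov Ux sT; rewrite -/mf -/b2 in h3.
  have e0 : 0 <= eta x by rewrite mulr_ge0.
  have e1 : eta x <= 1 by rewrite mulr_ile1.
  have i1 : N * (eta x * dotp (bk (x, s)) (grad V x)) <= N * (eta x * ((C - delta * b2 - 2 * mf) * V x)).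
    by apply: ler_wpM2l => //; apply: ler_wpM2l.
  have i2 : eta x * dotp (v *m (partials (fun y => bk (y, s)) x)^T) v * V x <= eta x * (mf * N) * V x.
    by apply: ler_wpM2r; [exact: ltW|exact: ler_wpM2l].
  have i3 : 4 * (th x * dotp (gth x) v) * dotp (bk (x, s)) v * V x <=
      (delta * (eta x * b2) + 4 * Gt ^+ 2 / delta) * N * V x.
    by apply: ler_wpM2r => //; exact: ltW.
  have i4 : eta x * (C * (N * V x)) <= C * (N * V x).
    by rewrite ler_piMl// mulr_ge0 ?(ltW C_gt0)// mulr_ge0// ltW.
  rewrite AE {1}/B dotpZl /scheme_rate -/Gt /=.
  exact: dissipative_algebra i1 i2 i3 i4.
have [q q0 Hq] : exists2 q : R, 0 < q & forall h x s, 0 <= h <= q -> h * M <= r -> cball (4 * r) x ->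
   s \in `[0, T] -> V (x + h *: B (x, s)) <= V x + h * dotp (B (x, s)) (grad V x) + h * V x.
  have gc x : cball (5 * r) x -> {for x, continuous (grad V)}.
    move=> xr; apply: continuous_row => i.
    rewrite (_ : (fun z => grad V z 0 i) = 'D_(unit_row i) V); last first.
      by apply/funext => z; rewrite mxE.
    by apply: (V_smooth.2 (unit_row i)).2.1; exact: KU.
  (* The accuracy is chosen so that d e (M + 1) <= v0 <= V. The Taylor error of a step is then at
     most h V, although V is only of class C^1. *)
  pose e := v0 / (d%:R * (M + 1)  + 1).
  have D0 : 0 < d%:R * (M + 1) + 1 by rewrite ltr_wpDl// mulr_ge0// addr_ge0.
  have e0 : 0 < e by rewrite divr_gt0.
  have [w w0 Hw] := heine_cantor (@compact_cball R d (5 * r)) gc e0.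
  have M1p : 0 < M + 1 by rewrite ltr_wpDl.
  exists (w / (M + 1)); first by rewrite divr_gt0.
  move=> h x s /andP[h0 hw] hM xr sT.
  have BMx : enorm (B (x, s)) <= M by exact: field_bound (FB s sT) _.
  have x5 : cball (5 * r) x by apply: le_trans xr (ltW r45).
  move: (B (x, s)) BMx => y BMx.
  have seg c : 0 <= c <= 1 -> cball (5 * r) (c *: (h *: y) + x).
    move=> /andP[c0 c1]; rewrite /cball/=; apply: (le_trans (enormD _ _)).
    have : enorm (c *: (h *: y)) <= r.
      rewrite !enormZ (ger0_norm c0) (ger0_norm h0); apply: (@le_trans _ _ (1 * (h * M))).
        by apply: ler_pM => //; [rewrite mulr_ge0 ?enorm_ge0|exact: ler_wpM2l].
      by rewrite mul1r.
    by move=> hr; rewrite (_ : 5 * r = r + 4 * r); [exact: lerD|ring].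
  have [c c01 Ec] := mean_value V_smooth (fun c c01 => KU _ (seg c c01)).
  set xi := c *: _ + _ in Ec.
  have gE (z w' : E) : U z -> 'D_w' V z = dotp (grad V z) w'.
    move=> Uz; rewrite {1}(row_unit_sum w') (derive_lincomb _ _ _ oU V_smooth Uz).
    by rewrite /dotp; apply: eq_bigr => i _; rewrite mxE mulrC.
  rewrite gE in Ec; last exact: KU _ (seg c c01).
  have xix : `|xi - x| <= w.
    rewrite /xi addrK; apply: (le_trans (normr_le_enorm _)).
    case/andP: c01 => c0 c1; rewrite !enormZ (ger0_norm c0) (ger0_norm h0).
    apply: (@le_trans _ _ (1 * (h * (M + 1)))).
      apply: ler_pM => //; rewrite ?mulr_ge0 ?enorm_ge0//; apply: ler_wpM2l => //.
      by apply: (le_trans BMx); rewrite lerDl.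
    by rewrite mul1r -ler_pdivlMr.
  have gd : enorm (grad V xi - grad V x) <= d%:R * e.
    apply: (le_trans (enorm_le_normr _)); apply: ler_wpM2l => //.
    by apply: Hw => //; exact: seg.
  have fin : dotp (grad V xi - grad V x) (y) <= V x.
    apply: (le_trans (ler_dotp _ _)); apply: (@le_trans _ _ (d%:R * e * (M + 1))).
      by apply: ler_pM; rewrite ?enorm_ge0// (le_trans BMx)// lerDl.
    apply: le_trans (V_ge (KU _ x5)).
    rewrite (_ : d%:R * e * (M + 1) = v0 * (d%:R * (M + 1)) / (d%:R * (M + 1) + 1)); last by rewrite /e; ring.
    by rewrite ler_pdivrMr// ler_wpM2l ?(ltW v0_gt0)// lerDl.
  have h1 := ler_wpM2l h0 fin.
  move: Ec; rewrite [h *: _ + x]addrC dotpZr => Ec.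
  rewrite dotpBl in h1; rewrite (dotpC y).
  exact: taylor_algebra Ec h1.
(* One number above both quantities whose product with [h0] must not exceed 1. *)
pose W := M + M ^+ 2 + 3 * M * (scheme_rate r C delta + 2 * M + 1) + 1.
have P0 : 0 <= 3 * M * (scheme_rate r C delta + 2 * M + 1).
  by rewrite mulr_ge0// ?mulr_ge0// addr_ge0// addr_ge0// mulr_ge0.
have Msq := sqr_ge0 M.
have [W0 WM WP] := sum_bounds M0 Msq P0; rewrite -/W in W0 WM WP.
pose h0 := Num.min q (Num.min (r / (M + 1)) W^-1).
have M1p : 0 < M + 1 by rewrite ltr_wpDl.
have h0p : 0 < h0 by rewrite !lt_min q0 divr_gt0// invr_gt0 W0.
have h0r : h0 * M <= r.
  apply: (@le_trans _ _ (r / (M + 1) * (M + 1))); last by rewrite divfK// gt_eqF.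
  by apply: ler_pM; rewrite ?(ltW h0p)// ?lerDl// !ge_min lexx orbT.
have h0W c : 0 <= c -> c <= W -> h0 * c <= 1.
  move=> c0 cW; apply: (@le_trans _ _ (W^-1 * W)); last by rewrite mulVf// gt_eqF.
  by apply: ler_pM; rewrite ?(ltW h0p)// !ge_min lexx !orbT.
have small : [/\ h0 * M <= 5 * r - 4 * r, h0 * M <= 1 &
  h0 * (M ^+ 2 + 3 * M * (scheme_rate r C delta + 2 * M + 1)) <= 1].
  split.
  - by rewrite (_ : 5 * r - 4 * r = r)//; ring.
  - by apply: h0W.
  - by apply: h0W => //; exact: addr_ge0.
have Vt h x s : 0 <= h <= h0 -> cball (4 * r) x -> s \in `[0, T] ->
   V (x + h *: B (x, s)) <= V x + h * dotp (B (x, s)) (grad V x) + h * V x.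
  move=> /andP[hh0 hh1]; apply: Hq.
    by rewrite hh0 (le_trans hh1)// ge_min lexx.
  by apply: le_trans h0r; apply: ler_wpM2r.
(* The initial constant is uniform in k in the application, since [v0] is there a common lower bound
   of all V_k. *)
have A00 : 0 <= G0 ^+ 2 / v0 by rewrite divr_ge0 ?sqr_ge0// ltW.
have init x : cball (5 * r) x -> enorm (gpsi x) ^+ 2 <= G0 ^+ 2 / v0 * V x.
  move=> xr; apply: (@le_trans _ _ (G0 ^+ 2 / v0 * v0)).
    rewrite divfK ?gt_eqF//; apply: lerXn2r; rewrite ?nnegrE ?enorm_ge0//.
    exact: C11_grad psi_C11 _ _.
  by apply: ler_wpM2l => //; apply: V_ge; exact: KU.
have r24 : 2 * r <= 4 * r by rewrite ler_pM2r// ler_nat.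
have [C' C'0 HC'] := scheme_test T_ge0 r_gt0 r24 (ltW r45) G0_ge0 L0_ge0 M0 psi_C11 psi_le1
  FB Bt B_out B_in V_gt0 c10 diss Vt small A00 init.
by exists C', h0.
Qed.

End LocalScheme.

(** * Difference of two solutions *)

Section BoxBumps.
Context {R : realType} {d : nat}.
Local Notation E := 'rV[R]_d.
Local Notation ER := (E * R)%type.

(** A slice of the space-time bump at the middle of the time interval ]0, 1[, so that smoothness and
    support are inherited; the time factor is a constant that tends to 1 with k. *)
Definition box_bump (a b : E) k (x : E) : R := sbox_bump a b 0 1 k (x, 2^-1).

Let half01 : 0 < (2^-1 : R) < 1.
Proof. by rewrite invr_gt0 ltr0n/= invf_lt1// ltr1n. Qed.

Lemma box_bump_le1 a b k x : `|box_bump a b k x| <= 1.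
Proof. by rewrite ger0_norm ?sbox_bump_ge0// sbox_bump_le1. Qed.

Lemma box_bump_out a b k x : ~ box a b x -> box_bump a b k x = 0.
Proof. by move=> nb; apply/eqP/negPn/negP => /sbox_bump_support[[]]. Qed.

Lemma box_bump_cvg a b x : box_bump a b k x @[k --> \oo] --> (\1_(box a b) x : R).
Proof.
have := @sbox_bump_cvg R d a b 0 1 (x, 2^-1).
have -> // : \1_(sbox a b 0 1) (x, 2^-1) = \1_(box a b) x :> R.
rewrite !indicE; congr (nat_of_bool _)%:R.
by apply/idP/idP; rewrite !inE; [case|move=> h; split].
Qed.

Lemma continuous_box_bump a b k : continuous (box_bump a b k).
Proof.
move=> x; apply: (@continuous_comp E ER R (fun x : E => (x, 2^-1 : R)) (sbox_bump a b 0 1 k) x).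
  by apply: (@cvg_pair _ _ _ (nbhs x) (nbhs x) (nbhs (2^-1 : R)) _ _ _ id (cst 2^-1));
    [exact: cvg_id|exact: cvg_cst].
by apply: flat_algebra_continuous; exact: sbox_bump_flat.
Qed.

(** Smoothness gives the bounds on a ball of radius n + 1, and the vanishing outside radius n makes
    them global. *)
Lemma box_bump_C11 a b k : exists G L g, [/\ 0 <= G, 0 <= L &
  C11 setT G L (box_bump a b k) g].
Proof.
have [n Hn] := box_bounded a b.
have sm : class_Coo ([set: E] `*` [set: R]) (sbox_bump a b 0 1 k : ER -> R).
  move=> j; apply: (class_C_sub (U := setT)); first exact: subsetT.
  exact: (flat_algebra_Coo (sbox_bump_flat a b 0 1 k)).
have [M M0 /(_ 2^-1)[]] := smooth_field_C11 (@openT _) 1 (@subsetT _ (cball (n%:R + 1))) sm.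
  by rewrite in_itv/=; case/andP: half01 => /ltW-> /ltW->.
move=> c1 fM _.
have n1 : n%:R < n%:R + 1 :> R by rewrite ltrDl.
have out (x : E) : ~ cball n%:R x -> box_bump a b k x = 0 /\ grad (box_bump a b k) x = 0.
  move=> xn; split; first by apply: box_bump_out => /Hn.
  apply/rowP => i; rewrite !mxE.
  rewrite (@near_eq_derive _ _ _ _ (cst 0)) ?derive_cst//.
  have oC : open (~` (cball n%:R : set E)) by rewrite openC; exact: closed_cball.
  have : nbhs x (~` (cball n%:R : set E)) by exact: open_nbhs_nbhs.
  by apply: filterS => y yn; apply: box_bump_out => /Hn.
eexists M, _, _; split; last exact: (C11_extend n1 M0 M0 c1 fM out) => //.
  by [].
by rewrite !addr_ge0// divr_ge0// ?sqr_ge0// subr_ge0 ltW.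
Qed.

End BoxBumps.

(** * Signed measures that annihilate countably many bumps *)

Section Vanishing.
Context {R : realType} {d : nat}.
Local Notation E := 'rV[R]_d.
Variables (m : set E -> R) (hm : locally_bounded_measure setT m).
Let exS := @exhausts_space R d.

Let int1 n : (lb_abs exS hm).-integrable (cball n%:R : set E) (EFin \o cst 1).
Proof.
apply: (lb_abs_bounded_integrable _ _ (c := 1)) => //; first exact: compact_cball.
by move=> x _; rewrite normr1.
Qed.

Let mcball n : measurable (cball n%:R : set (borel E)).
Proof. by apply: compact_borel; exact: compact_cball. Qed.

Let mbox (a b : E) : measurable (box a b : set (borel E)).
Proof. by apply: open_borel; exact: open_box. Qed.

Let box_indic (a b : E) : signed_integral setT m \1_(box a b) = m (box a b).
Proof.
have [n Hn] := box_bounded a b.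
exact: (signed_integral_indic exS hm (@compact_cball R d n%:R) (@subsetT _ _) (mbox a b) Hn).
Qed.

Let rat_box_null (n1 n2 : nat) :
  (forall k, signed_integral setT m (box_bump (rat_row n1) (rat_row n2) k) = 0) ->
  m (box (rat_row n1) (rat_row n2)) = 0.
Proof.
set a := rat_row n1; set b := rat_row n2 => H; rewrite -box_indic.
have [n Hn] := box_bounded a b.
have h := @signed_integral_cvg _ _ _ _ exS _ hm (cball n%:R) (box_bump a b) \1_(box a b)
  (cst 1) (mcball n) (@subsetT _ _).
apply: (cvg_unique _ (h _ _ _ _ _ _ _)) => //.
- by move=> k x _ nx; apply: box_bump_out => /Hn.
- by move=> x _ nx; rewrite indicE memNset// => /Hn.
- move=> k; apply: measurable_funS (continuous_borel_real (@continuous_box_bump R d a b k)) => //.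
- by move=> x _; exact: box_bump_cvg.
- by move=> k x _; exact: box_bump_le1.
- have z : signed_integral setT m (box_bump a b k) @[k --> \oo] --> (0 : R).
    by under eq_fun do rewrite H; exact: cvg_cst.
  exact: z.
Qed.

(** Bumps give the indicators of boxes with rational corners, these approximate a box with real
    corners from inside, and Dynkin's lemma within one large box gives all bounded Borel sets. Only
    countably many conditions are imposed, so one null set of times will do. *)
Lemma measure_eq0_of_bumps :
  (forall n1 n2 k, signed_integral setT m (box_bump (rat_row n1) (rat_row n2) k) = 0) ->
  forall B, bounded_borel setT B -> m B = 0.
Proof.
move=> H.
have box0 a b : m (box a b) = 0.
  have [n Hn] := box_bounded a b.
  have [e [e0 e_lt]] : exists e : nat -> R, (forall j, 0 < e j) /\
      forall eps, 0 < eps -> \forall j \near \oo, e j < eps.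
    exists (fun j => j.+1%:R^-1); split; first by move=> j; rewrite invr_gt0.
    by move=> eps eps0; exact: near_infty_natSinv_lt (PosNum eps0).
  (* A rational corner within e j of the true corner shifted inwards by 2 e j lies strictly inside,
     with each coordinate less than 3 e j away. *)
  have Ha j : exists i, ball (a + const_mx (2 * e j)) (e j) (rat_row i : E).
    exact: rat_row_dense.
  have Hb j : exists i, ball (b - const_mx (2 * e j)) (e j) (rat_row i : E).
    exact: rat_row_dense.
  pose aj j : E := rat_row (projT1 (cid (Ha j))).
  pose bj j : E := rat_row (projT1 (cid (Hb j))).
  have lin (x y z : R) : 0 < z -> x + 2 * z - z < y < x + 2 * z + z -> x < y < x + 3 * z.
    by move=> z0 /andP[? ?]; apply/andP; split; lra.
  have lin' (x y z : R) : 0 < z -> x - 2 * z - z < y < x - 2 * z + z -> x - 3 * z < y < x.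
    by move=> z0 /andP[? ?]; apply/andP; split; lra.
  have aE j i : a 0 i < aj j 0 i < a 0 i + 3 * e j.
    have : ball (a + const_mx (2 * e j)) (e j) (aj j) := projT2 (cid (Ha j)).
    rewrite ball_rowE// => /(_ i); rewrite !mxE; exact: lin.
  have bE j i : b 0 i - 3 * e j < bj j 0 i < b 0 i.
    have : ball (b - const_mx (2 * e j)) (e j) (bj j) := projT2 (cid (Hb j)).
    rewrite ball_rowE// => /(_ i); rewrite !mxE; exact: lin'.
  have sub j : box (aj j) (bj j) `<=` box a b.
    move=> x hx i; have /andP[h1 h2] := hx i; have /andP[h3 _] := aE j i; have /andP[_ h4] := bE j i.
    by rewrite (lt_trans h3 h1) (lt_trans h2 h4).
  have H0 j : signed_integral setT m \1_(box (aj j) (bj j)) = 0.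
    by rewrite box_indic; apply: rat_box_null => k; exact: H.
  rewrite -box_indic.
  have h := @signed_integral_cvg _ _ _ _ exS _ hm (cball n%:R) (fun j => \1_(box (aj j) (bj j)))
    \1_(box a b) (cst 1) (mcball n) (@subsetT _ _).
  apply: (cvg_unique _ (h _ _ _ _ _ _ _)) => //.
  - by move=> k x _ nx; rewrite indicE memNset// => /sub /Hn.
  - by move=> x _ nx; rewrite indicE memNset// => /Hn.
  - move=> x _; apply: cvg_near_cst.
    have [bx|bx] := pselect (box a b x); last first.
      apply: nearW => j; rewrite !indicE (memNset bx) memNset// => /sub; exact: bx.
    have near_i i : \forall j \near \oo, aj j 0 i < x 0 i < bj j 0 i.
      have /andP[x1 x2] := bx i.
      have ep : 0 < Num.min (x 0 i - a 0 i) (b 0 i - x 0 i) / 3.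
        by rewrite divr_gt0// lt_min !subr_gt0 x1.
      near=> j.
      have je : e j < Num.min (x 0 i - a 0 i) (b 0 i - x 0 i) / 3 by near: j; exact: e_lt.
      have /andP[_ h1] := aE j i; have /andP[h2 _] := bE j i.
      move: je; rewrite ltr_pdivlMr// lt_min mulrC => /andP[h3 h4].
      rewrite (lt_trans h1) ?(lt_trans _ h2)//.
        by rewrite ltrBrDr addrC -ltrBrDr.
      by rewrite addrC -ltrBrDr.
    have : \forall j \near \oo, forall i, aj j 0 i < x 0 i < bj j 0 i by apply: filter_forall.
    by apply: filterS => j hj; rewrite !indicE !mem_set.
  - by move=> k x _; rewrite indicE ger0_norm//; case: (_ \in _); rewrite ?ler01.
  - have z : signed_integral setT m \1_(box (aj k) (bj k)) @[k --> \oo] --> (0 : R).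
      by under eq_fun do rewrite H0; exact: cvg_cst.
    exact: z.
move=> B [mB bB _]; have [n Bn] := bounded_sub_cball bB.
pose Q : set E := box (const_mx (- (n%:R + 1))) (const_mx (n%:R + 1)).
have [n' Qn] : exists n' : nat, Q `<=` cball n'%:R := box_bounded _ _.
have BQ : B `<=` Q.
  move=> x /Bn xn i; rewrite !mxE -ltr_norml.
  by apply: le_lt_trans (coord_le_enorm x i) _; rewrite (le_lt_trans xn)// ltrDl.
have mQ : measurable (Q : set (borel E)) by exact: mbox.
have cn := @compact_cball R d n'%:R.
suff HA : forall A, measurable (A : set (borel E)) -> m (A `&` Q) = 0.
  by rewrite -(HA B mB) setIidl.
apply: box_induction.
- by rewrite setTI; exact: box0.
- by move=> a b; rewrite box_setI; exact: box0.
- move=> S mS IH.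
  have e : ~` S `&` Q = Q `\` (S `&` Q).
    by apply/seteqP; split => z /=; [move=> [h1 h2]; split=> // -[]|move=> [h1 h2]; split=> // h3; apply: h2].
  rewrite e (lb_setD hm cn (@subsetT _ _) mQ (measurableI _ _ mS mQ) (@subIsetr _ _ _) Qn).
  by rewrite IH /Q box0 subr0.
- move=> F mF tF IH; rewrite setI_bigcupl.
  have mI k : measurable (F k `&` Q : set (borel E)) by exact: measurableI.
  have tI : trivIset setT (fun k => F k `&` Q).
    apply/trivIsetP => i j _ _ ij; rewrite setIACA setIid.
    by move/trivIsetP: tF => ->//; rewrite set0I.
  have h1 := hm cn (@subsetT _ _) (fun k => conj (mI k) (subset_trans (@subIsetr _ _ _) Qn)) tI.
  apply: (cvg_unique _ h1) => //.
  have z : (\sum_(0 <= i < k) m (F i `&` Q)) @[k --> \oo] --> (0 : R).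
    by under eq_fun do rewrite big1//; exact: cvg_cst.
  exact: z.
Unshelve. all: by end_near. Qed.

End Vanishing.

(** * The equation satisfied by the difference of two solutions *)

Section DifferenceOfSolutions.
Context {R : realType} {d : nat}.
Local Notation E := 'rV[R]_d.
Local Notation ER := (E * R)%type.
Variables (T : R) (b : ER -> E) (nu : set E -> R) (mu1 mu2 : set ER -> R)
  (mut1 mut2 : R -> set E -> R).
Hypothesis T_gt0 : 0 < T.
Hypothesis b_borel : measurable_fun (slab T : set (borel ER)) (b : borel ER -> borel E).
Hypothesis sol1 : cauchy_solution T b nu mu1 mut1.
Hypothesis sol2 : cauchy_solution T b nu mu2 mut2.
Let exS := @exhausts_space R d.
Let gb1 := solution_given_by sol1.
Let gb2 := solution_given_by sol2.
Let mf1 := given_by_regular gb1.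
Let mf2 := given_by_regular gb2.
Let mT : measurable (`[0, T] : set (lebesgue_line R)) := leb_measurable_itv _.

Definition difference_family t B : R := zero_extension T mut1 t B - zero_extension T mut2 t B.
Local Notation m := difference_family.

Lemma regular_difference : regular_family T m.
Proof. exact: regular_familyB mf1 mf2. Qed.
Let mf := regular_difference.

(** [b] is measurable on the slab only; its extension by 0 is Borel on the whole space, as the
    lemmas on kernels require. *)
Definition slab_field (z : ER) : E := if z.2 \in `[0, T] then b z else 0.

Lemma slab_field_borel : measurable_fun setT (slab_field : borel ER -> borel E).
Proof.
have mS : measurable (slab T : set (borel ER)).
  by apply: setX_borel => //; exact: measurable_itv.
move=> _ Y mY.
have -> : setT `&` slab_field @^-1` Y =
    (slab T `&` b @^-1` Y) `|` (~` slab T `&` (if pselect (Y 0) then setT else set0)).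
  apply/seteqP; split => z /=; rewrite /slab_field /slab.
    move=> [_]; case: (boolP (z.2 \in `[0, T])) => zT Yz; first by left.
    by right; split; [move=> -[_]; exact/negP|case: pselect].
  move=> [[[_ zT] Yz]|[nz]]; first by split => //; rewrite zT.
  case: pselect => // Y0 _; split => //; case: ifPn => // zT.
  by exfalso; apply: nz.
apply: measurableU; first exact: b_borel.
apply: measurableI; first exact: measurableC.
by case: (pselect (Y 0)) => _ /=; [exact: measurableT|exact: measurable0].
Qed.

Lemma enorm_slab_field_borel : measurable_fun setT (fun z : borel ER => enorm (slab_field z)).
Proof.
apply: (measurableT_comp (f := enorm : borel E -> R)); last exact: slab_field_borel.
by apply: continuous_borel_real => x; apply: continuous_enorm; exact: cvg_id.
Qed.

Variables (r rho : R).
Hypothesis r_gt0 : 0 < r.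
Hypothesis rrho : 2 * r <= rho.
Local Notation K := (cball rho : set E).
Let cK : compact K := @compact_cball R d rho.
Let mK : measurable (K : set (borel E)). Proof. exact: compact_borel. Qed.

Section TestedEquation.
Variables (u ut : ER -> R) (ug : ER -> E) (t1 : R).
Hypothesis t1T : t1 < T.
Hypothesis tu : test_function T u.
Hypothesis cu : continuous u.
Hypothesis cut : continuous ut.
Hypothesis cug : continuous ug.
Hypothesis utE : forall z, ([set: E] `*` `[0, T[) z -> time_derive T u z = ut z.
Hypothesis ugE : forall z, space_grad u z = ug z.
Hypothesis out : forall z, 2 * r <= enorm z.1 -> [/\ u z = 0, ut z = 0 & ug z = 0].

(** The integrand of the equation, with the continuous functions [ut] and [ug] in place of the
    derivatives and with the extended field. It is Borel everywhere and agrees with the original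
    integrand for times in [0, T[. *)
Let H (z : ER) : R := ut z + dotp (slab_field z) (ug z).

Let outK x t : ~ K x -> [/\ u (x, t) = 0, ut (x, t) = 0 & ug (x, t) = 0].
Proof.
rewrite /cball/= => /negP; rewrite -ltNge => /ltW xr; apply: out => /=.
exact: le_trans rrho xr.
Qed.

Let H_borel : measurable_fun setT (H : borel ER -> R).
Proof.
apply: measurable_funD; first exact: continuous_borel_real.
rewrite /dotp; apply: measurable_sum => i; apply: measurable_funM.
  apply: (measurableT_comp (f := (fun x : borel E => x 0 i) : borel E -> R)); last exact: slab_field_borel.
  by apply: continuous_borel_real => x; apply: (continuous_coord (f := id)); exact: cvg_id.
by apply: continuous_borel_real => x; apply: continuous_coord; exact: cug.
Qed.

Let H_out x t : ~ K x -> H (x, t) = 0.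
Proof. by move=> /(outK t)[_ h1 h2]; rewrite /H h1 h2 dotp0r addr0. Qed.

Let cKT : compact (K `*` `[0, T]).
Proof. by apply: compact_setX => //; exact: segment_compact. Qed.
Let mKT : measurable (K `*` `[0, T] : set (borel ER)).
Proof. exact: compact_borel. Qed.
Let KTs : K `*` `[0, T] `<=` slab T. Proof. by move=> z [_ h]; split. Qed.

Let H_integrable (mu : set ER -> R) mut : cauchy_solution T b nu mu mut ->
  (abs_measure (slab T) mu).-integrable (K `*` `[0, T] : set (borel ER)) (EFin \o H).
Proof.
move=> sol; have hmu := given_by_measure (solution_given_by sol).
have [Mt Mt0 HMt] := compact_norm_bound cKT (fun z _ => @cut z).
have [Mg Mg0 HMg] := compact_norm_bound (f := fun z => enorm (ug z)) cKT (fun z _ => continuous_enorm (@cug z)).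
have rho1 : 0 < rho + 1.
  by rewrite (lt_le_trans _ (_ : 2 * r <= _))// ?mulr_gt0// (le_trans rrho)// lerDl.
have ib := solution_integrable sol 0 rho1.
have KU : K `*` `[0, T] `<=` eball 0 (rho + 1) `*` `[0, T].
  by move=> z [Kz zT]; split => //; rewrite /eball/= subr0; apply: le_lt_trans Kz _; rewrite ltrDl.
have ib' : (lb_abs (@exhausts_slab R d T) hmu).-integrable (K `*` `[0, T]) (fun z => (enorm (b z))%:E).
  have mE : measurable (eball 0 (rho + 1) `*` `[0, T] : set (borel ER)).
    apply: setX_borel; last exact: measurable_itv.
    by apply: open_borel; exact: open_eball.
  exact: (@integrableS _ _ _ (lb_abs (@exhausts_slab R d T) hmu) _ _ _ mE mKT KU ib).
have i1 : (lb_abs (@exhausts_slab R d T) hmu).-integrable (K `*` `[0, T]) (EFin \o cst Mt).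
  by apply: (lb_abs_bounded_integrable _ _ (c := Mt)) => // z _; rewrite ger0_norm.
have i2 := integrableZl mKT Mg ib'.
apply: (le_integrable (mu := lb_abs (@exhausts_slab R d T) hmu) mKT _ _ (integrableD mKT i1 i2)).
  by apply/measurable_EFinP; apply: measurable_funS H_borel.
move=> z [Kz zT]; change (`|H z|%:E <= `|Mt + Mg * enorm (b z)|%:E)%E.
rewrite lee_fin (ger0_norm (x := Mt + _)); last first.
  by rewrite addr_ge0// mulr_ge0// enorm_ge0.
apply: (le_trans (ler_normD _ _)); apply: lerD; first by apply: HMt.
rewrite /slab_field zT; apply: (le_trans (normr_dotp _ _)); rewrite mulrC.
apply: ler_wpM2r; first exact: enorm_ge0.
by apply: le_trans (HMg z _); rewrite ?ler_norm.
Qed.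

Let u_integrable (mm : set E -> R) (hm : locally_bounded_measure setT mm) t :
  (lb_abs exS hm).-integrable K (EFin \o (fun x => u (x, t))).
Proof.
have cut' : continuous (fun x => u (x, t)).
  move=> x; apply: (@continuous_comp E ER R (fun x : E => (x, t)) u x); last exact: cu.
  by apply: (@cvg_pair _ _ _ (nbhs x) (nbhs x) (nbhs t) _ _ _ id (cst t));
    [exact: cvg_id|exact: cvg_cst].
have [M M0 HM] := compact_norm_bound cK (fun x _ => cut' x).
apply: (lb_abs_bounded_integrable _ _ (c := M)) => //.
by apply: measurable_funS (continuous_borel_real cut').
Qed.

Let SI1 s := signed_integral setT (zero_extension T mut1 s) (fun x => H (x, s)).
Let SI2 s := signed_integral setT (zero_extension T mut2 s) (fun x => H (x, s)).
Let SI s := signed_integral setT (m s) (fun x => H (x, s)).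

(** The signed integral against a difference splits once the integrand is integrable against both
    measures, which is known for almost every time. *)
Let SI_ae : {ae leb R, forall s, s \in `[0, T] -> SI s = SI1 s - SI2 s /\
  (lb_abs exS (family_lb mf s)).-integrable K (EFin \o (fun x => H (x, s)))}.
Proof.
have a1 := given_by_ae_integrable gb1 cK H_borel (H_integrable sol1).
have a2 := given_by_ae_integrable gb2 cK H_borel (H_integrable sol2).
apply: leb_aeS (leb_aeI a1 a2) _ => s [h1 h2] sT; split.
  apply: (signed_integralB_measure cK (@subsetT _ K) mK (@subset_refl _ K) _ (h1 sT) (h2 sT)).
  by move=> x _; exact: H_out.
exact: (integrable_abs_measureB mK (h1 sT) (h2 sT)).
Qed.

Let subT t : t \in `[0, t1] -> (`[0, t] : set R) `<=` `[0, T].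
Proof.
rewrite in_itv/= => /andP[_ tt1] s /=; rewrite !in_itv/= => /andP[-> st]/=.
by rewrite (le_trans st)// (le_trans tt1)// ltW.
Qed.

(** Subtraction removes the common initial measure. The restriction t <= t1 < T keeps the time
    integral inside [0, T[, where [time_derive] is given by [ut]. *)
Let tested_equation : {ae leb R, forall t, t \in `[0, t1] ->
  signed_integral setT (m t) (fun x => u (x, t)) = \int[leb R]_(s in `[0, t]) SI s}.
Proof.
have eq mu mut : cauchy_solution T b nu mu mut -> {ae leb R, forall t, t \in `[0, t1] ->
    signed_integral setT (zero_extension T mut t) (fun x => u (x, t)) =
    signed_integral setT nu (fun x => u (x, 0)) +
    \int[leb R]_(s in `[0, t]) signed_integral setT (zero_extension T mut s) (fun x => H (x, s))}.
  move=> sol; apply: leb_aeS (solution_equation sol tu) _ => t Et tt1.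
  have tT : t \in `[0, T] by apply: (subT tt1); move: tt1; rewrite /= !in_itv/= lexx andbT => /andP[].
  have E0 := Et tT; rewrite (zero_extensionE _ tT) E0.
  apply: (congr1 (fun z => signed_integral setT nu (fun x => u (x, 0)) + z)).
  apply: (@eq_Rintegral _ (lebesgue_line R) R (leb R)); move=> s /set_mem st.
  have sT : s \in `[0, T] by exact: (subT tt1 st).
  rewrite (zero_extensionE _ sT); congr signed_integral; apply/funext => x.
  rewrite utE ?ugE /H /slab_field /= ?sT//; split => //=.
  move: st tt1 sT; rewrite /= !in_itv/= => /andP[-> st] /andP[_ tt1] _ /=.
  by rewrite (le_lt_trans st)// (le_lt_trans tt1).
apply: leb_aeS (leb_aeI (eq _ _ sol1) (eq _ _ sol2)) _ => t [e1 e2] tt1.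
have mt : measurable (`[0, t] : set (lebesgue_line R)) := leb_measurable_itv _.
have j1 := integrableS mT mt (subT tt1) (given_by_signed_integrable gb1 cK H_borel (H_integrable sol1) H_out).
have j2 := integrableS mT mt (subT tt1) (given_by_signed_integrable gb2 cK H_borel (H_integrable sol2) H_out).
have -> : signed_integral setT (m t) (fun x => u (x, t)) =
  signed_integral setT (zero_extension T mut1 t) (fun x => u (x, t)) -
  signed_integral setT (zero_extension T mut2 t) (fun x => u (x, t)).
  apply: (signed_integralB_measure cK (@subsetT _ K) mK (@subset_refl _ K) _
    (u_integrable (family_lb mf1 t) t) (u_integrable (family_lb mf2 t) t)).
  by move=> x _ /(outK t)[].
rewrite e1// e2// opprD addrACA subrr add0r -(RintegralB mt j1 j2).
have mS : measurable_fun setT (fun s : lebesgue_line R => SI s).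
  by rewrite /SI; exact: (@family_signed_measurable R d T m mf K cK H H_borel H_out).
have Z := @ae_eq_integral _ (lebesgue_line R) R (leb R) (`[0, t] : set (lebesgue_line R))
  (fun s => (SI1 s - SI2 s)%:E) (fun s => (SI s)%:E) mt.
have m12 : measurable_fun (`[0, t] : set (lebesgue_line R)) (fun s => (SI1 s - SI2 s)%:E).
  apply/measurable_EFinP; apply: measurable_funB.
    by apply: measurable_funS (@family_signed_measurable R d T _ mf1 K cK H H_borel H_out).
  by apply: measurable_funS (@family_signed_measurable R d T _ mf2 K cK H H_borel H_out).
have mSt : measurable_fun (`[0, t] : set (lebesgue_line R)) (fun s => (SI s)%:E).
  by apply/measurable_EFinP; apply: measurable_funS mS.
refine (esym (congr1 fine (Z _ _ _))).
- first [exact: m12|exact: mSt].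
- first [exact: mSt|exact: m12].
- apply: leb_aeS SI_ae _ => s Hs st; congr (_%:E).
  by have [-> _] := Hs (subT tt1 st).
Qed.

(** The majorant [W] is nonnegative, so the time interval [0, t] may be enlarged to [0, T] and the
    bound no longer depends on t. *)
Lemma difference_bound (W : ER -> R) : measurable_fun setT (W : borel ER -> R) ->
  (forall z, 0 <= W z) ->
  (forall x s, K x -> 0 <= s <= t1 -> `|H (x, s)| <= W (x, s)) ->
  {ae leb R, forall t, t \in `[0, t1] ->
    (`|signed_integral setT (m t) (fun x => u (x, t))|%:E <=
     \int[leb R]_(s in `[0%R, T]) \int[abs_measure setT (m s)]_(x in K) (W (x, s))%:E)%E}.
Proof.
move=> mW W0 HW; apply: leb_aeS tested_equation _ => t Et tt1; rewrite Et//.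
have mt : measurable (`[0, t] : set (lebesgue_line R)) := leb_measurable_itv _.
have mS : measurable_fun setT (fun s : lebesgue_line R => SI s).
  rewrite /SI; exact: (@family_signed_measurable R d T m mf K cK H H_borel H_out).
have mSt : measurable_fun (`[0, t] : set (lebesgue_line R)) (fun s => (SI s)%:E).
  by apply/measurable_EFinP; apply: measurable_funS mS.
have mWE : measurable_fun setT (fun z : borel ER => (W z)%:E) by exact/measurable_EFinP.
have mI := lb_abs_integral_measurable mf cK (g := fun z => (W z)%:E) (fun z => ltac:(by rewrite lee_fin)) mWE.
have I0 s : (0 <= \int[abs_measure setT (m s)]_(x in K) (W (x, s))%:E)%E.
  by apply: (@integral_ge0 _ _ _ (lb_abs exS (family_lb mf s))) => x _; rewrite lee_fin.
apply: (@le_trans _ _ (\int[leb R]_(s in `[0%R, t]) \int[abs_measure setT (m s)]_(x in K) (W (x, s))%:E)%E); last first.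
  apply: (@ge0_subset_integral _ (lebesgue_line R) R (leb R) _ _ mt mT _ _ _ (subT tt1)).
    by apply: measurable_funS mI.
  by move=> s _; exact: I0.
apply: (@le_trans _ _ (`|\int[leb R]_(s in `[0%R, t]) (SI s)%:E|)%E).
  rewrite /Rintegral; case: (integral _ _ _) => [x| |] //=; by rewrite ?normr0 ?leey.
apply: (le_trans (le_abse_integral _ mt mSt)).
apply: (ae_ge0_le_integral mt).
- by move=> s _; exact: abse_ge0.
- exact: measurableT_comp (@abse_measurable R setT) mSt.
- by move=> s _; exact: I0.
- by apply: measurable_funS mI.
apply: leb_aeS SI_ae _ => s Hs st.
have [_ hs] := Hs (subT tt1 st).
apply: le_trans (signed_integral_abs mK (@subsetT _ K) _ hs) _.
  by move=> x _; exact: H_out.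
apply: (@ge0_le_integral _ _ _ (lb_abs exS (family_lb mf s)) K mK).
- by move=> x _; rewrite lee_fin.
- apply/measurable_EFinP/measurableT_comp => //.
  by apply: measurable_funS (section_borel s H_borel).
- by apply/measurable_EFinP; apply: measurable_funS (section_borel s mW).
- move=> x Kx; rewrite lee_fin; apply: HW => //.
  move: st tt1; rewrite /= !in_itv/= => /andP[-> st] /andP[_ tt1].
  exact: le_trans st tt1.
Qed.

End TestedEquation.

End DifferenceOfSolutions.

Section OpenBorel.
Context {R : realType}.

(** Serves b_k and V_k, which are continuous on an open set and arbitrary outside it. *)
Lemma continuous_on_open_borel (X Y : normedModType R) (O : set X) (f : X -> Y) : open O ->
  (forall x, O x -> {for x, continuous f}) ->
  measurable_fun (O : set (borel X)) (f : borel X -> borel Y).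
Proof.
move=> oO cf; apply: (measurability _ (erefl : open.-sigma.-measurable = <<s @open Y>>)).
move=> _ [Z oZ <-]; apply: open_borel; rewrite openE => x [Ox Zx].
apply: filterI; first exact: open_nbhs_nbhs.
by apply: cf => //; exact: open_nbhs_nbhs.
Qed.

Lemma continuous_on_open_borel_real (X : normedModType R) (O : set X) (f : X -> R) : open O ->
  (forall x, O x -> {for x, continuous f}) ->
  measurable_fun (O : set (borel X)) (f : borel X -> R).
Proof.
move=> oO cf mO J mJ; apply: (continuous_on_open_borel oO cf) => //.
exact: borel_real_measurable.
Qed.

Lemma le_of_harmonic (a D c : R) p0 :
  (forall p : nat, (p0 <= p)%N -> a <= D / p.+1%:R + c) -> a <= c.
Proof.
move=> H; apply/ler_addgt0Pr => e e0.
have D1 : 0 < `|D| + 1 by rewrite ltr_wpDl.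
have [p [hp pe]] : exists p, (p0 <= p)%N /\ p.+1%:R^-1 < e / (`|D| + 1).
  have eD : 0 < e / (`|D| + 1) by rewrite divr_gt0.
  near \oo => p; exists p; split; first by near: p; exact: nbhs_infty_ge.
  by near: p; exact: near_infty_natSinv_lt (PosNum eD).
apply: (le_trans (H p hp)); rewrite addrC lerD2l.
apply: (@le_trans _ _ ((`|D| + 1) * p.+1%:R^-1)).
  by apply: ler_wpM2r; rewrite ?invr_ge0// (le_trans (ler_norm _))// lerDl.
by rewrite mulrC -ler_pdivlMr// ltW.
Unshelve. all: by end_near. Qed.

(** Here m is the integer part of t / h. The choice n = m + 2 puts t between one and two steps
    before n h, and n h <= T holds once two steps fit between t and T. *)
Lemma step_count_bounds (T t h m n : R) : m * h <= t -> t <= (m + 1) * h ->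
  2 * h <= T - t -> n = m + 2 -> n * h <= T /\ n * h - 2 * h <= t <= n * h - h.
Proof.
move=> + + + ->; rewrite (mulrDl m 2) (mulrDl m 1) mul1r.
by move: (m * h) => y a1 a2 a3; split; [lra|apply/andP; split; lra].
Qed.

End OpenBorel.

(** * The limit of vanishing step *)

Section LimitEstimate.
Context {R : realType} {d : nat}.
Local Notation E := 'rV[R]_d.
Local Notation ER := (E * R)%type.
Variables (T : R) (b : ER -> E) (nu : set E -> R) (mu1 mu2 : set ER -> R)
  (mut1 mut2 : R -> set E -> R).
Hypothesis T_gt0 : 0 < T.
Hypothesis b_borel : measurable_fun (slab T : set (borel ER)) (b : borel ER -> borel E).
Hypothesis sol1 : cauchy_solution T b nu mu1 mut1.
Hypothesis sol2 : cauchy_solution T b nu mu2 mut2.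
Let exS := @exhausts_space R d.
Local Notation m := (difference_family T mut1 mut2).
Let mf := regular_difference sol1 sol2.
Let mT : measurable (`[0, T] : set (lebesgue_line R)) := leb_measurable_itv _.

(** Finiteness of this mass makes the error C' h, integrated over [K] and over time, disappear as h
    tends to 0. *)
Lemma difference_integrable (K : set E) : compact K ->
  (\int[leb R]_(t in `[0%R, T]) abs_measure setT (m t) K < +oo)%E.
Proof.
move=> cK; have mK := compact_borel cK.
have i1 := given_by_integrable (solution_given_by sol1) cK.
have i2 := given_by_integrable (solution_given_by sol2) cK.
have i12 := integrableD mT i1 i2.
have /integrableP[m12] := i12; apply: le_lt_trans.
have mI := lb_abs_integral_measurable mf cK (g := cst 1%E) (fun _ => lee01) (measurable_cst _).
have e t : abs_measure setT (m t) K = (\int[abs_measure setT (m t)]_(x in K) 1)%E.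
  apply: esym; apply: etrans (integral_cst (lb_abs exS (family_lb mf t)) mK 1) _.
  by rewrite mul1e.
apply: (@ge0_le_integral _ (lebesgue_line R) R (leb R) _ mT).
- by move=> t _; exact: (measure_ge0 (lb_abs exS (family_lb mf t))).
- apply: eq_measurable_fun (measurable_funS measurableT (@subsetT _ _) mI) => t _.
  by rewrite e.
- exact: measurableT_comp (@abse_measurable R setT) m12.
move=> t tT; rewrite gee0_abs; last first.
  apply: adde_ge0.
    exact: (measure_ge0 (lb_abs exS (given_by_slice (solution_given_by sol1) tT))).
  exact: (measure_ge0 (lb_abs exS (given_by_slice (solution_given_by sol2) tT))).
rewrite /difference_family (zero_extensionE _ tT) (zero_extensionE _ tT).
exact: (abs_measureB_le exS (given_by_slice (solution_given_by sol1) tT)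
  (given_by_slice (solution_given_by sol2) tT) K).
Qed.

Variables (r C delta v0 G0 L0 : R) (psi : E -> R) (gpsi : E -> E).
Variables (bk : ER -> E) (V : E -> R).
Hypothesis r_gt0 : 0 < r.
Hypothesis C_gt0 : 0 < C.
Hypothesis delta_gt0 : 0 < delta.
Hypothesis v0_gt0 : 0 < v0.
Hypothesis G0_ge0 : 0 <= G0.
Hypothesis L0_ge0 : 0 <= L0.
Hypothesis psi_C11 : C11 setT G0 L0 psi gpsi.
Hypothesis psi_le1 : forall x, `|psi x| <= 1.
Hypothesis psi_cont : continuous psi.
Let U : set E := eball 0 (6 * r).
Hypothesis bk_smooth : class_Coo (U `*` setT) bk.
Hypothesis V_smooth : class_C 1 U V.
Hypothesis V_ge : forall x, U x -> v0 <= V x.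
Hypothesis lyapunov : forall x t, U x -> t \in `[0, T] ->
  dotp (bk (x, t)) (grad V x) <=
  (C - delta * enorm (bk (x, t)) ^+ 2 - 2 * max_form (partials (fun y => bk (y, t)) x)) * V x.

Let K : set E := cball (6 * r).
Let cK : compact K := @compact_cball R d (6 * r).
Let mK : measurable (K : set (borel E)). Proof. exact: compact_borel. Qed.
Let sf := slab_field T b.
Let S := G0 ^+ 2 / v0 * expR (T * (scheme_rate r C delta + 2)).
Let O : set ER := U `*` setT.
(** Extension by 0 outside the ball, and in [GJ] outside the annulus, gives Borel functions on all
    of space-time, so that both errors become integrals over one compact set [K]. *)
Let Gk : ER -> R := (fun z => enorm (bk z - sf z) * Num.sqrt (V z.1)) \_ O.
Let ring : set E := [set x | r < enorm x < 2 * r].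
Let GJ : ER -> R := (fun z => enorm (sf z)) \_ (ring `*` setT).

Let oU : open U. Proof. exact: open_eball. Qed.
Let oO : open O.
Proof.
rewrite (_ : O = fst @^-1` U); first by apply: open_comp => // z _; exact: cvg_fst.
by apply/seteqP; split => z /=; [case|].
Qed.

Let m_ring : measurable (ring : set (borel E)).
Proof.
have ce : continuous (enorm : E -> R).
  by move=> x; apply: (continuous_enorm (f := id)); exact: cvg_id.
have h := continuous_borel_real ce measurableT (measurable_itv `]r, (2 * r)[).
rewrite (_ : ring = setT `&` enorm @^-1` `]r, (2 * r)[%classic); first exact: h.
by apply/seteqP; split => x /=; rewrite in_itv/=; [|case].
Qed.

Let mGJ : measurable_fun setT (GJ : borel ER -> R).
Proof.
have mR : measurable (ring `*` setT : set (borel ER)) by exact: (setX_borel m_ring measurableT).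
rewrite /GJ; apply/(measurable_restrictT _ mR).
by apply: measurable_funS (enorm_slab_field_borel b_borel).
Qed.

Let mGk : measurable_fun setT (Gk : borel ER -> R).
Proof.
have mO : measurable (O : set (borel ER)) := open_borel oO.
rewrite /Gk; apply/(measurable_restrictT _ mO); apply: measurable_funM; last first.
  apply: (continuous_on_open_borel_real (f := fun z => Num.sqrt (V z.1)) oO) => z [Uz _].
  apply: (continuous_comp (f := fun z : ER => V z.1) (g := Num.sqrt)); last exact: sqrt_continuous.
  by apply: (continuous_comp (f := fst) (g := V)); [exact: cvg_fst|exact: V_smooth.1].
have -> : (fun z : borel ER => enorm (bk z - sf z)) =
  Num.sqrt \o (fun z : borel ER => \sum_i (bk z 0 i - sf z 0 i) * (bk z 0 i - sf z 0 i)).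
  by apply/funext => z; rewrite /enorm /dotp /=; congr Num.sqrt; apply: eq_bigr => i _; rewrite !mxE.
apply: measurableT_comp; first by apply: continuous_measurable_fun; exact: sqrt_continuous.
apply: measurable_sum => i.
have mi : measurable_fun (O : set (borel ER)) (fun z : borel ER => bk z 0 i - sf z 0 i).
  apply: measurable_funB.
    apply: (continuous_on_open_borel_real (f := fun z => bk z 0 i) oO) => z Oz.
    by apply: continuous_coord; exact: (bk_smooth 0%N).1.
  apply: (measurableT_comp (f := (fun x : borel E => x 0 i) : borel E -> R)).
    by apply: continuous_borel_real => x; apply: (continuous_coord (f := id)); exact: cvg_id.
  by apply: measurable_funS (slab_field_borel b_borel).
exact: measurable_funM.
Qed.

Let Gk0 z : 0 <= Gk z.
Proof. by rewrite /Gk patchE; case: ifP => // _; rewrite mulr_ge0 ?enorm_ge0 ?sqrtr_ge0. Qed.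
Let GJ0 z : 0 <= GJ z.
Proof. by rewrite /GJ patchE; case: ifP => // _; rewrite enorm_ge0. Qed.

Definition approximation_error : \bar R :=
  (\int[leb R]_(t in `[0%R, T]) \int[abs_measure setT (m t)]_(x in eball 0 (6 * r))
    (enorm (bk (x, t) - b (x, t)) * Num.sqrt (V x))%:E)%E.

Definition annulus_flux : \bar R :=
  (\int[leb R]_(t in `[0%R, T]) \int[abs_measure setT (m t)]_(x in [set x | r < enorm x < 2 * r]%R)
    (enorm (b (x, t)))%:E)%E.

Let inner_Gk t : t \in `[0, T] -> (\int[abs_measure setT (m t)]_(x in K) (Gk (x, t))%:E =
  \int[abs_measure setT (m t)]_(x in U) (enorm (bk (x, t) - b (x, t)) * Num.sqrt (V x))%:E)%E.
Proof.
move=> tT; set F := fun x : borel E => (enorm (bk (x, t) - b (x, t)) * Num.sqrt (V x))%:E.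
have -> : (fun x : borel E => (Gk (x, t))%:E) = F \_ U.
  apply/funext => x; rewrite /Gk !patchE /O /F /sf /slab_field.
  have -> : ((x, t) \in U `*` [set: R]) = (x \in U).
    by apply/idP/idP; rewrite !inE; [case|move=> h; split].
  by rewrite tT; case: ifP.
have h := integral_mkcondl (lb_abs exS (family_lb mf t)) K U F.
apply: etrans (esym h) _; congr integral.
by apply/setIidPl => x; rewrite /U /K /eball /cball/= subr0 => /ltW.
Qed.

Let inner_GJ t : t \in `[0, T] -> (\int[abs_measure setT (m t)]_(x in K) (GJ (x, t))%:E =
  \int[abs_measure setT (m t)]_(x in ring) (enorm (b (x, t)))%:E)%E.
Proof.
move=> tT; set F := fun x : borel E => (enorm (b (x, t)))%:E.
have -> : (fun x : borel E => (GJ (x, t))%:E) = F \_ ring.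
  apply/funext => x; rewrite /GJ !patchE /F /sf /slab_field.
  have -> : ((x, t) \in ring `*` [set: R]) = (x \in ring).
    by apply/idP/idP; rewrite !inE; [case|move=> h; split].
  by rewrite tT; case: ifP.
have h := integral_mkcondl (lb_abs exS (family_lb mf t)) K ring F.
apply: etrans (esym h) _; congr integral.
apply/setIidPl => x; rewrite /ring /K /cball/= => /andP[_ /ltW h2].
by apply: (le_trans h2); rewrite ler_pM2r// ler_nat.
Qed.

(** The test function changes with the step and with the number of steps, and each tested equation
    has its own null set. Only the steps T / (p + 1) are used, so that these null sets can be
    united. Outside the union t is fixed, the number of steps is adapted to t, and p tends to
    infinity. *)
Lemma cutoff_estimate : {ae leb R, forall t, t \in `]0, T[ ->
  (`|signed_integral setT (m t) (fun x => psi x * cutoff r x)|%:E <=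
   (5 * Num.sqrt S)%:E * approximation_error + (15 / r)%:E * annulus_flux)%E}.
Proof.
have [C' [h0 [C'0 h0p HS]]] := local_scheme (ltW T_gt0) r_gt0 C_gt0 delta_gt0 v0_gt0
  G0_ge0 L0_ge0 psi_C11 psi_le1 bk_smooth V_smooth V_ge lyapunov.
have S0 : 0 <= S by rewrite mulr_ge0 ?expR_ge0// divr_ge0 ?sqr_ge0// ltW.
have r2K : 2 * r <= 6 * r by rewrite ler_pM2r// ler_nat.
pose X t := lb_abs exS (family_lb mf t).
pose I0 := (\int[leb R]_(t in `[0%R, T]) X t K)%E.
have I0fin : (I0 < +oo)%E := difference_integrable cK.
pose A := approximation_error; pose J := annulus_flux.
pose bound h := ((C' * h)%:E * I0 + ((5 * Num.sqrt S)%:E * A + (15 / r)%:E * J))%E.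
pose hs (p : nat) := T / p.+1%:R.
have Hpn (pn : nat * nat) : {ae leb R, forall t, t \in `]0, T[ ->
    (2 <= pn.2)%N -> hs pn.1 <= h0 -> pn.2%:R * hs pn.1 <= T ->
    pn.2%:R * hs pn.1 - 2 * hs pn.1 <= t <= pn.2%:R * hs pn.1 - hs pn.1 ->
    (`|signed_integral setT (m t) (fun x => psi x * cutoff r x)|%:E <=
      (C' * hs pn.1)%:E * X t K + bound (hs pn.1))%E}.
  have hp : 0 < hs pn.1 by rewrite divr_gt0.
  move: (hs pn.1) hp => h hp.
  (* Parameters that violate a constraint make the claim vacuous; any property that holds almost
     everywhere then serves to conclude. *)
  have [n2|n2] := pselect (is_true (2 <= pn.2)%N); last first.
    by apply: leb_aeS (leb_ae_interior T) _ => t _ _ /n2.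
  have [hh|hh] := pselect (is_true (h <= h0)); last first.
    by apply: leb_aeS (leb_ae_interior T) _ => t _ _ _ /hh.
  have [nT|nT] := pselect (is_true (pn.2%:R * h <= T)); last first.
    by apply: leb_aeS (leb_ae_interior T) _ => t _ _ _ _ /nT.
  have [u [ut [ug [tu [cu cut cug] [utE ugE] out [e1 e2]]]]] := HS _ _ n2 hp hh nT.
  have t1T : pn.2%:R * h - h < T by apply: lt_le_trans nT; rewrite ltrBlDr ltrDl.
  (* The right-hand side of the scheme estimate for w = b, with the indicator of the ball dropped
     from the constant term and the others contained in [Gk] and [GJ]. *)
  pose W (z : ER) : R := C' * h + 5 * Num.sqrt S * Gk z + 15 / r * GJ z.
  have c5 : 0 <= 5 * Num.sqrt S by rewrite mulr_ge0 ?sqrtr_ge0.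
  have c15 : 0 <= 15 / r by rewrite divr_ge0// ltW.
  have Ch : 0 <= C' * h by rewrite mulr_ge0// ltW.
  have mW : measurable_fun setT (W : borel ER -> R).
    apply: measurable_funD; first apply: measurable_funD; first exact: measurable_cst.
      by apply: measurable_funM => //; exact: measurable_cst.
    by apply: measurable_funM => //; exact: measurable_cst.
  have W0 z : 0 <= W z by rewrite !addr_ge0// mulr_ge0.
  have HW x s : K x -> 0 <= s <= pn.2%:R * h - h ->
      `|ut (x, s) + dotp (slab_field T b (x, s)) (ug (x, s))| <= W (x, s).
    move=> Kx hsr; apply: (le_trans (e2 x s (slab_field T b (x, s)) hsr)); rewrite /W -/sf.
    apply: lerD.
      have [xr|xr] := boolP (enorm x < 2 * r); last first.
        by rewrite mul0r addr_ge0// mulr_ge0.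
      have Ux : U x by rewrite /U /eball/= subr0 (lt_le_trans xr).
      rewrite mul1r lerD2l /Gk patchE mem_set//=.
      by rewrite sqrtrM// le_eqVlt; apply/orP; left; apply/eqP; ring.
    rewrite /GJ patchE; have [xr|xr] := boolP (r < enorm x < 2 * r).
      by rewrite mul1r mem_set.
    by rewrite mul0r; case: ifP => _; rewrite mulr_ge0 ?enorm_ge0.
  have D := difference_bound b_borel sol1 sol2 r_gt0 r2K t1T tu cu cut cug utE ugE out mW W0 HW.
  apply: leb_aeS D _ => t Dt tT _ _ _ ht.
  have t01 : t \in `[0, pn.2%:R * h - h].
    by rewrite in_itv/=; move: tT ht; rewrite in_itv/= => /andP[/ltW-> _] /andP[_ ->].
  have tTc : t \in `[0, T].
    by move: tT; rewrite !in_itv/= => /andP[/ltW-> /ltW->].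
  have {}Dt := Dt t01.
  have int_c (f : E -> R) c : continuous f -> (forall x, `|f x| <= c) ->
      (X t).-integrable K (EFin \o f).
    move=> cf fc; apply: (lb_abs_bounded_integrable _ _ (c := c)) => //.
    by apply: measurable_funS (continuous_borel_real cf).
  have [Lp Lp0 Cphi] := cutoff_C11 (d := d) r_gt0.
  have phi01 (x : E) : 0 <= cutoff r x <= 1 by exact: cutoff_01.
  have [_ cphi _] : C1_grad (cutoff (d := d) r) (cutoff_grad r).
    by apply: (C11_C1_grad Lp0 Cphi (M := 1)) => x; have /andP[? ?] := phi01 x; rewrite ger0_norm.
  have cut' : continuous (fun x => u (x, t)).
    move=> x; apply: (@continuous_comp E ER R (fun x : E => (x, t)) u x); last exact: cu.
    by apply: (@cvg_pair _ _ _ (nbhs x) (nbhs x) (nbhs t) _ _ _ id (cst t));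
      [exact: cvg_id|exact: cvg_cst].
  have cpp : continuous (fun x => psi x * cutoff r x) by move=> x; exact: cvgM (psi_cont (x := x)) (cphi x).
  pose q x := psi x * cutoff r x - u (x, t).
  have cq : continuous q by move=> x; exact: cvgB (cpp x) (cut' x).
  have qb x : `|q x| <= C' * h by rewrite /q distrC; exact: e1.
  have outx x : ~ K x -> u (x, t) = 0 /\ cutoff r x = 0.
    rewrite /K /cball/= => /negP; rewrite -ltNge => /ltW xr.
    have xr2 : 2 * r <= enorm x by exact: le_trans xr.
    by have [-> _ _] := out (x, t) xr2; rewrite cutoff_out.
  have iq := int_c q _ cq qb.
  have iu : (X t).-integrable K (EFin \o (fun x => u (x, t))).
    have [M M0 HM] := compact_norm_bound cK (fun x _ => cut' x).
    apply: (lb_abs_bounded_integrable _ _ (c := M)) => //.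
    by apply: measurable_funS (continuous_borel_real cut').
  (* psi times the cut-off is u + q: the equation controls u, and q is at most C' h because t lies
     in the window of the scheme. *)
  have dec : signed_integral setT (m t) (fun x => psi x * cutoff r x) =
      signed_integral setT (m t) (fun x => u (x, t)) + signed_integral setT (m t) q.
    have := signed_integralD (exD := exS) (hm := family_lb mf t) mK (@subsetT _ K) _ _ iu iq.
    rewrite (_ : (fun x => u (x, t) + q x) = (fun x => psi x * cutoff r x)); last first.
      by apply/funext => x; rewrite /q addrC subrK.
    by apply=> x _ /outx[hu hc]; rewrite ?hu// /q hu hc mulr0 subr0.
  have Q1 : (`|signed_integral setT (m t) q|%:E <= (C' * h)%:E * X t K)%E.
    have := signed_integral_abs (exD := exS) (hm := family_lb mf t) mK (@subsetT _ K) _ iq.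
    move=> /(_ (fun x _ nK => ltac:(by have [hu hc] := outx x nK; rewrite /q hu hc mulr0 subr0))).
    move=> /le_trans; apply.
    rewrite -(integral_cst (X t) mK (C' * h)%:E); apply: (@ge0_le_integral _ _ _ (X t) K mK).
    - by move=> x _; rewrite lee_fin.
    - apply/measurable_EFinP/measurableT_comp => //.
      by apply: measurable_funS (continuous_borel_real cq).
    - exact: measurable_cst.
    - by move=> x _; rewrite lee_fin; exact: qb.
  have mGkE : measurable_fun setT (fun z : borel ER => (Gk z)%:E) by exact/measurable_EFinP.
  have mGJE : measurable_fun setT (fun z : borel ER => (GJ z)%:E) by exact/measurable_EFinP.
  have Gk0E z : (0 <= (Gk z)%:E)%E by rewrite lee_fin.
  have GJ0E z : (0 <= (GJ z)%:E)%E by rewrite lee_fin.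
  have innerW s : s \in `[0, T] -> (\int[abs_measure setT (m s)]_(x in K) (W (x, s))%:E =
     (C' * h)%:E * X s K + ((5 * Num.sqrt S)%:E * (\int[abs_measure setT (m s)]_(x in K) (Gk (x, s))%:E) +
     (15 / r)%:E * \int[abs_measure setT (m s)]_(x in K) (GJ (x, s))%:E))%E.
    move=> sT.
    have s1 : measurable_fun (K : set (borel E)) (fun x : borel E => (Gk (x, s))%:E).
      by apply: measurable_funS (section_borel s mGkE).
    have s2 : measurable_fun (K : set (borel E)) (fun x : borel E => (GJ (x, s))%:E).
      by apply: measurable_funS (section_borel s mGJE).
    pose k5 := (5 * Num.sqrt S)%:E; pose k15 := (15 / r)%:E.
    have k50 : (0 <= k5)%E by rewrite lee_fin.
    have k150 : (0 <= k15)%E by rewrite lee_fin.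
    have z1 := ge0_integralZl (X s) mK s1 (fun x _ => Gk0E (x, s)) k50.
    have z2 := ge0_integralZl (X s) mK s2 (fun x _ => GJ0E (x, s)) k150.
    have p1 x : K x -> (0 <= k5 * (Gk (x, s))%:E)%E by move=> _; exact: mule_ge0.
    have p2 x : K x -> (0 <= k15 * (GJ (x, s))%:E)%E by move=> _; exact: mule_ge0.
    have q1 : measurable_fun (K : set (borel E)) (fun x : borel E => (k5 * (Gk (x, s))%:E)%E) by exact: measurable_funeM.
    have q2 : measurable_fun (K : set (borel E)) (fun x : borel E => (k15 * (GJ (x, s))%:E)%E) by exact: measurable_funeM.
    have z3 := ge0_integralD (X s) mK p1 q1 p2 q2.
    have z4 := @ge0_integralD _ _ _ (X s) K mK (fun=> (C' * h)%:E)
      (fun x => (k5 * (Gk (x, s))%:E + k15 * (GJ (x, s))%:E)%E)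
      (fun _ _ => (Ch : (0 <= (C' * h)%:E)%E)) (measurable_cst _)
      (fun x Kx => adde_ge0 (p1 x Kx) (p2 x Kx)) (emeasurable_funD q1 q2).
    apply: etrans (etrans z4 (congr2 _ (integral_cst (X s) mK (C' * h)%:E)
      (etrans z3 (congr2 _ z1 z2)))).
    apply: (@eq_integral _ (borel E) R (X s) K
      (fun x => ((C' * h)%:E + (k5 * (Gk (x, s))%:E + k15 * (GJ (x, s))%:E))%E)
      (fun x => (W (x, s))%:E)) => x _.
    by rewrite /W -addrA.
  have mm1 : measurable_fun (`[0, T] : set (lebesgue_line R)) (fun s => X s K).
    have mI := lb_abs_integral_measurable mf cK (g := cst 1%E) (fun _ => lee01) (measurable_cst _).
    apply: eq_measurable_fun (measurable_funS measurableT (@subsetT _ _) mI) => s _.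
    apply: etrans (integral_cst (X s) mK 1) _; by rewrite mul1e.
  have mm2 : measurable_fun (`[0, T] : set (lebesgue_line R)) (fun s => \int[abs_measure setT (m s)]_(x in K) (Gk (x, s))%:E)%E.
    exact: (measurable_funS measurableT (@subsetT _ _) (lb_abs_integral_measurable mf cK Gk0E mGkE)).
  have mm3 : measurable_fun (`[0, T] : set (lebesgue_line R)) (fun s => \int[abs_measure setT (m s)]_(x in K) (GJ (x, s))%:E)%E.
    exact: (measurable_funS measurableT (@subsetT _ _) (lb_abs_integral_measurable mf cK GJ0E mGJE)).
  have nn1 s : (0 <= X s K)%E by exact: measure_ge0.
  have nn2 s : (0 <= \int[abs_measure setT (m s)]_(x in K) (Gk (x, s))%:E)%E.
    by apply: (@integral_ge0 _ _ _ (X s)) => x _; exact: Gk0E.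
  have nn3 s : (0 <= \int[abs_measure setT (m s)]_(x in K) (GJ (x, s))%:E)%E.
    by apply: (@integral_ge0 _ _ _ (X s)) => x _; exact: GJ0E.
  have outer : (\int[leb R]_(s in `[0%R, T]) \int[abs_measure setT (m s)]_(x in K) (W (x, s))%:E = bound h)%E.
    pose k5 := (5 * Num.sqrt S)%:E; pose k15 := (15 / r)%:E; pose kc := (C' * h)%:E.
    have k50 : (0 <= k5)%E by rewrite lee_fin.
    have k150 : (0 <= k15)%E by rewrite lee_fin.
    have kc0 : (0 <= kc)%E by rewrite lee_fin.
    pose aX s := X s K.
    pose aG s := (\int[abs_measure setT (m s)]_(x in K) (Gk (x, s))%:E)%E.
    pose aJ s := (\int[abs_measure setT (m s)]_(x in K) (GJ (x, s))%:E)%E.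
    have z0 := ge0_integralZl (leb R) mT (f := aX) mm1 (fun s _ => nn1 s) kc0.
    have z1 := ge0_integralZl (leb R) mT (f := aG) mm2 (fun s _ => nn2 s) k50.
    have z2 := ge0_integralZl (leb R) mT (f := aJ) mm3 (fun s _ => nn3 s) k150.
    have p0 s : `[0, T]%classic s -> (0 <= kc * aX s)%E by move=> _; exact: mule_ge0.
    have p1 s : `[0, T]%classic s -> (0 <= k5 * aG s)%E by move=> _; exact: mule_ge0 (nn2 s).
    have p2 s : `[0, T]%classic s -> (0 <= k15 * aJ s)%E by move=> _; exact: mule_ge0 (nn3 s).
    have q0 := measurable_funeM kc mm1.
    have q1 := measurable_funeM k5 mm2.
    have q2 := measurable_funeM k15 mm3.
    have z3 := @ge0_integralD _ (lebesgue_line R) R (leb R) _ mT (fun s => k5 * aG s)%E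
      (fun s => k15 * aJ s)%E p1 q1 p2 q2.
    have z4 := @ge0_integralD _ (lebesgue_line R) R (leb R) _ mT (fun s => kc * aX s)%E
      (fun s => k5 * aG s + k15 * aJ s)%E p0 q0
      (fun s sT => adde_ge0 (p1 s sT) (p2 s sT)) (emeasurable_funD q1 q2).
    have eG : (\int[leb R]_(s in `[0%R, T]) aG s)%E = A.
      by apply: eq_integral => s sT; exact: inner_Gk (set_mem sT).
    have eJ : (\int[leb R]_(s in `[0%R, T]) aJ s)%E = J.
      by apply: eq_integral => s sT; exact: inner_GJ (set_mem sT).
    rewrite eG in z1; rewrite eJ in z2.
    apply: etrans (etrans z4 (congr2 _ z0 (etrans z3 (congr2 _ z1 z2)))).
    by apply: eq_integral => s sT; exact: innerW (set_mem sT).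
  rewrite dec; apply: (@le_trans _ _ (`|signed_integral setT (m t) q|%:E + `|signed_integral setT (m t) (fun x => u (x, t))|%:E)%E).
    by rewrite -EFinD lee_fin addrC; exact: ler_normD.
  by apply: leeD => //; rewrite -outer.
apply: leb_aeS (leb_ae_countable Hpn) _ => t Ht tT.
have fX : (X t K < +oo)%E := lb_abs_lty exS (family_lb mf t) cK (@subsetT _ K) mK (@subset_refl _ K).
set B := ((5 * Num.sqrt S)%:E * approximation_error + _)%E.
set a := `|_|%R.
have [t0 tT'] : 0 < t /\ t < T by move: tT; rewrite in_itv/= => /andP[].
pose Q := fine (X t K) + fine I0.
have finX : X t K = (fine (X t K))%:E by rewrite fineK// ge0_fin_numE.
have I00 : (0 <= I0)%E by apply: integral_ge0 => s _; exact: measure_ge0.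
have finI : I0 = (fine I0)%:E by rewrite fineK// ge0_fin_numE.
(* The step must be admissible for the scheme, and two steps must fit between t and T. *)
have [p0 Hp0] : exists p0, forall p, (p0 <= p)%N -> T / p.+1%:R <= h0 /\ 2 * (T / p.+1%:R) <= T - t.
  have e0 : 0 < Num.min h0 ((T - t) / 2) / T.
    by rewrite divr_gt0// lt_min h0p divr_gt0// subr_gt0.
  have [p0 _ Hp] := near_infty_natSinv_lt (PosNum e0); exists p0 => p pp.
  have := Hp p pp; rewrite /= ltr_pdivlMr// lt_min => /andP[/ltW k1 /ltW k2].
  have -> : T / p.+1%:R = p.+1%:R^-1 * T by rewrite mulrC.
  by split => //; rewrite mulrC -ler_pdivlMr.
have main p : (p0 <= p)%N -> (a%:E <= (C' * Q * T / p.+1%:R)%:E + B)%E.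
  move=> pp; have [hh h2] := Hp0 p pp; set h := T / p.+1%:R in hh h2 *.
  have hp : 0 < h by rewrite divr_gt0.
  pose n := (Num.truncn (t / h)).+2.
  have th0 : 0 <= t / h by rewrite divr_ge0// ltW.
  have /andP[f1 f2] := truncn_itv th0.
  have g1 : (Num.truncn (t / h))%:R * h <= t by rewrite -ler_pdivlMr.
  have g2 : t <= ((Num.truncn (t / h))%:R + 1) * h.
    by rewrite natr1 -ler_pdivrMr// ltW.
  have nE : n%:R = (Num.truncn (t / h))%:R + 2 :> R by rewrite /n -addn2 natrD.
  have [b1 b2] := step_count_bounds g1 g2 h2 nE.
  apply: le_trans (Ht (p, n) tT isT hh b1 b2) _.
  rewrite /bound {1}finX finI addeA leeD2r// -!EFinM -EFinD lee_fin /Q /h /hs /=.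
  move: (p.+1%:R^-1) => z.
  by rewrite le_eqVlt; apply/orP; left; apply/eqP; ring.
(* The bound plus infinity leaves nothing to prove, and minus infinity contradicts the inequality at
   p0. *)
case: B main => [c| |] main; last 2 first.
- by rewrite leey.
- by have := main p0 (leqnn _); rewrite addeNy leeNy_eq.
rewrite lee_fin; apply: (@le_of_harmonic _ _ (C' * Q * T) _ p0) => p pp.
by have := main p pp; rewrite -EFinD lee_fin.
Qed.

End LimitEstimate.

(** * Removal of the approximation and of the spatial cut-off *)

Theorem theorem1p4 (R : realType) (d : nat) (d_gt0 : (0 < d)%N)
  (T : R) (T_gt0 : 0 < T)
  (b : 'rV[R]_d * R -> 'rV[R]_d)
  (b_borel : measurable_fun (slab T : set (borel ('rV[R]_d * R)%type))
               (b : borel ('rV[R]_d * R)%type -> borel 'rV[R]_d))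
  (nu : set 'rV[R]_d -> R) (nu_lb : locally_bounded_measure setT nu)
  (mu1 mu2 : set ('rV[R]_d * R) -> R) (mut1 mut2 : R -> set 'rV[R]_d -> R)
  (sol1 : cauchy_solution T b nu mu1 mut1)
  (sol2 : cauchy_solution T b nu mu2 mut2)
  (mut := fun t B => mut1 t B - mut2 t B)
  (growth :
    ((N%:R^-1)%:E * \int[leb R]_(t in `[0%R, T])
       \int[abs_measure setT (mut t)]_(x in [set x | N%:R < enorm x < 2 * N%:R]%R)
         (enorm (b (x, t)))%:E)%E @[N --> \oo] --> 0%E)
  (approx : forall (c : 'rV[R]_d) (r : R), 0 < r -> let U := eball c r in
    exists (C delta : R)
      (bk : nat -> 'rV[R]_d * R -> 'rV[R]_d) (V : nat -> 'rV[R]_d -> R),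
    [/\ 0 < C /\ 0 < delta,
        forall k, class_Coo (U `*` setT) (bk k),
        forall k, class_C 1 U (V k) /\ (forall x, U x -> 0 < V k x),
        0 < inf [set inf [set V k x | x in U] | k in setT] /\
        (forall k x t, U x -> t \in `[0, T] ->
           dotp (bk k (x, t)) (grad (V k) x) <=
           (C - delta * enorm (bk k (x, t)) ^+ 2
              - 2 * max_form (partials (fun y => bk k (y, t)) x)) * V k x)
      & (\int[leb R]_(t in `[0%R, T]) \int[abs_measure setT (mut t)]_(x in U)
           (enorm (bk k (x, t) - b (x, t)) * Num.sqrt (V k x))%R%:E)%E
           @[k --> \oo] --> 0%E]) :
  same_family T mut (fun _ _ => 0) /\ same_family T mut1 mut2.
Proof.
have mutE t : t \in `[0, T] -> difference_family T mut1 mut2 t = mut t.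
  by move=> tT; apply/funext => B; rewrite /difference_family !zero_extensionE.
pose mf := regular_difference sol1 sol2.
pose exS := @exhausts_space R d.
(* One null set for each pair of rational corners and each index of the bump; their union is still
   null. *)
have bump0 (q : nat * nat * nat) : {ae leb R, forall t, t \in `]0, T[ ->
    signed_integral setT (difference_family T mut1 mut2 t)
      (box_bump (rat_row q.1.1) (rat_row q.1.2) q.2) = 0}.
  set a := rat_row q.1.1; set a' := rat_row q.1.2; set psi := box_bump a a' q.2.
  have [G0 [L0 [g [G00 L00 Cpsi]]]] := box_bump_C11 a a' q.2.
  have [n0 Hn0] := box_bounded a a'.
  pose J N := annulus_flux T b mut1 mut2 N%:R.
  have JE N : J N = (\int[leb R]_(t in `[0%R, T])
       \int[abs_measure setT (mut t)]_(x in [set x | N%:R < enorm x < 2 * N%:R]%R)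
         (enorm (b (x, t)))%:E)%E.
    by apply: eq_integral => t /set_mem tT; rewrite mutE.
  have HN (N : nat) : {ae leb R, forall t, t \in `]0, T[ ->
      (`|signed_integral setT (difference_family T mut1 mut2 t)
         (fun x => psi x * cutoff N.+1%:R x)|%:E <= (15 / N.+1%:R)%:E * J N.+1)%E}.
    have N0 : 0 < N.+1%:R :> R by [].
    have r0 : 0 < 6 * N.+1%:R :> R by rewrite mulr_gt0.
    have [C [delta [bk [V [[C0 delta0] bks Vs [v0 lyap] lim]]]]] := approx 0 _ r0.
    set v := inf _ in v0.
    (* Positivity of the V_k makes 0 a lower bound of both sets of values; without lower bounds the
       infima would carry no information. *)
    have V_ge k x : eball 0 (6 * N.+1%:R) x -> v <= V k x.
      move=> Ux; apply: (@le_trans _ _ (inf [set V k x | x in eball 0 (6 * N.+1%:R)])).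
        apply: ge_inf; last by exists k.
        exists 0 => _ [j _ <-]; apply: lb_le_inf; first by exists (V j x); exists x.
        by move=> _ [y Uy <-]; apply: ltW; exact: (Vs j).2.
      apply: ge_inf; last by exists x.
      by exists 0 => _ [y Uy <-]; apply: ltW; exact: (Vs k).2.
    pose S := G0 ^+ 2 / v * expR (T * (scheme_rate N.+1%:R C delta + 2)).
    pose A k := approximation_error T b mut1 mut2 N.+1%:R (bk k) (V k).
    have Hk k := cutoff_estimate T_gt0 b_borel sol1 sol2 N0 C0 delta0 v0 G00 L00 Cpsi
      (@box_bump_le1 R d a a' q.2) (@continuous_box_bump R d a a' q.2) (bks k) (Vs k).1
      (V_ge k) (fun x t Ux tT => lyap k x t Ux tT).
    apply: leb_aeS (leb_ae_countable Hk) _ => t Ht tT.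
    (* k tends to infinity with N fixed, which is possible because [S] and the exceptional set of
       times do not depend on k. *)
    have limA : A k @[k --> \oo] --> 0%E.
      have AE k : A k = (\int[leb R]_(t in `[0%R, T]) \int[abs_measure setT (mut t)]_(x in eball 0 (6 * N.+1%:R))
           (enorm (bk k (x, t) - b (x, t)) * Num.sqrt (V k x))%R%:E)%E.
        by apply: eq_integral => s /set_mem sT; rewrite mutE.
      by under eq_fun do rewrite AE.
    have lim1 : ((5 * Num.sqrt S)%:E * A k + (15 / N.+1%:R)%:E * J N.+1)%E @[k --> \oo] -->
        (0 + (15 / N.+1%:R)%:E * J N.+1)%E.
      apply: cvgeD; [by []| |exact: cvg_cst].
      by rewrite -[X in _ --> X](mule0 (5 * Num.sqrt S)%:E); exact: cvgeZl.
    rewrite -[leRHS]add0e -(cvg_lim (@ereal_hausdorff R) lim1); apply: lime_ge.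
      by apply/cvg_ex; eexists; exact: lim1.
    by apply: nearW => k; exact: Ht.
  apply: leb_aeS (leb_ae_countable HN) _ => t Ht tT.
  apply/eqP; rewrite -normr_le0 -lee_fin.
  (* This is 15 times the expression in (i) with its index shifted by one; the shift keeps the
     radius N + 1 positive. *)
  have limJ : ((15 / N.+1%:R)%:E * J N.+1)%E @[N --> \oo] --> 0%E.
    have h0 : ((N%:R^-1)%:E * J N)%E @[N --> \oo] --> 0%E.
      have -> : (fun N : nat => ((N%:R^-1)%:E * J N)%E) = (fun N : nat => ((N%:R^-1)%:E *
          \int[leb R]_(t in `[0%R, T])
            \int[abs_measure setT (mut t)]_(x in [set x | N%:R < enorm x < 2 * N%:R]%R)
              (enorm (b (x, t)))%:E)%E) by apply/funext => N; rewrite JE.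
      exact: growth.
    have h : (15%:E * ((N%:R^-1)%:E * J N))%E @[N --> \oo] --> (15%:E * 0)%E.
      by apply: (cvgeZl _ h0).
    rewrite mule0 in h; have := h; rewrite -[X in X -> _](cvg_shiftS (fun N => (15%:E * ((N%:R^-1)%:E * J N))%E)) /=.
    by under eq_fun do rewrite muleA -EFinM.
  rewrite [leRHS](esym (cvg_lim (@ereal_hausdorff R) limJ)); apply: lime_ge.
    by apply/cvg_ex; eexists; exact: limJ.
  (* As soon as N + 1 reaches the radius of a ball containing the box, the cut-off equals 1 on the
     support of psi. *)
  near=> N.
  have nN : n0%:R <= N.+1%:R :> R.
    rewrite ler_nat; apply: leqW; near: N; exact: nbhs_infty_ge.
  have -> : psi = (fun x => psi x * cutoff N.+1%:R x).
    apply/funext => x; have [bx|bx] := pselect (box a a' x).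
      by rewrite cutoff_in ?mulr1// (le_trans (Hn0 _ bx)).
    by rewrite /psi box_bump_out// mul0r.
  exact: Ht.
have zero : {ae leb R, forall t, t \in `[0, T] ->
    forall B, bounded_borel setT B -> mut t B = 0}.
  apply: leb_aeS (leb_aeI (leb_ae_countable bump0) (leb_ae_interior T)) _ => t [Ht It] tT B bB.
  rewrite -mutE//; apply: (measure_eq0_of_bumps (family_lb mf t)) bB => n1 n2 k.
  exact: (Ht (n1, n2, k)) (It tT).
split; first exact: zero.
apply: leb_aeS zero _ => t Ht tT B bB.
by apply/eqP; rewrite -subr_eq0; apply/eqP; exact: Ht.
Unshelve. all: by end_near. Qed.
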